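(* Let $M^5\subset\mathbb C^4$ be a real analytic CR-generic submanifold that is maximally minimal (i.e. belongs to the General Class $\mathsf{III}_1$), and assume that the fundamental function $R$ is not identically zero; after relocalization, $M$ is considered near a point where $R\neq 0$, so that $R$ vanishes nowhere. Then the extrinsic biholomorphic equivalence problem (equivalently, the intrinsic CR-equivalence problem) for $M$ always reduces to an absolute parallelism on the $5$-dimensional base $M$ itself.
   Context: $M^5\subset\mathbb C^4$ is a local real analytic CR-generic submanifold of codimension $3$ through the origin, in coordinates $z=x+iy$, $w_j=u_j+iv_j$ ($j=1,2,3$), given as a graph $v_j=\varphi_j(x,y,u_1,u_2,u_3)$ with $\varphi_j$ real analytic, $\varphi_j(0)=0$, $d\varphi_j(0)=0$; $(x,y,u_1,u_2,u_3)$ are coordinates on $M$. $\overline{\mathcal L}$ is the unique local generator of $T^{0,1}M$ whose intrinsic expression is $\partial_{\overline z}$ plus a combination of $\partial_{u_1},\partial_{u_2},\partial_{u_3}$; $\mathcal L$ is its conjugate. Put $\mathcal T:=i[\mathcal L,\overline{\mathcal L}]$ (real), $\mathcal S:=[\mathcal L,\mathcal T]$, $\overline{\mathcal S}:=[\overline{\mathcal L},\mathcal T]$. $M$ is maximally minimal (belongs to the General Class $\mathsf{III}_1$) if $\{\overline{\mathcal S},\mathcal S,\mathcal T,\overline{\mathcal L},\mathcal L\}$ is a frame for $\mathbb C\otimes_{\mathbb R}TM$. The function $R$ is defined by $$[\mathcal L,\mathcal S]=P\mathcal T+Q\mathcal S+R\,\overline{\mathcal S}.$$ An absolute parallelism ($\{e\}$-structure)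 on a manifold is a coframe of $1$-forms. The equivalence problem ''reduces to an absolute parallelism on the base $M$'' if to each such $M$ is canonically associated (up to a finite choice, namely that of a local function $\mathbf A_0$ with $\mathbf A_0^2/\overline{\mathbf A}_0=R$) a coframe $\{\overline\sigma,\sigma,\rho,\overline\zeta,\zeta\}$ of $\mathbb C\otimes_{\mathbb R} T^*M$, with $\rho$ real, so that a local diffeomorphism between two such manifolds $M,M'$ is (the restriction of) a local biholomorphism, equivalently a CR-diffeomorphism, if and only if it carries the coframe of $M$ to the coframe of $M'$ (for suitable choices). *)

(* Defs.v *)
From HB Require Import structures.
From mathcomp Require Import all_boot all_order all_algebra.
From mathcomp Require Import all_classical all_reals all_analysis.
From mathcomp Require Import complex.

Set Implicit Arguments.
Unset Strict Implicit.
Unset Printing Implicit Defensive.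

Import Order.TTheory GRing.Theory Num.Theory numFieldNormedType.Exports.

Local Open Scope classical_set_scope.
Local Open Scope ring_scope.
Local Open Scope complex_scope.

Section RealAnalytic.
Context {R : realType}.

(** Absolutely convergent power series in n variables, with multi-indices
    exhausted by the boxes [0, N[^n. *)
Definition box_sum (n : nat) (c : {ffun 'I_n -> nat} -> R) (v : 'rV[R]_n)
    (N : nat) : R :=
  \sum_(k : {ffun 'I_n -> 'I_N})
    c [ffun i => (k i : nat)] * \prod_(i < n) v 0 i ^+ k i.

Definition analytic_at (n : nat) (f : 'rV[R]_n -> R) (a : 'rV[R]_n) : Prop :=
  exists (c : {ffun 'I_n -> nat} -> R) (r : R), 0 < r /\
    forall x : 'rV[R]_n, (forall i, `|x 0 i - a 0 i| < r) ->
      cvgn (box_sum (fun k => `|c k|) (map_mx Num.norm (x - a))) /\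
      box_sum c (x - a) @ \oo --> f x.

Definition vanalytic_at (n m : nat) (f : 'rV[R]_n -> 'rV[R]_m) (a : 'rV[R]_n)
    : Prop :=
  forall j, analytic_at (fun x => f x 0 j) a.

Definition canalytic_at (n : nat) (f : 'rV[R]_n -> R[i]) (a : 'rV[R]_n)
    : Prop :=
  analytic_at (fun x => complex.Re (f x)) a /\
  analytic_at (fun x => complex.Im (f x)) a.

(** [h] is a real analytic diffeomorphism from the open set [V] onto the open
    set [V']; the values of [h] outside [V] are irrelevant. *)
Definition analytic_diffeo (n : nat) (V V' : set 'rV[R]_n)
    (h : 'rV[R]_n -> 'rV[R]_n) : Prop :=
  [/\ open V, open V', h @` V = V', (forall p, V p -> vanalytic_at h p) &
    exists g : 'rV[R]_n -> 'rV[R]_n,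
      [/\ forall q, V' q -> vanalytic_at g q,
          forall p, V p -> g (h p) = p &
          forall q, V' q -> h (g q) = q]].

End RealAnalytic.

(** Complex vector fields and 1-forms on open subsets of R^5, with real
    coordinates (x, y, u_1, u_2, u_3) numbered 0, 1, 2, 3, 4.  A complex tangent
    vector is a row X (its components along d/dx, d/dy, d/du_k) and a covector
    is a column t, the pairing being [X *m t]. *)
Section ComplexFields.
Context {R : realType}.
Local Notation C := R[i].
Local Notation pt := 'rV[R]_5.

Definition cpartial (i : 'I_5) (f : pt -> C) (p : pt) : C :=
  'D_(delta_mx 0 i) (fun q => complex.Re (f q)) p +i*
  'D_(delta_mx 0 i) (fun q => complex.Im (f q)) p.

Definition apply_field (X : pt -> 'rV[C]_5) (f : pt -> C) (p : pt) : C :=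
  \sum_(i < 5) X p 0 i * cpartial i f p.

Definition bracket (X Y : pt -> 'rV[C]_5) (p : pt) : 'rV[C]_5 :=
  \row_k (apply_field X (fun q => Y q 0 k) p
          - apply_field Y (fun q => X q 0 k) p).

Definition conj_mx (m n : nat) (A : 'M[C]_(m, n)) : 'M[C]_(m, n) :=
  map_mx (@conjc R) A.

Definition conj_field (X : pt -> 'rV[C]_5) (p : pt) : 'rV[C]_5 :=
  conj_mx (X p).

(** Row convention: the differential of h at p sends X to [X *m cjacobian h p]. *)
Definition cjacobian (h : pt -> pt) (p : pt) : 'M[C]_5 :=
  map_mx (fun t : R => t%:C) (jacobian h p).

Definition pullback (h : pt -> pt) (theta : pt -> 'cV[C]_5) (p : pt)
    : 'cV[C]_5 :=
  cjacobian h p *m theta (h p).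

End ComplexFields.

(** Graphs M = { v = phi(x, y, u) } in C^4 = C_z x C_w^3, for phi defined on an
    open set D of R^5. *)
Section Graphs.
Context {R : realType}.
Local Notation C := R[i].
Local Notation pt := 'rV[R]_5.

Definition C4 : normedModType C := 'rV[C]_4.

Definition coord_u (j : 'I_3) : 'I_5 := rshift 2 j.

Definition graph_map (phi : pt -> 'rV[R]_3) (p : pt) : C4 :=
  row_mx (const_mx (p 0 0 +i* p 0 1) : 'rV[C]_1)
         (\row_(j < 3) (p 0 (coord_u j) +i* phi p 0 j)).

(** Row i is the image in C^4 of the i-th coordinate vector field; in other
    words column j is the differential on M of the j-th holomorphic coordinate
    of C^4. *)
Definition graph_diff (phi : pt -> 'rV[R]_3) (p : pt) : 'M[C]_(5, 4) :=
  \matrix_(i, j) cpartial i (fun q => graph_map phi q 0 j) p.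

(** T_F(p) M + J T_F(p) M = T_F(p) C^4. *)
Definition cr_generic_at (phi : pt -> 'rV[R]_3) (p : pt) : Prop :=
  forall Z : 'rV[C]_4, exists a b : 'rV[R]_5,
    Z = map_mx (fun t : R => t%:C) a *m graph_diff phi p
        + 'i *: (map_mx (fun t : R => t%:C) b *m graph_diff phi p).

(** Complex tangent vectors of M of type (0,1), i.e. those killed by
    dz, dw_1, dw_2, dw_3. *)
Definition T01 (phi : pt -> 'rV[R]_3) (p : pt) : set 'rV[C]_5 :=
  [set X | X *m graph_diff phi p = 0].

(** d/d(conj z) = (d/dx + i d/dy) / 2, plus the d/du_k components which the
    linear system [X *m graph_diff phi p = 0] imposes; see [fieldLbarP].  The
    formula is meaningful only where the block of the d/du_k is invertible. *)
Definition fieldLbar (phi : pt -> 'rV[R]_3) (p : pt) : 'rV[C]_5 :=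
  let dzbar : 'rV[C]_2 := \row_k (if k == 0 then 2^-1 else 'i / 2) in
  let G : 'M[C]_(2 + 3, 1 + 3) := graph_diff phi p in
  row_mx dzbar (- (dzbar *m ursubmx G) *m invmx (drsubmx G)).

Lemma row_mx_val (m n : nat) (A : 'rV[C]_m) (B : 'rV[C]_n) (k : 'I_(m + n))
    (j : 'I_m) : k = j :> nat -> row_mx A B 0 k = A 0 j.
Proof. by move=> e; rewrite (_ : k = lshift n j) ?row_mxEl //; exact: val_inj. Qed.

Lemma cpartial_coord (i k l : 'I_5) (p : pt) :
  cpartial i (fun q => q 0 k +i* q 0 l) p = (i == k)%:R +i* (i == l)%:R.
Proof.
have dco (m : 'I_5) : 'D_(delta_mx 0 i) (fun q : pt => q 0 m) p = (i == m)%:R.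
  have @f : {linear pt -> R}.
    by exists (fun N : pt => N 0 m); do 2![eexists]; do ?[constructor];
       rewrite ?mxE// => ? *; rewrite ?mxE//; move=> ?; rewrite !mxE.
  rewrite deriveE; last exact: differentiable_coord.
  rewrite (_ : (fun _ => _) = f)// diff_lin; last exact: coord_continuous.
  by rewrite /f /= !mxE eqxx /= eq_sym.
by rewrite /cpartial /= !dco.
Qed.

Lemma graph_diff_col0 (phi : pt -> 'rV[R]_3) (p : pt) (X : 'rV[C]_5) :
  (X *m graph_diff phi p) 0 0 = X 0 0 + 'i * X 0 1.
Proof.
have E i : graph_diff phi p i 0 = (i == 0)%:R +i* (i == 1)%:R.
  rewrite mxE -(cpartial_coord i 0 1 p); congr (cpartial _ _ p).
  by apply/funext => q; rewrite /graph_map (@row_mx_val 1 3 _ _ _ 0) ?mxE.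
rewrite mxE 2!big_ord_recl big1 ?addr0; last first.
  by move=> i _; rewrite E /= mulr0.
rewrite !E /= (_ : lift _ _ = 1); last exact: val_inj.
by rewrite mulr1 mulrC.
Qed.

Lemma fieldLbarP (phi : pt -> 'rV[R]_3) (p : pt) (X : 'rV[C]_5) :
  cr_generic_at phi p -> T01 phi p X -> X 0 0 = 2^-1 -> X = fieldLbar phi p.
Proof.
move=> gen; rewrite /T01 /= => XG X0.
have X1 : X 0 1 = 'i / 2.
  have /eqP := graph_diff_col0 phi p X.
  rewrite XG mxE X0 eq_sym addr_eq0 => /eqP e.
  by rewrite e mulrN mulrA -expr2 sqr_i mulN1r opprK.
pose G : 'M[C]_(2 + 3, 1 + 3) := graph_diff phi p.
have blk (Y : 'rV[C]_(2 + 3)) : rsubmx (Y *m G) =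
    lsubmx Y *m ursubmx G + rsubmx Y *m drsubmx G.
  rewrite -{1}(hsubmxK Y) -{1}(submxK G) mul_row_block.
  by rewrite row_mxKr.
have surj (e : 'rV[C]_3) : exists v : 'rV[C]_3, v *m drsubmx G = e.
  have [a [b]] := gen (row_mx (0 : 'rV[C]_1) e).
  rewrite scalemxAl -mulmxDl; set c : 'rV[C]_5 := (_ + _) => ec; clearbody c.
  pose Y : 'rV[C]_(2 + 3) := c - (2 * c 0 0) *: X.
  have c1 : c 0 0 + 'i * c 0 1 = 0.
    rewrite -(graph_diff_col0 phi p) -ec.
    by rewrite (@row_mx_val 1 3 _ _ _ 0) ?mxE.
  have YG : Y *m G = row_mx 0 e.
    by rewrite /Y mulmxBl -scalemxAl /G XG scaler0 subr0 -ec.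
  have lY : lsubmx Y = 0.
    apply/rowP => j; rewrite !mxE.
    have [->|->] : j = 0 \/ j = 1.
      by case: j => -[|[|//]] ?; [left|right]; exact: val_inj.
    - rewrite (_ : lshift 3 (0 : 'I_2) = 0 :> 'I_5); last exact: val_inj.
      by rewrite X0 mulrAC divff ?mul1r ?subrr// pnatr_eq0.
    - rewrite (_ : lshift 3 (1 : 'I_2) = 1 :> 'I_5); last exact: val_inj.
      have c01 : c 0 1 = 'i * c 0 0.
        have -> : c 0 0 = - ('i * c 0 1) by apply/eqP; rewrite -addr_eq0 c1.
        by rewrite mulrN mulrA -expr2 sqr_i mulN1r opprK.
      rewrite X1 c01 [2 * _]mulrC -mulrA (mulrCA 2) mulfV ?mulr1 ?pnatr_eq0//.
      by rewrite mulrC subrr.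
  exists (rsubmx Y).
  by move: (blk Y); rewrite YG row_mxKr lY mul0mx add0r => <-.
have uG : drsubmx G \in unitmx.
  rewrite -row_full_unit -sub1mx; apply/row_subP => i.
  by have [v <-] := surj (row i 1%:M); exact: submxMl.
rewrite /fieldLbar -/G; set d := (\row_k _).
have lX : lsubmx (X : 'rV[C]_(2 + 3)) = d.
  apply/rowP => j; rewrite !mxE.
  have [->|->] : j = 0 \/ j = 1.
    by case: j => -[|[|//]] ?; [left|right]; exact: val_inj.
  - by rewrite (_ : lshift 3 (0 : 'I_2) = 0 :> 'I_5) ?X0 //; exact: val_inj.
  - by rewrite (_ : lshift 3 (1 : 'I_2) = 1 :> 'I_5) ?X1 //; exact: val_inj.
have := blk X; rewrite /G XG lX => /esym/eqP.
have -> : @rsubmx C 1 1 3 0 = 0 by apply/rowP => j; rewrite !mxE.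
rewrite addrC addr_eq0 => /eqP e.
by rewrite -e mulmxK// -lX; exact: esym (@hsubmxK _ 1 2 3 X).
Qed.

Definition fieldL (phi : pt -> 'rV[R]_3) : pt -> 'rV[C]_5 :=
  conj_field (fieldLbar phi).

Definition fieldT (phi : pt -> 'rV[R]_3) (p : pt) : 'rV[C]_5 :=
  'i *: bracket (fieldL phi) (fieldLbar phi) p.

Definition fieldS (phi : pt -> 'rV[R]_3) : pt -> 'rV[C]_5 :=
  bracket (fieldL phi) (fieldT phi).

Definition fieldSbar (phi : pt -> 'rV[R]_3) : pt -> 'rV[C]_5 :=
  bracket (fieldLbar phi) (fieldT phi).

Definition frame_mx (phi : pt -> 'rV[R]_3) (p : pt) : 'M[C]_5 :=
  \matrix_(i < 5) [:: fieldSbar phi p; fieldS phi p; fieldT phi p;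
                      fieldLbar phi p; fieldL phi p]`_i.

(** General Class III_1, i.e. maximally minimal.  The condition on [fieldLbar]
    says that T^{0,1}M has a generator of the form d/d(conj z) + ... at p; it
    holds on a neighbourhood of 0 since dphi(0) = 0, and only bounds the size
    of D. *)
Definition class_III1 (D : set pt) (phi : pt -> 'rV[R]_3) : Prop :=
  [/\ open D /\ D 0,
      forall p, D p -> vanalytic_at phi p,
      phi 0 = 0 /\ jacobian phi 0 = 0,
      forall p, D p -> cr_generic_at phi p /\ T01 phi p (fieldLbar phi p) &
      forall p, D p -> frame_mx phi p \in unitmx].

(** The coefficient R in [L, S] = P T + Q S + R Sbar, read off as the first
    coordinate in the frame (Sbar, S, T, Lbar, L); see [fundRP]. *)
Definition fundR (phi : pt -> 'rV[R]_3) (p : pt) : C :=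
  (bracket (fieldL phi) (fieldS phi) p *m invmx (frame_mx phi p)) 0 0.

Lemma bracket_cst (X Y : pt -> 'rV[C]_5) (k : 'I_5) (a b : C) :
  (forall p, X p 0 k = a) -> (forall p, Y p 0 k = b) ->
  forall p, bracket X Y p 0 k = 0.
Proof.
have cst0 (Z : pt -> 'rV[C]_5) (c : C) p : apply_field Z (fun=> c) p = 0.
  rewrite /apply_field big1// => i _.
  by rewrite /cpartial !derive_cst mulr0.
move=> Xa Yb p; rewrite mxE.
rewrite (_ : (fun q => Y q 0 k) = fun=> b); last exact/funext.
by rewrite (_ : (fun q => X q 0 k) = fun=> a) ?cst0 ?subrr//; exact/funext.
Qed.

Lemma mulmx_rows5 (c a0 a1 a2 a3 a4 : 'rV[C]_5) :
  c *m (\matrix_(i < 5) [:: a0; a1; a2; a3; a4]`_i) =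
  c 0 0 *: a0 + c 0 1 *: a1 + c 0 2 *: a2 + c 0 3 *: a3 + c 0 4 *: a4.
Proof.
have o2 : lift ord0 (lift ord0 ord0) = 2 :> 'I_5 by apply: val_inj.
have o3 : lift ord0 (lift ord0 (lift ord0 ord0)) = 3 :> 'I_5.
  by apply: val_inj.
have o4 : lift ord0 (lift ord0 (lift ord0 (lift ord0 ord0))) = 4 :> 'I_5.
  by apply: val_inj.
have o1 : lift ord0 ord0 = 1 :> 'I_5 by apply: val_inj.
by rewrite mulmx_sum_row !big_ord_recl big_ord0 addr0 !rowK /= !addrA o4 o3 o2 o1.
Qed.

Lemma fundRP (phi : pt -> 'rV[R]_3) (p : pt) (r : C) :
  frame_mx phi p \in unitmx ->
  (exists P Q : C, bracket (fieldL phi) (fieldS phi) p =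
     P *: fieldT phi p + Q *: fieldS phi p + r *: fieldSbar phi p) <->
  r = fundR phi p.
Proof.
move=> uE.
have exp5 c := mulmx_rows5 c (fieldSbar phi p) (fieldS phi p) (fieldT phi p)
  (fieldLbar phi p) (fieldL phi p).
rewrite -/(frame_mx phi p) in exp5.
have half0 : (2^-1 : C) != 0 by rewrite invr_eq0 pnatr_eq0.
have Lb0 q : fieldLbar phi q 0 0 = 2^-1.
  by rewrite /fieldLbar (@row_mx_val 2 3 _ _ _ 0) ?mxE.
have Lb1 q : fieldLbar phi q 0 1 = 'i / 2.
  by rewrite /fieldLbar (@row_mx_val 2 3 _ _ _ 1) ?mxE.
have L0 q : fieldL phi q 0 0 = (2^-1)^*.
  by rewrite /fieldL /conj_field /conj_mx mxE Lb0.
have L1 q : fieldL phi q 0 1 = ('i / 2)^*.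
  by rewrite /fieldL /conj_field /conj_mx mxE Lb1.
have T0 q : fieldT phi q 0 0 = 0 by rewrite mxE (bracket_cst L0 Lb0) mulr0.
have T1 q : fieldT phi q 0 1 = 0 by rewrite mxE (bracket_cst L1 Lb1) mulr0.
have S0 : forall q, fieldS phi q 0 0 = 0 := bracket_cst L0 T0.
have S1 : forall q, fieldS phi q 0 1 = 0 := bracket_cst L1 T1.
have Sb0 : forall q, fieldSbar phi q 0 0 = 0 := bracket_cst Lb0 T0.
have Sb1 : forall q, fieldSbar phi q 0 1 = 0 := bracket_cst Lb1 T1.
have B0 := bracket_cst L0 S0 p; have B1 := bracket_cst L1 S1 p.
rewrite /fundR; move: B0 B1; set B := bracket (fieldL phi) (fieldS phi) p.
move: {exp5} (exp5) uE (Lb0 p) (Lb1 p) (L0 p) (L1 p) (T0 p) (T1 p) (S0 p) (S1 p)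
  (Sb0 p) (Sb1 p).
clearbody B; move: B (frame_mx phi p) => B F.
move: (fieldLbar phi p) (fieldL phi p) (fieldT phi p) (fieldS phi p)
  (fieldSbar phi p) => vLb vL vT vS vSb.
move=> exp5 uF {}Lb0 {}Lb1 {}L0 {}L1 {}T0 {}T1 {}S0 {}S1 {}Sb0 {}Sb1 B0 B1.
split=> [[P [Q e]]|->].
  pose c : 'rV[C]_5 := \row_i [:: r; Q; P; 0; 0]`_i.
  have -> : B = c *m F.
    rewrite exp5 !mxE /= !scale0r !addr0 e.
    by rewrite addrC [P *: _ + _]addrC addrA.
  by rewrite mulmxK// mxE.
have eB : B = (B *m invmx F) *m F by rewrite mulmxKV.
move: (B *m invmx F) eB => c eB.
have z j := congr1 (fun M : 'rV_5 => M 0 j) (etrans (esym (exp5 c)) (esym eB)).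
have := z 0; rewrite !mxE Sb0 S0 T0 Lb0 L0 B0 !mulr0 !add0r => e0.
have := z 1; rewrite !mxE Sb1 S1 T1 Lb1 L1 B1 !mulr0 !add0r => e1.
have c34 : c 0 3 = - c 0 4.
  move: e0; rewrite conjc_inv (_ : (2%:R : C)^* = 2%:R); last first.
    by rewrite rmorph_nat.
  rewrite -mulrDl => /eqP; rewrite mulf_eq0 (negPf half0) orbF.
  by rewrite addr_eq0 => /eqP.
have c4 : c 0 4 = 0.
  have ci : ('i / 2 : C)^* = - ('i / 2).
    rewrite -mulNr rmorphM fmorphV rmorph_nat.
    by congr (_ * _); apply/eqP; rewrite eq_complex /= oppr0 !eqxx.
  move: e1; rewrite ci c34 mulNr mulrN -opprD => /eqP.
  have i2 : 'i / 2 != 0 :> C.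
    by rewrite mulf_neq0// eq_complex /= oner_eq0 andbF.
  by rewrite oppr_eq0 -mulr2n mulrn_eq0 /= mulf_eq0 (negPf i2) orbF => /eqP.
exists (c 0 2), (c 0 1).
rewrite {1}eB exp5 c34 c4 oppr0 !scale0r !addr0.
by rewrite addrC (addrC (c 0 0 *: _)) addrA.
Qed.

(** The part of the graph over D on which R does not vanish. *)
Definition locus_R_neq0 (D : set pt) (phi : pt -> 'rV[R]_3) : set pt :=
  [set p | D p /\ fundR phi p != 0].

Definition choice_A0 (phi : pt -> 'rV[R]_3) (V : set pt) (A0 : pt -> C)
    : Prop :=
  forall p, V p -> canalytic_at A0 p /\ A0 p ^+ 2 / (A0 p)^* = fundR phi p.

(** A coframe (conj sigma, sigma, rho, conj zeta, zeta). *)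
Record coframe : Type := Coframe {
  sigma : pt -> 'cV[C]_5;
  rho : pt -> 'cV[C]_5;
  zeta : pt -> 'cV[C]_5 }.

Definition coframe_mx (theta : coframe) (p : pt) : 'M[C]_5 :=
  \matrix_(i, j) [:: conj_mx (sigma theta p); sigma theta p; rho theta p;
                     conj_mx (zeta theta p); zeta theta p]`_j i 0.

Definition parallelism_on (V : set pt) (theta : coframe) : Prop :=
  forall p, V p ->
    [/\ forall i j, canalytic_at (fun q => coframe_mx theta q i j) p,
        conj_mx (rho theta p) = rho theta p &
        coframe_mx theta p \in unitmx].

Definition coframe_eq_at (theta theta' : coframe) (p : pt) : Prop :=
  [/\ sigma theta p = sigma theta' p, rho theta p = rho theta' p &
      zeta theta p = zeta theta' p].

Definition carries_at (h : pt -> pt) (theta theta' : coframe) (p : pt) : Prop :=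
  [/\ pullback h (sigma theta') p = sigma theta p,
      pullback h (rho theta') p = rho theta p &
      pullback h (zeta theta') p = zeta theta p].

(** [h], read in the coordinates of M and M', maps T^{0,1}M onto T^{0,1}M'. *)
Definition cr_map_on (phi phi' : pt -> 'rV[R]_3) (V : set pt) (h : pt -> pt)
    : Prop :=
  forall p, V p -> forall X : 'rV[C]_5,
    T01 phi p X <-> T01 phi' (h p) (X *m cjacobian h p).

(** [differentiable] is Frechet differentiability over the field C, hence
    holomorphy on the open sets [U] and [H @` U]. *)
Definition biholomorphism_on (U : set C4) (H : C4 -> C4) : Prop :=
  exists K : C4 -> C4,
    [/\ open U, open (H @` U),
        forall a, U a -> differentiable H a,
        forall b, (H @` U) b -> differentiable K b &
        forall a, U a -> K (H a) = a].

Definition restricts_biholomorphism_on (phi phi' : pt -> 'rV[R]_3)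
    (V : set pt) (h : pt -> pt) : Prop :=
  forall p, V p -> exists (U : set C4) (H : C4 -> C4),
    [/\ biholomorphism_on U H, U (graph_map phi p) &
      forall q, V q -> U (graph_map phi q) ->
        H (graph_map phi q) = graph_map phi' (h q)].

End Graphs.

Arguments coframe : clear implicits.

(* Main.v *)
(** The transport rule [R_(aL) = (a^2 / conj a) R_L] for a rescaled generator shows that
    [A_0^2 / conj A_0 = R] means exactly that the field [E = L / A_0] has [R_E = 1].  A
    CR-diffeomorphism sends [L] to [f L'], hence [E] to a field of the same kind; brackets
    being natural, it sends the frame (Sbar, S, T, Ebar, E) built from [E] to the one built
    on the target, and the dual coframe is the desired parallelism.  Conversely a map which
    carries the coframes carries [Ebar], which generates T^(0,1).  As
    [A_0^2 / conj A_0 = R] amounts to [A_0^3 = R^2 conj R], there are three local choices.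

    A biholomorphism restricts to a CR map by the chain rule.  For the converse, the
    components of a CR map are real analytic CR functions; in the complexification of [M]
    they depend only on the holomorphic coordinates of [C^4], so they extend
    holomorphically, and the extension is invertible by the inverse function theorem.

    Complex analyticity in several variables is handled through [majorized r f a]: [f] is
    generated from constants and coordinates by sums, products and limits of series, with
    a bound [a] on the l^1 norm of its coefficients weighted by the polyradii [r]. *)

Require Import Defs.
From HB Require Import structures.
From mathcomp Require Import all_boot all_order all_algebra.
From mathcomp Require Import all_classical all_reals all_analysis.
From mathcomp Require Import complex ring lra.
Import Order.TTheory GRing.Theory Num.Theory numFieldNormedType.Exports.
Import ComplexField.Normc.
Local Open Scope classical_set_scope.
Local Open Scope ring_scope.
Local Open Scope complex_scope.

Set Implicit Arguments.
Unset Strict Implicit.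
Unset Printing Implicit Defensive.

(** * Complex moduli and convergence *)

(** The conjugate in [A_0^2 / conj A_0 = R] is a first obstacle: the equation is not holomorphic in
    [A_0], and solving it analytically or counting its solutions becomes possible only after it is
    traded for the cubic one. A second obstacle is that the definitions speak of box sums, Frechet
    derivatives and real partial derivatives, none of which composes well. Hence the analysis is
    carried by derivations of [majorized]: composition is an induction on the derivation, and
    Hadamard's lemma [f(z) = f_0 + sum z_j q_j], whose quotients have explicit majorants, takes the
    place of Cauchy integrals and of term-by-term differentiation. Taylor estimates, smallness near
    a zero, contraction constants and division by a variable are read off from it; coefficients
    appear only in the translation from and to [analytic_at]. On the geometric side, rescaling the
    generator acts on the frame by a triangular matrix, so the transport of [R] is decided by
    leading coefficients, and naturality of iterated brackets requires relatedness on whole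
    neighbourhoods. *)

Section ComplexModulus.
Context {R : realType}.
Local Notation C := R[i].

(** The norm [|z|] is an element of [C]; a modulus with values in [R] keeps radii, majorants and
    error bounds in an ordered field with suprema. *)
Definition cabs (z : C) : R := normc z.

Lemma cabsE z : (cabs z)%:C = `|z|. Proof. by case: z. Qed.
Lemma cabs_ge0 z : 0 <= cabs z. Proof. by case: z => a b; exact: sqrtr_ge0. Qed.
Lemma cabs0 : cabs 0 = 0. Proof. exact: normc0. Qed.
Lemma cabs1 : cabs 1 = 1. Proof. exact: normc1. Qed.
Lemma cabsM x y : cabs (x * y) = cabs x * cabs y. Proof. exact: normcM. Qed.
Lemma cabsV x : cabs x^-1 = (cabs x)^-1. Proof. exact: normcV. Qed.
Lemma cabsN x : cabs (- x) = cabs x. Proof. exact: normcN. Qed.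
Lemma cabsD x y : cabs (x + y) <= cabs x + cabs y.
Proof. exact: le_normcD. Qed.
Lemma cabsBC x y : cabs (x - y) = cabs (y - x).
Proof. by rewrite -cabsN opprB. Qed.
Lemma cabsX x n : cabs (x ^+ n) = cabs x ^+ n.
Proof. by elim: n => [|n IH]; rewrite ?expr0 ?cabs1// !exprS cabsM IH. Qed.
Lemma cabs_eq0 x : (cabs x == 0) = (x == 0).
Proof. by apply/eqP/eqP => [/eq0_normc|->]; [|exact: cabs0]. Qed.
Lemma cabs_le0 x : cabs x <= 0 -> x = 0.
Proof. by move=> h; apply/eqP; rewrite -cabs_eq0 eq_le h cabs_ge0. Qed.
Lemma cabs_conj x : cabs x^* = cabs x.
Proof. by apply: complexI; rewrite !cabsE normcJ. Qed.
Lemma cabs_real (x : R) : cabs x%:C = `|x|.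
Proof. by rewrite /cabs /= expr0n /= addr0 sqrtr_sqr. Qed.
Lemma cabs_Re z : `|complex.Re z| <= cabs z.
Proof.
case: z => a b; rewrite /cabs /= -sqrtr_sqr ler_sqrt; last first.
  by rewrite addr_ge0// sqr_ge0.
by rewrite lerDl sqr_ge0.
Qed.
Lemma cabs_Im z : `|complex.Im z| <= cabs z.
Proof.
case: z => a b; rewrite /cabs /= -sqrtr_sqr ler_sqrt; last first.
  by rewrite addr_ge0// sqr_ge0.
by rewrite lerDr sqr_ge0.
Qed.
Lemma cabsE1 : cabs 'i = 1.
Proof. by rewrite /cabs /= expr0n /= add0r expr1n sqrtr1. Qed.
Lemma cabs_le z : cabs z <= `|complex.Re z| + `|complex.Im z|.
Proof.
by rewrite {1}[z]complexE (le_trans (cabsD _ _))// cabsM !cabs_real cabsE1 mul1r.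
Qed.
Lemma cabs_sum (I : Type) (s : seq I) (P : pred I) (F : I -> C) :
  cabs (\sum_(i <- s | P i) F i) <= \sum_(i <- s | P i) cabs (F i).
Proof.
elim/big_ind2: _ => // [|x a y b xa yb]; first by rewrite cabs0.
exact: le_trans (cabsD _ _) (lerD xa yb).
Qed.

Lemma cabs_small z : (forall e : R, 0 < e -> cabs z <= e) -> z = 0.
Proof.
by move=> h; apply: cabs_le0; apply/ler_addgt0Pr => e e0; rewrite add0r h.
Qed.

Lemma cabs_lim_uniq z (a : R) : 0 <= a ->
  (forall e : R, 0 < e -> cabs z <= a * e) -> z = 0.
Proof.
move=> a0 h; apply: cabs_small => e e0.
have a1 : 0 < a + 1 by rewrite ltr_wpDl.
apply: le_trans (h (e / (a + 1)) _) _; first by rewrite divr_gt0.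
by rewrite mulrCA ger_pMr// ler_pdivrMr// mul1r lerDl.
Qed.

(** Convergence with real error bounds, free of any topology on [C]; [cconvP] connects it with
    limits of real sequences. *)
Definition cconv (u : nat -> C) (l : C) : Prop :=
  forall e : R, 0 < e -> exists N, forall n, (N <= n)%N -> cabs (u n - l) <= e.

Lemma cconv_uniq u l l' : cconv u l -> cconv u l' -> l = l'.
Proof.
move=> ul ul'; apply/eqP; rewrite -subr_eq0; apply/eqP/cabs_small => e e0.
have e2 : 0 < e / 2 by rewrite divr_gt0.
have [N HN] := ul _ e2; have [N' HN'] := ul' _ e2.
have := HN _ (leq_maxl N N'); have := HN' _ (leq_maxr N N').
set n := maxn _ _ => h1 h2.
have -> : l - l' = (u n - l') - (u n - l) by ring.
rewrite (le_trans (cabsD _ _))// cabsN [leRHS](splitr e).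
exact: lerD.
Qed.

Lemma cconv_le u l (b : R) : cconv u l -> (forall n, cabs (u n) <= b) ->
  cabs l <= b.
Proof.
move=> ul ub; apply/ler_addgt0Pr => e e0; have [N HN] := ul _ e0.
have -> : l = u N - (u N - l) by ring.
by rewrite (le_trans (cabsD _ _))// cabsN lerD// HN.
Qed.

Lemma eq_cconv u v l : u =1 v -> cconv u l -> cconv v l.
Proof. by move=> uv; rewrite (_ : u = v)//; exact/funext. Qed.

Lemma cconvD u v l m : cconv u l -> cconv v m ->
  cconv (fun n => u n + v n) (l + m).
Proof.
move=> ul vm e e0.
have e2 : 0 < e / 2 by rewrite divr_gt0.
have [N HN] := ul _ e2; have [N' HN'] := vm _ e2.
exists (maxn N N') => n; rewrite geq_max => /andP[h1 h2].
rewrite (_ : _ - _ = (u n - l) + (v n - m)); last by ring.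
by rewrite (le_trans (cabsD _ _))// [leRHS](splitr e) lerD ?HN ?HN'.
Qed.

Lemma cconvZ c u l : cconv u l -> cconv (fun n => c * u n) (c * l).
Proof.
move=> ul e e0.
have c1 : 0 < cabs c + 1 by rewrite ltr_wpDl// cabs_ge0.
have [|N HN] := ul (e / (cabs c + 1)); first by rewrite divr_gt0.
exists N => n /HN h; rewrite -mulrBr cabsM.
rewrite (@le_trans _ _ ((cabs c + 1) * (e / (cabs c + 1))))//; last first.
  by rewrite mulrCA divff ?mulr1// gt_eqF.
by rewrite ler_pM ?cabs_ge0// lerDl.
Qed.

Lemma cconv_cst l : cconv (fun=> l) l.
Proof. by move=> e e0; exists 0%N => n _; rewrite subrr cabs0 ltW. Qed.

Lemma cconv_sum (I : Type) (s : seq I) (u : I -> nat -> C) (l : I -> C) :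
  (forall i, cconv (u i) (l i)) ->
  cconv (fun n => \sum_(i <- s) u i n) (\sum_(i <- s) l i).
Proof.
move=> ul; elim: s => [|i s IH].
  by rewrite big_nil; apply: eq_cconv (cconv_cst _) => n; rewrite big_nil.
rewrite big_cons; apply: eq_cconv (cconvD (ul i) IH) => n.
by rewrite big_cons.
Qed.

Lemma cconv_conj u l : cconv u l -> cconv (fun n => (u n)^*) l^*.
Proof.
move=> ul e /ul[N HN]; exists N => n /HN.
by rewrite -rmorphB cabs_conj.
Qed.

Lemma cconvP u l : cconv u l <->
  (fun n => complex.Re (u n)) @ \oo --> complex.Re l /\
  (fun n => complex.Im (u n)) @ \oo --> complex.Im l.
Proof.
split=> [ul|[/cvgrPdist_le h1 /cvgrPdist_le h2] e e0].
  split; apply/cvgrPdist_le => e /ul[N HN]; near=> n.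
    rewrite distrC -raddfB (le_trans (cabs_Re _))// HN//.
    by near: n; exists N.
  rewrite distrC -raddfB (le_trans (cabs_Im _))// HN//.
  by near: n; exists N.
have e2 : 0 < e / 2 by rewrite divr_gt0.
have [N _ HN] := h1 _ e2; have [N' _ HN'] := h2 _ e2.
exists (maxn N N') => n; rewrite geq_max => /andP[/HN a1 /HN' a2].
rewrite (le_trans (cabs_le _))// [leRHS](splitr e) !raddfB/= lerD//.
  by rewrite distrC.
by rewrite distrC.
Unshelve. all: by end_near. Qed.

Lemma cvg_sumr (I : Type) (s : seq I) (u : I -> nat -> R) (l : I -> R) :
  (forall i, u i @ \oo --> l i) ->
  (fun n => \sum_(i <- s) u i n) @ \oo --> \sum_(i <- s) l i.
Proof.
move=> ul; elim: s => [|i s IH].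
  rewrite big_nil (_ : (fun n => _) = fun=> 0); first exact: cvg_cst.
  by apply/funext => n; rewrite big_nil.
rewrite big_cons (_ : (fun n => _) = fun n => u i n + \sum_(j <- s) u j n).
  exact: cvgD.
by apply/funext => n; rewrite big_cons.
Qed.

(** The bound [s] is replaced by the exact sum [t]: inequalities between finite combinations of such
    sums then pass to the limit, which a mere bound does not allow. *)
Lemma real_series_sup (nu : nat -> R) (s : R) : (forall m, 0 <= nu m) ->
  (forall n, \sum_(m < n) nu m <= s) ->
  exists2 t, t <= s & (forall n, \sum_(m < n) nu m <= t) /\
    (fun n => \sum_(m < n) nu m) @ \oo --> t.
Proof.
move=> nu0 nus; set u := (fun n : nat => \sum_(m < n) nu m).
have nd : nondecreasing_seq u.
  apply/nondecreasing_seqP => n; rewrite /u big_ord_recr /= lerDl; exact: nu0.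
have cu : cvgn u.
  by apply: nondecreasing_is_cvgn => //; exists s => _ [n _ <-]; exact: nus.
exists (limn u).
  by apply: limr_le => //; exact: nearW.
by split => // n; exact: (nondecreasing_cvgn_le nd cu n).
Qed.

Lemma cconv_series (u : nat -> C) (nu : nat -> R) (s : R) :
  (forall m, cabs (u m) <= nu m) -> (forall n, \sum_(m < n) nu m <= s) ->
  exists l, cconv (fun n => \sum_(m < n) u m) l.
Proof.
move=> unu nus.
have nu0 m : 0 <= nu m := le_trans (cabs_ge0 _) (unu m).
(* One argument serves both components: [p] is the real or the imaginary part. *)
have cv (p : C -> R) : {morph p : x y / x + y} -> p 0 = 0 ->
    (forall z, `|p z| <= cabs z) -> cvgn (fun n => p (\sum_(m < n) u m)).
  move=> pD p0 pn.
  rewrite (_ : (fun n => p _) = series (fun m => p (u m))); last first.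
    by apply/funext => n; rewrite (big_morph p pD p0) /series /= big_mkord.
  apply: normed_cvg; apply: (@series_le_cvg _ _ nu) => //.
    by move=> n; exact: normr_ge0.
    by move=> n; exact: le_trans (pn _) (unu n).
  have [t _ [_ h]] := real_series_sup nu0 nus.
  apply: (cvgP t); rewrite (_ : series nu = (fun n => \sum_(m < n) nu m))//.
  by apply/funext => n; rewrite /series /= big_mkord.
exists (limn (fun n => complex.Re (\sum_(m < n) u m)) +i*
        limn (fun n => complex.Im (\sum_(m < n) u m))).
apply/cconvP; split; apply: cv => //.
- by move=> x y; rewrite raddfD.
- exact: cabs_Re.
- by move=> x y; rewrite raddfD.
- exact: cabs_Im.
Qed.

End ComplexModulus.

(** * Majorized power series *)

Section Majorized.
Context {R : realType}.
Local Notation C := R[i].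

Definition polydisc (I : Type) (r : I -> R) (z : I -> C) : Prop :=
  forall i, cabs (z i) <= r i.

(** A proof of [majorized r f a] is a recipe for [f], so a closure property is one induction with
    five cases. In [maj_lim] the sum is required to be [f] on the polydisc only; the values
    elsewhere are free. *)
Inductive majorized (I : Type) (r : I -> R) : ((I -> C) -> C) -> R -> Prop :=
| maj_cst c : majorized r (fun=> c) (cabs c)
| maj_var i : majorized r (fun z => z i) (r i)
| maj_add f g a b : majorized r f a -> majorized r g b ->
    majorized r (fun z => f z + g z) (a + b)
| maj_mul f g a b : majorized r f a -> majorized r g b ->
    majorized r (fun z => f z * g z) (a * b)
| maj_lim F nu f s : (forall m : nat, majorized r (F m) (nu m)) ->
    (forall n, \sum_(m < n) nu m <= s) ->
    (forall z, polydisc r z -> cconv (fun n => \sum_(m < n) F m z) (f z)) ->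
    majorized r f s.

Section Basics.
Variables (I : Type) (r : I -> R).
Hypothesis r0 : forall i, 0 <= r i.

Lemma majorized_ge0 f a : majorized r f a -> 0 <= a.
Proof.
elim=> [c|i|????????|????????|F nu ? s _ _ ns _].
- exact: cabs_ge0.
- exact: r0.
- exact: addr_ge0.
- exact: mulr_ge0.
- by have := ns 0%N; rewrite big_ord0.
Qed.

Lemma majorized_bound f a z : majorized r f a -> polydisc r z ->
  cabs (f z) <= a.
Proof.
move=> fa rz; elim: fa => [c|i|f1 g a1 b _ fa _ gb|f1 g a1 b _ fa _ gb|
    F nu f1 s _ Fn ns cv] //=.
- exact: le_trans (cabsD _ _) (lerD fa gb).
- by rewrite cabsM ler_pM ?cabs_ge0.
- apply: cconv_le (cv _ rz) _ => n.
  by rewrite (le_trans (cabs_sum _ _ _))// (le_trans _ (ns n))// ler_sum.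
Qed.

(** The series [f, 0, 0, ...] and one use of [maj_lim] give two liberties at once: a larger bound,
    and other values outside the polydisc. *)
Lemma majorized_le f g a b : majorized r f a -> a <= b ->
  (forall z, polydisc r z -> f z = g z) -> majorized r g b.
Proof.
move=> fa ab fg.
pose F m := if m is 0 then f else fun=> 0.
pose nu m := if m is 0 then a else cabs (0 : C).
apply: (@maj_lim _ _ F nu) => [[|m]//|[|n]|z rz].
- exact: maj_cst.
- by rewrite big_ord0 (le_trans (majorized_ge0 fa)).
- by rewrite big_ord_recl /= big1 ?addr0// => i _; exact: cabs0.
- move=> e e0; exists 1%N => -[//|n] _.
  by rewrite big_ord_recl /= big1 ?addr0// fg// subrr cabs0 ltW.
Qed.

Lemma majorized_ext f g a : majorized r f a ->
  (forall z, polydisc r z -> f z = g z) -> majorized r g a.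
Proof. by move=> fa; exact: majorized_le fa _. Qed.

Lemma majorized_cst c a : cabs c <= a -> majorized r (fun=> c) a.
Proof. by move=> ca; exact: majorized_le (maj_cst r c) ca _. Qed.

Lemma majorized_var i a : r i <= a -> majorized r (fun z => z i) a.
Proof. by move=> ra; exact: majorized_le (maj_var r i) ra _. Qed.

Lemma majorizedZ c f a : majorized r f a ->
  majorized r (fun z => c * f z) (cabs c * a).
Proof. exact: maj_mul (maj_cst r c). Qed.

Lemma majorizedN f a : majorized r f a -> majorized r (fun z => - f z) a.
Proof.
move=> /(majorizedZ (-1)); rewrite cabsN cabs1 mul1r => h.
by apply: majorized_ext h _ => z _; rewrite mulN1r.
Qed.

Lemma majorizedB f g a b : majorized r f a -> majorized r g b ->
  majorized r (fun z => f z - g z) (a + b).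
Proof. by move=> fa /majorizedN; exact: maj_add. Qed.

Lemma majorized_sum (T : Type) (s : seq T) (P : pred T) f a :
  (forall t, majorized r (f t) (a t)) ->
  majorized r (fun z => \sum_(t <- s | P t) f t z) (\sum_(t <- s | P t) a t).
Proof.
move=> fa; elim: s => [|t s IH].
  rewrite big_nil; apply: majorized_ext (@majorized_cst 0 0 _) _ => [|z _].
    by rewrite cabs0.
  by rewrite big_nil.
rewrite big_cons; case: ifP => Pt; last first.
  by apply: majorized_ext IH _ => z _; rewrite big_cons Pt.
by apply: majorized_ext (maj_add (fa t) IH) _ => z _; rewrite big_cons Pt.
Qed.

Lemma majorizedX f a n : majorized r f a ->
  majorized r (fun z => f z ^+ n) (a ^+ n).
Proof.
move=> fa; elim: n => [|n IH].
  by rewrite expr0 -cabs1; exact: maj_cst.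
rewrite exprS; apply: majorized_ext (maj_mul fa IH) _ => z _.
by rewrite exprS.
Qed.

Lemma majorized_prod (T : Type) (s : seq T) (P : pred T) f a :
  (forall t, majorized r (f t) (a t)) ->
  majorized r (fun z => \prod_(t <- s | P t) f t z) (\prod_(t <- s | P t) a t).
Proof.
move=> fa; elim: s => [|t s IH].
  rewrite big_nil; apply: majorized_ext (@majorized_cst 1 1 _) _ => [|z _].
    by rewrite cabs1.
  by rewrite big_nil.
rewrite big_cons; case: ifP => Pt; last first.
  by apply: majorized_ext IH _ => z _; rewrite big_cons Pt.
by apply: majorized_ext (maj_mul (fa t) IH) _ => z _; rewrite big_cons Pt.
Qed.

Lemma majorized_series F nu s : (forall m : nat, majorized r (F m) (nu m)) ->
  (forall n, \sum_(m < n) nu m <= s) ->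
  exists2 f, majorized r f s & forall z, polydisc r z ->
     cconv (fun n => \sum_(m < n) F m z) (f z).
Proof.
move=> Fn ns.
have /choice[f fP] : forall z, exists l, polydisc r z ->
    cconv (fun n => \sum_(m < n) F m z) l.
  move=> z; have [rz|nrz] := pselect (polydisc r z); last by exists 0 => /nrz.
  have [l ll] := cconv_series (fun m => majorized_bound (Fn m) rz) ns.
  by exists l.
by exists f => //; apply: maj_lim Fn ns _ => z rz; exact: fP.
Qed.

End Basics.

(** Substitution in the derivation of [f]: the majorant [r i] of [g i] is exactly the weight of the
    variable [i] in [f], so the bound does not change. *)
Lemma majorized_comp (I J : Type) (r : I -> R) (s : J -> R) f a
    (g : I -> (J -> C) -> C) : (forall i, 0 <= r i) -> (forall j, 0 <= s j) ->
  majorized r f a -> (forall i, majorized s (g i) (r i)) ->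
  majorized s (fun w => f (fun i => g i w)) a.
Proof.
move=> r0 s0 fa gr.
elim: fa => [c|i|f1 f2 a1 b _ fa _ gb|f1 f2 a1 b _ fa _ gb|
    F nu f1 t _ Fn nt cv] //=.
- exact: maj_cst.
- exact: maj_add.
- exact: maj_mul.
- apply: (maj_lim Fn) => // z sz; apply: cv => i.
  exact: majorized_bound (gr i) sz.
Qed.

(** Conjugating both argument and value conjugates the coefficients. At real points the result is
    the conjugate of [f], so conjugates of analytic functions will be analytic. *)
Lemma majorized_conj (I : Type) (r : I -> R) f a : majorized r f a ->
  majorized r (fun z => (f (fun i => (z i)^*))^*) a.
Proof.
elim=> [c|i|f1 f2 a1 b _ fa _ gb|f1 f2 a1 b _ fa _ gb|
    F nu f1 t _ Fn nt cv] //=.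
- by rewrite -cabs_conj; exact: maj_cst.
- rewrite (_ : (fun z => _) = fun z => z i); last first.
    by apply/funext => z; rewrite conjcK.
  exact: maj_var.
- rewrite (_ : (fun z => _) = fun z => (f1 (fun i => (z i)^*))^* + (f2 (fun i => (z i)^*))^*).
    exact: maj_add.
  by apply/funext => z; rewrite rmorphD.
- rewrite (_ : (fun z => _) = fun z => (f1 (fun i => (z i)^*))^* * (f2 (fun i => (z i)^*))^*).
    exact: maj_mul.
  by apply/funext => z; rewrite rmorphM.
- apply: (maj_lim Fn) => // z sz.
  apply: eq_cconv (cconv_conj (cv (fun i => (z i)^*) _)).
    by move=> n; rewrite rmorph_sum.
  by move=> i; rewrite cabs_conj.
Qed.

(* Hadamard's lemma; the l^1 norm splits exactly along the decomposition, so
   that the constants do not deteriorate in the induction. *)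
Lemma majorized_split (I : Type) (J : finType) (r : I + J -> R) f a :
  (forall k, 0 <= r k) -> (forall j, 0 < r (inr j)) -> majorized r f a ->
  exists (f0 : (I -> C) -> C) (m0 : R) (q : J -> (I + J -> C) -> C) (m : J -> R),
    [/\ majorized (r \o inl) f0 m0, forall j, majorized r (q j) (m j),
        m0 + \sum_j r (inr j) * m j <= a &
        forall z, polydisc r z ->
          f z = f0 (z \o inl) + \sum_j z (inr j) * q j z].
Proof.
move=> r0 rJ; have rl0 i : 0 <= (r \o inl) i by exact: r0.
have lift f0 m0 : majorized (r \o inl) f0 m0 ->
    majorized r (fun z => f0 (z \o inl)) m0.
  move=> h; apply: (majorized_comp _ _ h) => // i; exact: (maj_var r (inl i)).
have D0 : majorized r (fun=> 0) 0 by apply: majorized_cst => //; rewrite cabs0.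
elim=> [c|[i|i]|f1 f2 a1 b _ [f0 [m0 [q [m [fm qm le fE]]]]] _
    [g0 [n0 [p [n [gn pn le' gE]]]]]|
    f1 f2 a1 b f1a [f0 [m0 [q [m [fm qm le fE]]]]] f2b
    [g0 [n0 [p [n [gn pn le' gE]]]]]|
    F nu f1 t Fn IH nt cv] /=.
- exists (fun=> c), (cabs c), (fun _ _ => 0), (fun=> 0); split=> //.
  + exact: maj_cst.
  + by rewrite big1 ?addr0// => j _; rewrite mulr0.
  + by move=> z _; rewrite big1 ?addr0// => j _; rewrite mulr0.
- exists (fun z => z i), (r (inl i)), (fun _ _ => 0), (fun=> 0); split=> //.
  + exact: (maj_var (r \o inl) i).
  + by rewrite big1 ?addr0// => j _; rewrite mulr0.
  + by move=> z _; rewrite big1 ?addr0// => j _; rewrite mulr0.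
- exists (fun=> 0), 0, (fun j _ => (j == i)%:R), (fun j => (j == i)%:R).
  split=> //.
  + by apply: majorized_cst => //; rewrite cabs0.
  + move=> j; apply: majorized_cst => //.
    by case: eqP => _; rewrite ?mulr1n ?mulr0n ?cabs0 ?cabs1.
  + rewrite add0r (bigD1 i)//= eqxx mulr1 big1 ?addr0//.
    by move=> j /negPf ->; rewrite mulr0.
  + move=> z _; rewrite add0r (bigD1 i)//= eqxx mulr1 big1 ?addr0//.
    by move=> j /negPf ->; rewrite mulr0.
- exists (fun z => f0 z + g0 z), (m0 + n0), (fun j z => q j z + p j z),
    (fun j => m j + n j); split=> [|j||z rz].
  + exact: maj_add.
  + exact: maj_add.
  + apply: le_trans (lerD le le'); rewrite addrACA lerD2l -big_split /=.
    by apply: ler_sum => j _; rewrite mulrDr.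
  + rewrite fE// gE// addrACA -big_split /=; congr (_ + _).
    by apply: eq_bigr => j _; rewrite mulrDr.
(* An asymmetric product rule: [f2] stays whole next to [q j], so the total weight is
   [m0 (n0 + sum r n) + (sum r m) b], at most [a1 * b], and nothing is lost. *)
- exists (fun z => f0 z * g0 z), (m0 * n0),
    (fun j z => q j z * f2 z + f0 (z \o inl) * p j z),
    (fun j => m j * b + m0 * n j); split=> [|j||z rz].
  + exact: maj_mul.
  + by apply: maj_add; apply: maj_mul => //; exact: lift.
  + have b0 := majorized_ge0 r0 f2b.
    have m00 := majorized_ge0 rl0 fm.
    apply: le_trans (ler_wpM2r b0 le); rewrite mulrDl.
    rewrite (eq_bigr (fun j => r (inr j) * m j * b + m0 * (r (inr j) * n j))).
      rewrite big_split/= -mulr_suml -mulr_sumr addrCA addrC -mulrDr addrC.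
      by rewrite [leRHS]addrC lerD2l ler_wpM2l.
    by move=> j _; ring.
  + rewrite {1}fE// mulrDl {1}gE// mulrDr -addrA; congr (_ + _).
    rewrite mulr_suml mulr_sumr -big_split; apply: eq_bigr => j _ /=.
    ring.
- have /choice[X HX] : forall k, exists X : ((I -> C) -> C) * R * (J -> (I + J -> C) -> C) * (J -> R),
    [/\ majorized (r \o inl) X.1.1.1 X.1.1.2,
        forall j, majorized r (X.1.2 j) (X.2 j),
        X.1.1.2 + \sum_j r (inr j) * X.2 j <= nu k &
        forall z, polydisc r z ->
          F k z = X.1.1.1 (z \o inl) + \sum_j z (inr j) * X.1.2 j z].
    by move=> k; have [f0 [m0 [q [m h]]]] := IH k; exists (f0, m0, q, m).
  pose m0 k := (X k).1.1.2; pose m k := (X k).2.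
  pose f0 k := (X k).1.1.1; pose q k := (X k).1.2.
  have m00 k : 0 <= m0 k by have [h _ _ _] := HX k; exact: majorized_ge0 h.
  have mk0 k j : 0 <= m k j.
    by have [_ h _ _] := HX k; exact: majorized_ge0 (h j).
  have s0 k : 0 <= \sum_j r (inr j) * m k j.
    by apply: sumr_ge0 => j _; rewrite mulr_ge0.
  have b0 n : \sum_(k < n) m0 k <= t.
    apply: le_trans (nt n); apply: ler_sum => k _.
    by have [_ _ + _] := HX k; apply: le_trans; rewrite lerDl s0.
  (* The majorants of the quotients are summable because [r (inr j) * m k j <= nu k]; a positive
     radius permits the division. *)
  have b1 j n : \sum_(k < n) m k j <= t / r (inr j).
    rewrite ler_pdivlMr// mulr_suml; apply: le_trans (nt n).
    apply: ler_sum => k _; have [_ _ + _] := HX k; apply: le_trans.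
    apply: ler_wpDl; first exact: m00.
    rewrite (bigD1 j)//= mulrC lerDl.
    by apply: sumr_ge0 => i _; rewrite mulr_ge0//; exact: mk0.
  have [t0 _ [t0b t0l]] := real_series_sup m00 b0.
  have /choice[t1 t1P] : forall j, exists t1,
      (forall n, \sum_(k < n) m k j <= t1) /\
      (fun n : nat => \sum_(k < n) m k j) @ \oo --> t1.
    move=> j; have [t1 _ h] := real_series_sup (fun k => mk0 k j) (b1 j).
    by exists t1.
  have [g0 g0m g0c] : exists2 g0, majorized (r \o inl) g0 t0 & forall z, polydisc (r \o inl) z ->
     cconv (fun n => \sum_(k < n) f0 k z) (g0 z).
    by apply: majorized_series t0b => // k; have [] := HX k.
  have /choice[p pP] : forall j, exists p, majorized r p (t1 j) /\ forall z, polydisc r z ->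
     cconv (fun n => \sum_(k < n) q k j z) (p z).
    move=> j; have [] := @majorized_series _ r (fun k => q k j) (fun k => m k j) (t1 j).
    + by move=> k; have [_ h _ _] := HX k; exact: h.
    + by move=> n; exact: (t1P j).1.
    + by move=> p pm pc; exists p.
  exists g0, t0, p, t1; split=> [//|j||z rz].
  + exact: (pP j).1.
  (* [t0] and the [t1 j] are exact sums, so the inequality between partial sums passes to the
     limit. *)
  + have h : (fun n : nat => \sum_(k < n) m0 k + \sum_j r (inr j) * \sum_(k < n) m k j)
        @ \oo --> t0 + \sum_j r (inr j) * t1 j.
      apply: cvgD => //; apply: cvg_sumr => j.
      by apply: cvgMl_tmp; exact: (t1P j).2.
    rewrite -(cvg_lim _ h)//; apply: limr_le; first by apply: cvgP h.
    apply: nearW => n; apply: le_trans (nt n).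
    under [X in _ + X <= _]eq_bigr do rewrite mulr_sumr.
    rewrite exchange_big -big_split /=; apply: ler_sum => k _.
    by have [] := HX k.
  + apply: cconv_uniq (cv _ rz) _.
    have rl : polydisc (r \o inl) (z \o inl) by move=> i; exact: rz.
    apply: eq_cconv (cconvD (g0c _ rl) (cconv_sum _ (fun j => cconvZ (z (inr j)) ((pP j).2 _ rz)))).
    move=> n /=; under [X in _ + X = _]eq_bigr do rewrite mulr_sumr.
    rewrite exchange_big -big_split /=; apply: eq_bigr => k _.
    by have [_ _ _ ->] := HX k.
Qed.

End Majorized.

(** * Derivatives of majorized series *)

Section Taylor.
Context {R : realType}.
Local Notation C := R[i].

Lemma majorized_restrict (I : Type) (r s : I -> R) f a :
  (forall i, 0 <= s i) -> (forall i, s i <= r i) -> majorized r f a ->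
  majorized s f a.
Proof.
move=> s0 sr fa; have r0 i : 0 <= r i := le_trans (s0 i) (sr i).
by apply: (majorized_comp r0 s0 fa) => i; apply: majorized_var.
Qed.

Definition sumfun (I J : Type) (T : Type) (x : I -> T) (y : J -> T) (k : I + J) : T :=
  match k with inl i => x i | inr j => y j end.

Lemma polydisc_sumfun (I J : Type) (r : I -> R) (s : J -> R) (x : I -> C)
  (y : J -> C) : polydisc r x -> polydisc s y ->
  polydisc (sumfun r s) (sumfun x y).
Proof. by move=> rx sy [i|j] /=; [exact: rx|exact: sy]. Qed.

Lemma polydisc0 (I : Type) (r : I -> R) : (forall i, 0 <= r i) ->
  polydisc r (fun=> 0).
Proof. by move=> r0 i; rewrite cabs0. Qed.

Section Hadamard.
Variables (I : finType) (r s : I -> R).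
Hypotheses (r0 : forall i, 0 <= r i) (s0 : forall i, 0 < s i).

(** Hadamard's split of [f (x + h)] in the doubled variables [(x, h)], along the block [h]; the
    radii [r] and [s] add up to those of [f], and setting [h = 0] identifies the constant part with
    [f x]. *)
Lemma majorized_increment f a : majorized (fun i => r i + s i) f a ->
  exists (q : I -> (I + I -> C) -> C) (m : I -> R),
    [/\ forall i, majorized (sumfun r s) (q i) (m i),
        \sum_i s i * m i <= a &
        forall x h, polydisc r x -> polydisc s h ->
          f (fun i => x i + h i) = f x + \sum_i h i * q i (sumfun x h)].
Proof.
move=> fa.
have s0' i : 0 <= s i by exact: ltW.
have rs0 k : 0 <= sumfun r s k by case: k => i /=.
have Fa : majorized (sumfun r s)
    (fun w => f (fun i => w (inl i) + w (inr i))) a.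
  apply: (majorized_comp _ rs0 fa) => i; first exact: addr_ge0.
  exact: (maj_add (maj_var (sumfun r s) (inl i)) (maj_var (sumfun r s) (inr i))).
have [//|f0 [m0 [q [m [f0m qm le fE]]]]] := majorized_split rs0 _ Fa.
exists q, m; split => //.
  apply: le_trans le; rewrite lerDr; exact: majorized_ge0 f0m.
move=> x h rx sh.
have f0x : f0 x = f x.
  have := fE _ (polydisc_sumfun rx (polydisc0 s0')).
  rewrite /= big1 ?addr0; last by move=> i _; rewrite mul0r.
  rewrite (_ : (fun i => x i + 0) = x); first by move=> ->.
  by apply/funext => i; rewrite addr0.
by have := fE _ (polydisc_sumfun rx sh) => /= ->; congr (_ + _).
Qed.

(** A second split, now of the quotients of [majorized_increment], isolates the partial derivatives
    [D i]; what is left is quadratic in [h], with constant the sum of all second majorants. *)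
Lemma majorized_taylor1 f a : majorized (fun i => r i + s i) f a ->
  exists (D : I -> (I -> C) -> C) (m : I -> R) (M : R),
    [/\ forall i, majorized r (D i) (m i), 0 <= M &
        forall x h, polydisc r x -> polydisc s h ->
        cabs (f (fun i => x i + h i) - f x - \sum_i h i * D i x) <=
          M * (\sum_i cabs (h i)) ^+ 2].
Proof.
move=> /majorized_increment[q [m [qm _ fE]]].
have s0' i : 0 <= s i by exact: ltW.
have rs0 k : 0 <= sumfun r s k by case: k => i /=.
have /choice[X HX] i : exists X : ((I -> C) -> C) * R * (I -> (I + I -> C) -> C) * (I -> R),
    [/\ majorized r X.1.1.1 X.1.1.2,
        forall j, majorized (sumfun r s) (X.1.2 j) (X.2 j) &
        forall z, polydisc (sumfun r s) z ->
          q i z = X.1.1.1 (z \o inl) + \sum_j z (inr j) * X.1.2 j z].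
  have [//|f0 [m0 [q' [m' [h1 h2 _ h3]]]]] := majorized_split rs0 _ (qm i).
  by exists (f0, m0, q', m').
have X0 i j : 0 <= (X i).2 j.
  by have [_ h _] := HX i; exact: majorized_ge0 (h j).
exists (fun i => (X i).1.1.1), (fun i => (X i).1.1.2),
  (\sum_i \sum_j (X i).2 j); split=> [i||x h rx sh].
- by have [] := HX i.
- by do 2![apply: sumr_ge0 => ? _].
rewrite fE// [f x + _ - _]addrAC subrr add0r -sumrB.
rewrite (_ : \sum_(i : I) _ = \sum_i \sum_j h i * h j * (X i).1.2 j (sumfun x h)).
  rewrite (le_trans (cabs_sum _ _ _))// mulr_suml ler_sum// => i _.
  rewrite (le_trans (cabs_sum _ _ _))// mulr_suml ler_sum// => j _.
  have [_ /(_ j) Xm _] := HX i.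
  have := majorized_bound Xm (polydisc_sumfun rx sh) => Xb.
  rewrite !cabsM mulrC ler_pM// ?mulr_ge0 ?cabs_ge0// expr2.
  have le1 k : cabs (h k) <= \sum_i cabs (h i).
    by rewrite (bigD1 k)//= lerDl sumr_ge0// => ? _; exact: cabs_ge0.
  by rewrite ler_pM ?cabs_ge0.
apply: eq_bigr => i _; have [_ _ /(_ _ (polydisc_sumfun rx sh)) ->] := HX i.
rewrite mulrDr /= addrAC subrr add0r mulr_sumr.
by apply: eq_bigr => j _; rewrite mulrA.
Qed.

End Hadamard.

Definition cderiv (I : finType) (f : (I -> C) -> C) (x : I -> C) (d : I -> C) :=
  forall e : R, 0 < e -> exists2 del : R, 0 < del &
    forall h : I -> C, (forall i, cabs (h i) <= del) ->
      cabs (f (fun i => x i + h i) - f x - \sum_i h i * d i) <=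
        e * \sum_i cabs (h i).

Lemma sum_single (I : finType) (k : I) (t : C) (d : I -> C) :
  \sum_i (if i == k then t else 0) * d i = t * d k.
Proof.
rewrite (bigD1 k)//= eqxx big1 ?addr0// => i /negPf ->; exact: mul0r.
Qed.

Lemma sum_cabs_single (I : finType) (k : I) (t : C) :
  \sum_i cabs (if i == k then t else 0) = cabs t.
Proof.
rewrite (bigD1 k)//= eqxx big1 ?addr0// => i /negPf ->; exact: cabs0.
Qed.

Lemma taylor_cderiv (I : finType) (s : I -> R) f x (d : I -> C) (M : R) :
  (forall i, 0 < s i) -> 0 <= M ->
  (forall h, polydisc s h -> cabs (f (fun i => x i + h i) - f x - \sum_i h i * d i) <=
     M * (\sum_i cabs (h i)) ^+ 2) ->
  cderiv f x d.
Proof.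
move=> s0 M0 fE e e0.
(* [N] exceeds the number of variables, so the l^1 norm of [h] is at most [N * del]; [M + 1] stands
   in the denominator because [M] may vanish. *)
pose N : R := 1 + \sum_(i : I) 1.
have N0 : 0 < N by rewrite ltr_wpDr// sumr_ge0.
have MN : 0 < (M + 1) * N by rewrite mulr_gt0// ltr_wpDl.
pose del := \big[Num.min/(e / ((M + 1) * N))]_i s i.
have d0 : 0 < del by rewrite /del; elim/big_ind: _ => // [|x1 y ? ?];
  rewrite ?divr_gt0// lt_min; apply/andP.
have dels i : del <= s i by exact: bigmin_le_cond.
have dele : del <= e / ((M + 1) * N) by exact: bigmin_le_id.
exists del => // h hd.
apply: le_trans (fE h _) _; first by move=> i; exact: le_trans (hd i) (dels i).
rewrite expr2 mulrA ler_wpM2r ?sumr_ge0// => [? _|]; first exact: cabs_ge0.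
apply: (@le_trans _ _ ((M + 1) * (N * del))).
  apply: ler_pM; rewrite ?lerDl//; first by rewrite sumr_ge0// => ? _; exact: cabs_ge0.
  rewrite /N mulrDl mul1r mulr_suml ler_wpDl ?(ltW d0)// ler_sum// => i _.
  by rewrite mul1r.
by rewrite mulrA mulrC -ler_pdivlMr.
Qed.

Lemma majorized_cderiv (I : finType) (r s : I -> R) f a :
  (forall i, 0 <= r i) -> (forall i, 0 < s i) ->
  majorized (fun i => r i + s i) f a ->
  exists (D : I -> (I -> C) -> C) (m : I -> R),
    (forall i, majorized r (D i) (m i)) /\
    (forall x, polydisc r x -> cderiv f x (fun i => D i x)).
Proof.
move=> r0 s0 /(majorized_taylor1 r0 s0)[D [m [M [Dm M0 fE]]]].
exists D, m; split=> // x rx; apply: (taylor_cderiv s0 M0) => h; exact: fE.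
Qed.

(** The case of [majorized_increment] where the base polydisc is the single point 0. *)
Lemma majorized_factor0 (I : finType) (r : I -> R) f a :
  (forall i, 0 < r i) -> majorized r f a -> f (fun=> 0) = 0 ->
  exists (q : I -> (I -> C) -> C) (m : I -> R),
    [/\ forall i, majorized r (q i) (m i),
        \sum_i r i * m i <= a &
        forall z, polydisc r z -> f z = \sum_i z i * q i z].
Proof.
move=> r0 fa f00.
have r0' i : 0 <= r i by exact: ltW.
have [//||q [m [qm le fE]]] := @majorized_increment I (fun=> 0) r _ r0 f a.
  by apply: majorized_restrict fa => i; rewrite add0r.
have sr0 (k : I + I) : 0 <= sumfun (fun=> 0) r k by case: k => i /=.
exists (fun i z => q i (sumfun (fun=> 0) z)), m; split=> //.
- move=> i; apply: (majorized_comp (g := fun (k : I + I) (z : I -> C) => sumfun (fun=> 0) z k) sr0 r0' (qm i)).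
  by case=> j /=; [apply: majorized_cst => //; rewrite cabs0|exact: maj_var].
- move=> z rz; have := fE (fun=> 0) z (polydisc0 _) rz.
  rewrite f00 add0r => <- //; congr f; apply/funext => i; exact: esym (add0r _).
Qed.

(** A zero at the origin makes the majorant linear in the radii. As [m] does not depend on [s],
    radii can be chosen afterwards to make the function as small as an argument demands. *)
Lemma majorized_small (I : finType) (r : I -> R) f a :
  (forall i, 0 < r i) -> majorized r f a -> f (fun=> 0) = 0 ->
  exists2 m : I -> R, forall i, 0 <= m i & forall s,
    (forall i, 0 <= s i <= r i) -> majorized s f (\sum_i s i * m i).
Proof.
move=> r0 fa f00; have [q [m [qm _ fE]]] := majorized_factor0 r0 fa f00.
have r0' i : 0 <= r i by exact: ltW.
exists m => [i|s sr]; first exact: majorized_ge0 (qm i).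
have s0 i : 0 <= s i by case/andP: (sr i).
have sr' i : s i <= r i by case/andP: (sr i).
apply: (majorized_ext s0 (f := fun z => \sum_i z i * q i z)); last first.
  by move=> z sz; rewrite fE// => i; exact: le_trans (sz i) (sr' i).
apply: majorized_sum => // i; apply: maj_mul; first exact: maj_var.
exact: majorized_restrict s0 sr' (qm i).
Qed.

(** Two successive factorizations; the second is possible because the vanishing derivative forces
    the linear coefficients [q i 0] to be zero. *)
Lemma majorized_small2 (I : finType) (r : I -> R) f a :
  (forall i, 0 < r i) -> majorized r f a -> f (fun=> 0) = 0 ->
  cderiv f (fun=> 0) (fun=> 0) ->
  exists2 m : I -> I -> R, forall i j, 0 <= m i j & forall s,
    (forall i, 0 <= s i <= r i) ->
    majorized s f (\sum_i s i * \sum_j s j * m i j).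
Proof.
move=> r0 fa f00 fd; have [q [m [qm _ fE]]] := majorized_factor0 r0 fa f00.
have r0' i : 0 <= r i by exact: ltW.
(* The coefficient is tested on increments along the real axis of the variable [i], of a length [t]
   small enough both for the derivative at 0 and for the continuity of [q i]. *)
have q00 i : q i (fun=> 0) = 0.
  pose g z := q i z - q i (fun=> 0).
  have ga : majorized r g (m i + cabs (q i (fun=> 0))).
    by apply: majorizedB => //; exact: maj_cst.
  have [m' m'0 gm'] := majorized_small r0 ga (subrr _).
  apply: (@cabs_lim_uniq _ _ (1 + m' i)) => [|e e0]; first exact: addr_ge0.
  have [d d0 hd] := fd _ e0.
  pose t := Num.min (Num.min d e) (r i).
  have t0 : 0 < t by rewrite !lt_min d0 e0 r0.
  have td : t <= d by rewrite !ge_min lexx.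
  have te : t <= e by rewrite !ge_min lexx orbT.
  have tr : t <= r i by rewrite ge_min lexx orbT.
  pose h k : C := if k == i then t%:C else 0.
  have ht w : t <= w -> forall k, cabs (h k) <= w.
    move=> tw k; rewrite /h; case: eqP => _; last by rewrite cabs0 (le_trans _ tw)// ltW.
    by rewrite cabs_real ger0_norm// ltW.
  have rh : polydisc r h.
    move=> k; rewrite /h; case: eqP => [->|_]; last by rewrite cabs0.
    by rewrite cabs_real ger0_norm// ltW.
  have h0 : (fun k => 0 + h k) = h by apply/funext => k; exact: add0r.
  have := hd h (ht _ td); rewrite f00 subr0 (_ : \sum_k h k * 0 = 0); last first.
    by rewrite big1// => k _; rewrite mulr0.
  rewrite subr0 h0 fE// sum_single sum_cabs_single cabsM mulrC.
  rewrite cabs_real gtr0_norm// ler_pM2r// => h1.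
  pose s k := if k == i then t else 0.
  have sb k : 0 <= s k <= r k.
    rewrite /s; case: eqP => [->|_]; last by rewrite lexx r0'.
    by rewrite tr ltW.
  have sh : polydisc s h.
    move=> k; rewrite /h /s; case: eqP => [_|_]; last by rewrite cabs0.
    by rewrite cabs_real ger0_norm// ltW.
  have := majorized_bound (gm' s sb) sh.
  rewrite (bigD1 i)//= big1 ?addr0 => [|k /negPf ki]; last by rewrite /s ki mul0r.
  rewrite /s eqxx /g => h2.
  have -> : q i (fun=> 0) = q i h - (q i h - q i (fun=> 0)) by ring.
  rewrite (le_trans (cabsD _ _))// cabsN mulrDl mul1r lerD//.
  by rewrite (le_trans h2)// mulrC ler_wpM2l.
have /choice[m' m'P] i : exists m' : I -> R, (forall j, 0 <= m' j) /\
    forall s, (forall i, 0 <= s i <= r i) -> majorized s (q i) (\sum_i s i * m' i).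
  by have [m' h1 h2] := majorized_small r0 (qm i) (q00 i); exists m'.
exists m' => [i j|s sr]; first by have [h _] := m'P i; exact: h.
have s0 i : 0 <= s i by case/andP: (sr i).
have sr' i : s i <= r i by case/andP: (sr i).
apply: (majorized_ext s0 (f := fun z => \sum_i z i * q i z)); last first.
  by move=> z sz; rewrite fE// => i; exact: le_trans (sz i) (sr' i).
apply: majorized_sum => // i; apply: maj_mul; first exact: maj_var.
by have [_ h] := m'P i; exact: h.
Qed.

End Taylor.

(** * The inverse function theorem *)

Section FixedPoint.
Context {R : realType}.
Local Notation C := R[i].

Lemma sum_geom_half (c : R) n : 0 <= c -> \sum_(m < n) c / 2 ^+ m <= 2 * c.
Proof.
move=> c0; suff -> : \sum_(m < n) c / 2 ^+ m = 2 * c - 2 * c / 2 ^+ n.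
  by rewrite gerBl divr_ge0// ?mulr_ge0// exprn_ge0.
elim: n => [|n IH]; first by rewrite big_ord0 expr0 divr1 subrr.
rewrite big_ord_recr /= IH exprS invfM.
have h2 : (2 : R) != 0 by rewrite pnatr_eq0.
by field; rewrite expf_neq0.
Qed.

Lemma half_powers_small (x c : R) : 0 <= c ->
  (forall n, x <= c / 2 ^+ n) -> x <= 0.
Proof.
move=> c0 h; rewrite leNgt; apply/negP => x0.
have [n xn] : exists n : nat, c / x < n%:R.
  exists (Num.truncn (c / x)).+1; exact: truncnS_gt.
have n2 : n%:R <= 2 ^+ n :> R by rewrite -natrX ler_nat ltnW// ltn_expl.
have := h n; rewrite ler_pdivlMr ?exprn_gt0// leNgt => /negP; apply.
rewrite mulrC -ltr_pdivrMr//; exact: lt_le_trans n2.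
Qed.

Lemma term_le_sum1 (J : finType) (F : J -> R) j : (forall k, 0 <= F k) ->
  F j <= 1 + \sum_k F k.
Proof.
move=> F0; apply: ler_wpDl => //; rewrite (bigD1 j)//= lerDl.
by apply: sumr_ge0.
Qed.

Section Contraction.
Variables (I J : finType) (rho : I -> R) (sg : R).
Variables (Phi : J -> (I + J -> C) -> C).
Hypotheses (rho0 : forall i, 0 <= rho i) (sg0 : 0 < sg).
Hypothesis Phi_small :
  forall j, majorized (sumfun rho (fun=> sg)) (Phi j) (sg / 4).

Let hs : R := sg / 2.
Let hs0 : 0 < hs. Proof. by rewrite /hs divr_gt0. Qed.

(** The reason for the bound [sg / 4]: with point and increment both of radius [hs = sg / 2],
    Hadamard's lemma gives [hs * sum m <= sg / 4], that is [sum m <= 1 / 2], so [Phi] contracts the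
    block [J] by one half. *)
Lemma Phi_increment j : exists (q : J -> ((I + J) + J -> C) -> C) (m : J -> R),
  [/\ forall k, majorized (sumfun (sumfun rho (fun=> hs)) (fun=> hs)) (q k) (m k),
      \sum_k m k <= 1 / 2 &
      forall x u h, polydisc rho x -> polydisc (fun=> hs) u ->
        polydisc (fun=> hs) h ->
        Phi j (sumfun x (fun k => u k + h k)) = Phi j (sumfun x u) +
          \sum_k h k * q k (sumfun (sumfun x u) h)].
Proof.
have r0 (k : I + J) : 0 <= sumfun rho (fun=> hs) k.
  by case: k => k //=; exact: ltW.
have r0' (k : I + J) : 0 <= sumfun rho (fun=> sg) k.
  by case: k => k //=; exact: ltW.
have s0 (k : (I + J) + J) : 0 <= sumfun (sumfun rho (fun=> hs)) (fun=> hs) k.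
  by case: k => k //=; exact: ltW.
pose g (k : I + J) (w : (I + J) + J -> C) : C :=
  match k with inl i => w (inl (inl i)) | inr k => w (inl (inr k)) + w (inr k) end.
pose r3 := sumfun (sumfun rho (fun _ : J => hs)) (fun _ : J => hs).
have gm k : majorized r3 (g k) (sumfun rho (fun=> sg) k).
  case: k => k /=; first exact: (maj_var r3 (inl (inl k))).
  have -> : sg = hs + hs by exact: splitr.
  exact: (maj_add (maj_var r3 (inl (inr k))) (maj_var r3 (inr k))).
have [//|f0 [m0 [q [m [f0m qm le fE]]]]] :=
  majorized_split s0 _ (majorized_comp r0' s0 (Phi_small j) gm).
exists q, m; split=> // [|x u h rx su sh].
  move: le; rewrite -mulr_sumr => le.
  rewrite -(ler_pM2l hs0); apply: le_trans (le_trans _ le) _.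
    by rewrite lerDr; exact: majorized_ge0 f0m.
  by rewrite le_eqVlt; apply/orP; left; apply/eqP; rewrite /hs; field.
pose z := polydisc0 (fun _ : J => ltW hs0).
have xu := polydisc_sumfun rx su.
have := fE _ (polydisc_sumfun xu sh); have := fE _ (polydisc_sumfun xu z).
rewrite /= [X in _ = _ + X]big1 ?addr0; last by move=> k _; rewrite mul0r.
have gE h' : (fun k => g k (sumfun (sumfun x u) h')) =
    sumfun x (fun k => u k + h' k) by apply/funext => -[].
rewrite !gE => e ->; congr (_ + _).
have -> : f0 (sumfun (sumfun x u) h \o inl) =
    Phi j (sumfun x (fun k => u k + 0)) by exact: esym e.
by congr (Phi j (sumfun x _)); apply/funext => k; rewrite addr0.
Qed.

Lemma Phi_lipschitz j x u h b : polydisc rho x -> polydisc (fun=> hs) u ->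
  polydisc (fun=> hs) h -> (forall k, cabs (h k) <= b) -> 0 <= b ->
  cabs (Phi j (sumfun x (fun k => u k + h k)) - Phi j (sumfun x u)) <= b / 2.
Proof.
move=> rx su sh hb b0; have [q [m [qm ms E]]] := Phi_increment j.
rewrite E// addrAC subrr add0r (le_trans (cabs_sum _ _ _))//.
apply: (@le_trans _ _ (\sum_k b * m k)).
  apply: ler_sum => k _; rewrite cabsM ler_pM ?cabs_ge0//.
  exact: majorized_bound (qm k) (polydisc_sumfun (polydisc_sumfun rx su) sh).
by rewrite -mulr_sumr ler_wpM2l// -div1r.
Qed.

Lemma hs_quarter : sg / 4 <= hs.
Proof.
rewrite /hs ler_pM2l//; rewrite lef_pV2 ?posrE//; by rewrite ler_nat.
Qed.

(** A solution in the polydisc [sg] automatically lies in [sg / 4], so the difference of two of them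
    lies in [hs], where the contraction halves it over and over. *)
Lemma contraction_uniq x v v' : polydisc rho x ->
  polydisc (fun=> sg) v -> polydisc (fun=> sg) v' ->
  (forall j, v j = Phi j (sumfun x v)) ->
  (forall j, v' j = Phi j (sumfun x v')) -> v = v'.
Proof.
move=> rx sv sv' vE vE'.
have r0' (k : I + J) : 0 <= sumfun rho (fun=> sg) k.
  by case: k => k //=; exact: ltW.
have q4 w : polydisc (fun=> sg) w -> (forall j, w j = Phi j (sumfun x w)) ->
    forall j, cabs (w j) <= sg / 4.
  move=> sw wE j; rewrite wE.
  exact: majorized_bound (Phi_small j) (polydisc_sumfun rx sw).
pose h k := v' k - v k.
have hb k : cabs (h k) <= hs.
  rewrite (le_trans (cabsD _ _))// cabsN.
  rewrite (_ : hs = sg / 4 + sg / 4) ?lerD ?q4//.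
  by rewrite /hs; field.
have step b : 0 <= b -> (forall k, cabs (h k) <= b) -> forall k, cabs (h k) <= b / 2.
  move=> b0 bh k; rewrite {1}/h vE' [v k]vE.
  have -> : v' = (fun k => v k + h k) by apply/funext => l; rewrite /h; ring.
  by apply: Phi_lipschitz => // l; exact: le_trans (q4 _ sv vE l) hs_quarter.
apply/funext => k; apply/eqP; rewrite -subr_eq0 -oppr_eq0 opprB -/(h k).
apply/eqP/cabs_le0; apply: (half_powers_small (ltW hs0)) => n.
elim: n k => [|n IH] k; first by rewrite expr0 divr1.
rewrite exprSr invfM mulrA; apply: step => //.
by rewrite divr_ge0 ?exprn_ge0// ltW.
Qed.

(** Picard iteration inside the class of majorized functions of the parameter [x]: the successive
    differences have geometric majorants, so the limit is again majorized, which is its analyticity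
    in [x]. *)
Lemma contraction_fixpoint : exists y : J -> (I -> C) -> C,
  (forall j, majorized rho (y j) hs) /\
  (forall x, polydisc rho x ->
     forall j, y j x = Phi j (sumfun x (fun k => y k x))).
Proof.
have r0' (k : I + J) : 0 <= sumfun rho (fun=> sg) k.
  by case: k => k //=; exact: ltW.
have r2 (k : I + J) : 0 <= sumfun rho (fun=> hs) k.
  by case: k => k //=; exact: ltW.
have r3 (k : (I + J) + J) : 0 <= sumfun (sumfun rho (fun=> hs)) (fun=> hs) k.
  by case: k => k //=; exact: ltW.
pose Y := fix Y n : J -> (I -> C) -> C :=
  if n is n'.+1 then fun j x => Phi j (sumfun x (fun k => Y n' k x))
  else fun _ _ => 0.
have sg4 : 0 <= sg / 4 by rewrite divr_ge0// ltW.
have Yn n : forall j, majorized rho (Y n j) (sg / 4).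
  elim: n => [|n IH] j /=; first by apply: majorized_cst => //; rewrite cabs0.
  pose g (k : I + J) (x : I -> C) := sumfun x (fun k => Y n k x) k.
  have gm k : majorized rho (g k) (sumfun rho (fun=> sg) k).
    case: k => k; first exact: maj_var.
    apply: majorized_le (IH k) _ _ => //.
    by rewrite ger_pMr// invf_le1// ler1n.
  exact: majorized_comp r0' rho0 (Phi_small j) gm.
have Yb n x : polydisc rho x -> polydisc (fun=> hs) (fun k => Y n k x).
  move=> rx k; exact: le_trans (majorized_bound (Yn n k) rx) hs_quarter.
(* The majorant of the difference between the iterates [n] and [n + 1]; these add up to at most
   [2 * (sg / 4) = hs]. *)
pose c n : R := (sg / 4) / 2 ^+ n.
have c0 n : 0 <= c n by rewrite divr_ge0// exprn_ge0.
have chs n : c n <= hs.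
  apply: le_trans hs_quarter; rewrite ger_pMr ?divr_gt0//.
  by rewrite invf_le1 ?exprn_gt0// exprn_ege1// ler1n.
have dn n : forall j, majorized rho (fun x => Y n.+1 j x - Y n j x) (c n).
  elim: n => [|n IH] j.
    apply: majorized_le (Yn 1 j) _ _ => //; first by rewrite /c expr0 divr1.
    by move=> z _; rewrite /= subr0.
  have [q [m [qm ms E]]] := Phi_increment j.
  pose d k x := Y n.+1 k x - Y n k x.
  pose g (k : (I + J) + J) (x : I -> C) :=
    sumfun (sumfun x (fun k => Y n k x)) (fun k => d k x) k.
  have gm k : majorized rho (g k) (sumfun (sumfun rho (fun=> hs)) (fun=> hs) k).
    case: k => [[k|k]|k]; first exact: maj_var.
      by apply: majorized_le (Yn n k) hs_quarter _.
    by apply: majorized_le (IH k) (chs n) _.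
  have qgm k := majorized_comp r3 rho0 (qm k) gm.
  have h := majorized_sum rho0 (index_enum J) xpredT (fun k => maj_mul (IH k) (qgm k)).
  apply: majorized_le h _ _ => //.
    have -> : c n.+1 = c n * (1 / 2) by rewrite /c exprSr invfM mulrA div1r.
    by rewrite -mulr_sumr; apply: ler_wpM2l.
  move=> x rx; rewrite -[LHS]/(\sum_k d k x * q k (sumfun (sumfun x (fun k => Y n k x)) (fun k => d k x))).
  have := E x (fun k => Y n k x) (fun k => d k x) rx (Yb n x rx) _.
  rewrite (_ : (fun k => Y n k x + d k x) = fun k => Y n.+1 k x); last first.
    by apply/funext => k; rewrite /d; ring.
  move=> e; rewrite [Y n.+2 j x]e; first by rewrite /=; ring.
  by move=> k; apply: majorized_bound (majorized_le rho0 (IH k) (chs n) _) rx.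
have Ysum n j x : \sum_(m < n) (Y m.+1 j x - Y m j x) = Y n j x.
  elim: n => [|n IH]; first by rewrite big_ord0.
  by rewrite big_ord_recr /= IH; ring.
have /choice[y yP] j : exists y, majorized rho y hs /\ forall x, polydisc rho x ->
    cconv (fun n => Y n j x) (y x).
  have [||y ym yc] := @majorized_series _ _ rho (fun n x => Y n.+1 j x - Y n j x) c hs.
  - by move=> n; exact: dn.
  - move=> n; rewrite (_ : hs = 2 * (sg / 4)); first exact: sum_geom_half.
    by rewrite /hs; field.
  - exists y; split=> // x rx; apply: eq_cconv (yc _ rx) => n /=.
    exact: Ysum.
exists y; split=> [j|x rx j]; first exact: (yP j).1.
(* The Lipschitz bound lets the limit pass through [Phi]; uniqueness of limits then gives the fixed
   point equation. *)
have cv : cconv (fun n => Y n.+1 j x) (Phi j (sumfun x (fun k => y k x))).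
  move=> e e0; pose d := Num.min e hs.
  have d0 : 0 < d by rewrite lt_min e0 hs0.
  have /choice[N HN] k : exists N, forall n, (N <= n)%N -> cabs (Y n k x - y k x) <= d.
    by have [N HN] := (yP k).2 x rx _ d0; exists N.
  exists (\max_k N k) => n nN.
  have hb k : cabs (y k x - Y n k x) <= d.
    by rewrite cabsBC; apply: HN; apply: leq_trans nN; exact: leq_bigmax.
  rewrite cabsBC /=.
  rewrite (_ : (fun k => y k x) = fun k => Y n k x + (y k x - Y n k x)); last first.
    by apply/funext => k; ring.
  apply: (@le_trans _ _ (d / 2)).
    apply: Phi_lipschitz => //; [exact: Yb| |exact: ltW].
    by move=> k; apply: le_trans (hb k) _; rewrite ge_min lexx orbT.
  apply: (@le_trans _ _ d); last by rewrite ge_min lexx.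
  by rewrite ger_pMr// invf_le1// ler1n.
apply: cconv_uniq cv => e e0.
have [N HN] := (yP j).2 x rx _ e0; exists N => n nN; apply: HN.
exact: leq_trans nN _.
Qed.

End Contraction.

(** With [B] the inverse of the Jacobian [D], solving [Psi(y) = x] amounts to solving
    [y = N(y) + x B], where [N(y) = y - Psi(y) B] has no linear part and is therefore quadratically
    small. This is a contraction with parameter [x]. *)
Lemma inverse_function (J : finType) (r : R) (Psi : J -> (J -> C) -> C)
    (a : J -> R) (D B : J -> J -> C) :
  0 < r -> (forall j, majorized (fun=> r) (Psi j) (a j)) ->
  (forall j, Psi j (fun=> 0) = 0) ->
  (forall j, cderiv (Psi j) (fun=> 0) (fun i => D i j)) ->
  (forall i j, \sum_k D i k * B k j = (i == j)%:R) ->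
  (forall i j, \sum_k B i k * D k j = (i == j)%:R) ->
  exists (s t : R) (U : J -> (J -> C) -> C),
    [/\ [/\ 0 < s, s <= r & 0 < t],
        forall j, majorized (fun=> t) (U j) s,
        forall x, polydisc (fun=> t) x ->
          forall j, Psi j (fun k => U k x) = x j &
        forall v, polydisc (fun=> s) v ->
          polydisc (fun=> t) (fun k => Psi k v) ->
          forall j, U j (fun k => Psi k v) = v j].
Proof.
move=> r0 Pa P0 PD DB BD.
have rr (i : J) : 0 <= r by exact: ltW.
pose N j (y : J -> C) := y j - \sum_k Psi k y * B k j.
pose aN j := r + \sum_k a k * cabs (B k j).
have Nm j : majorized (fun=> r) (N j) (aN j).
  apply: majorizedB => //; first exact: maj_var.
  by apply: majorized_sum => // k; apply: maj_mul => //; exact: maj_cst.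
have N0 j : N j (fun=> 0) = 0.
  by rewrite /N big1 ?subr0// => k _; rewrite P0 mul0r.
(* [D] and [B] are inverse to each other, so the linear parts of [y] and of [Psi(y) B] cancel. *)
have ND j : cderiv (N j) (fun=> 0) (fun=> 0).
  move=> e e0; pose Q := 1 + \sum_k cabs (B k j).
  have Q0 : 0 < Q by rewrite ltr_wpDr// sumr_ge0// => ? _; exact: cabs_ge0.
  have eQ : 0 < e / Q by rewrite divr_gt0.
  have /choice[d dP] k : exists d, 0 < d /\ forall h : J -> C,
      (forall i, cabs (h i) <= d) ->
      cabs (Psi k (fun i => 0 + h i) - Psi k (fun=> 0) - \sum_i h i * D i k) <=
        e / Q * \sum_i cabs (h i).
    by have [d d0 dh] := PD k _ eQ; exists d.
  have d0 k : 0 < d k by have [] := dP k.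
  exists (\big[Num.min/1]_k d k).
    by elim/big_ind: _ => // x y ? ?; rewrite lt_min; apply/andP.
  move=> h hd; rewrite (_ : _ - _ - _ =
      - \sum_k (Psi k (fun i => 0 + h i) - Psi k (fun=> 0) - \sum_i h i * D i k) * B k j).
    rewrite cabsN (le_trans (cabs_sum _ _ _))//.
    apply: (@le_trans _ _ (\sum_k (e / Q * \sum_i cabs (h i)) * cabs (B k j))).
      apply: ler_sum => k _; rewrite cabsM ler_wpM2r ?cabs_ge0//.
      have [_ ] := dP k; apply => i; apply: le_trans (hd i) _.
      exact: bigmin_le_cond.
    rewrite -mulr_sumr mulrAC ler_wpM2r ?sumr_ge0// => [? _|]; first exact: cabs_ge0.
    by rewrite mulrAC ler_pdivrMr// ler_pM2l// lerDr.
  rewrite N0 subr0 [\sum_i h i * 0]big1 ?subr0; last by move=> i _; rewrite mulr0.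
  have E : \sum_k (\sum_i h i * D i k) * B k j = h j.
    under eq_bigr do rewrite mulr_suml.
    rewrite exchange_big (bigD1 j)//= [X in _ + X]big1 => [|i ij].
      by rewrite addr0; under eq_bigr do rewrite -mulrA; rewrite -mulr_sumr DB eqxx mulr1.
    under eq_bigr do rewrite -mulrA.
    by rewrite -mulr_sumr DB (negPf ij) mulr0.
  under [in RHS]eq_bigr do rewrite P0 subr0 mulrBl.
  by rewrite sumrB E /N add0r opprB.
have /choice[m mP] j : exists m : J -> J -> R, (forall i k, 0 <= m i k) /\
    forall s, (forall i, 0 <= s i <= r) ->
    majorized s (N j) (\sum_i s i * \sum_k s k * m i k).
  have [m m0 h] := majorized_small2 (fun=> r0) (Nm j) (N0 j) (ND j).
  by exists m.
pose K := 1 + \sum_j \sum_i \sum_k m j i k.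
have m0 j i k : 0 <= m j i k by have [h _] := mP j; exact: h.
have K0 : 0 < K by rewrite ltr_wpDr// sumr_ge0// => j _; do 2![apply: sumr_ge0 => ? _].
pose Q := 1 + \sum_j \sum_k cabs (B k j).
have Q0 : 0 < Q.
  by rewrite ltr_wpDr// sumr_ge0// => j _; apply: sumr_ge0 => ? _; exact: cabs_ge0.
(* The contraction requires the bound [s / 4]. The quadratic part contributes at most
   [s * (s * K) <= s / 8], and the parameter part at most [t * Q = s / 8], which dictates [t]
   below. *)
pose s := Num.min r (1 / (8 * K)).
have s0 : 0 < s by rewrite lt_min r0 divr_gt0// mulr_gt0.
have sr : s <= r by rewrite ge_min lexx.
have sK : s * K <= 1 / 8.
  apply: (@le_trans _ _ (1 / (8 * K) * K)).
    by rewrite ler_wpM2r ?(ltW K0)// ge_min lexx orbT.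
  by rewrite le_eqVlt; apply/orP; left; apply/eqP; field; rewrite gt_eqF.
pose t := s / (8 * Q).
have t0 : 0 < t by rewrite divr_gt0// mulr_gt0.
have ts0 (k : J + J) : 0 <= sumfun (fun=> t) (fun=> s) k by case: k => k /=; exact: ltW.
pose Phi j (w : J + J -> C) := N j (w \o inr) + \sum_k w (inl k) * B k j.
have Phim j : majorized (sumfun (fun=> t) (fun=> s)) (Phi j) (s / 4).
  have [_ /(_ (fun=> s))Ns] := mP j.
  have s0' (i : J) : 0 <= s by exact: ltW.
  have Nm1 := Ns (fun=> (introT andP (conj (ltW s0) sr))).
  have Nm2 := majorized_comp s0' ts0 Nm1 (fun k => maj_var (sumfun (fun _ : J => t) (fun _ : J => s)) (inr k)).
  have Bm := majorized_sum ts0 (index_enum J) xpredT (fun k => maj_mul (maj_var (sumfun (fun _ : J => t) (fun _ : J => s)) (inl k)) (maj_cst _ (B k j))).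
  apply: majorized_le (maj_add Nm2 Bm) _ _ => //=.
  rewrite -!mulr_sumr (_ : s / 4 = s / 8 + s / 8); last by field.
  apply: lerD.
    under eq_bigr do rewrite -mulr_sumr.
    rewrite -mulr_sumr ler_pM2l// -div1r; apply: le_trans sK.
    rewrite ler_pM2l//.
    apply: (@term_le_sum1 _ (fun j => \sum_i \sum_k m j i k)) => l.
    by do 2![apply: sumr_ge0 => ? _].
  apply: (@le_trans _ _ (t * Q)).
    rewrite ler_pM2l//.
    apply: (@term_le_sum1 _ (fun j => \sum_k cabs (B k j))) => l.
    by apply: sumr_ge0 => ? _; exact: cabs_ge0.
  by rewrite le_eqVlt; apply/orP; left; apply/eqP; rewrite /t; field; rewrite gt_eqF.
have [y [ym yE]] := contraction_fixpoint (fun _ : J => ltW t0) s0 Phim.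
have s2 : s / 2 <= s by rewrite ger_pMr// invf_le1// ler1n.
exists s, t, y; split=> //.
- by move=> j; apply: majorized_le (ym j) s2 _ => // _; exact: ltW.
- move=> x tx l.
  (* The fixed point equation says [(x - Psi(y)) B = 0]; multiplication by [D] then removes [B]. *)
  have E j : \sum_k (x k - Psi k (fun k => y k x)) * B k j = 0.
    have e : y j x = y j x - \sum_k Psi k (fun k => y k x) * B k j +
      \sum_k x k * B k j := yE x tx j.
    under eq_bigr do rewrite mulrBl.
    by rewrite sumrB; apply: (addrI (y j x)); rewrite addr0 [RHS]e; ring.
  have : \sum_j (\sum_k (x k - Psi k (fun k => y k x)) * B k j) * D j l = 0.
    by rewrite big1// => j _; rewrite E mul0r.
  under eq_bigr do rewrite mulr_suml.
  rewrite exchange_big (bigD1 l)//= [X in _ + X]big1 => [|k kl].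
    under eq_bigr do rewrite -mulrA.
    by rewrite -mulr_sumr BD eqxx mulr1 addr0 => /eqP; rewrite subr_eq0 => /eqP.
  under eq_bigr do rewrite -mulrA.
  by rewrite -mulr_sumr BD (negPf kl) mulr0.
- move=> v sv tv j.
  have := @contraction_uniq _ _ _ _ _ (fun _ : J => ltW t0) s0 Phim (fun k => Psi k v) (fun k => y k (fun k => Psi k v)) v tv _ sv.
  move=> h; suff /(congr1 (fun f => f j)) :
    (fun k => y k (fun k => Psi k v)) = v by [].
  apply: h => {}j.
  + by apply: majorized_bound tv; apply: majorized_le (ym j) s2 _ => // _; exact: ltW.
  + exact: yE.
  + by rewrite /Phi /N /=; ring.
Qed.

End FixedPoint.

(** * The identity theorem, inverses and cube roots *)

Section Identity.
Context {R : realType}.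
Local Notation C := R[i].

Lemma sum_unit (V : nmodType) (F : unit -> V) : \sum_i F i = F tt.
Proof. by rewrite (bigD1 tt)//= big1 ?addr0// => -[]. Qed.

Lemma majorized_real_at0 (s : R) (f : (unit -> C) -> C) a : 0 < s ->
  majorized (fun=> s) f a ->
  (forall t : R, 0 < `|t| < s -> f (fun=> t%:C) = 0) -> f (fun=> 0) = 0.
Proof.
move=> s0 fa ft; have s0' (i : unit) : 0 <= s by exact: ltW.
pose g z := f z - f (fun=> 0).
have gm : majorized (fun=> s) g (a + cabs (f (fun=> 0))).
  by apply: majorizedB => //; exact: maj_cst.
have [m m0 gm'] := majorized_small (fun=> s0) gm (subrr _).
apply: (@cabs_lim_uniq _ _ (m tt)) => // e e0.
pose t := Num.min e (s / 2).
have t0 : 0 < t by rewrite lt_min e0 divr_gt0.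
have ts : t < s by rewrite gt_min ltr_pdivrMr// ltr_pMr// ltr1n orbT.
have := majorized_bound (gm' (fun=> t) _) (z := fun=> t%:C) _.
rewrite /g ft ?gtr0_norm ?t0//= sub0r cabsN sum_unit mulrC => h.
apply: le_trans (h _ _) _ => [i|i|].
- by rewrite !ltW.
- by rewrite cabs_real gtr0_norm.
- by rewrite ler_wpM2l// ge_min lexx.
Qed.

(** Division by the variable can be repeated forever: each quotient vanishes at nonzero reals, hence
    at 0. After [n] divisions the value at [t] is at most [a (|t| / s)^n], which tends to 0. *)
Lemma identity1 (s : R) (f : (unit -> C) -> C) a : 0 < s ->
  majorized (fun=> s) f a ->
  (forall t : R, 0 < `|t| < s -> f (fun=> t%:C) = 0) ->
  forall t : C, cabs t < s -> f (fun=> t) = 0.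
Proof.
move=> s0 fa ft t ts.
have a0 : 0 <= a by apply: majorized_ge0 fa => _; exact: ltW.
have IT n : exists q : (unit -> C) -> C, [/\ majorized (fun=> s) q (a / s ^+ n),
    forall u : R, 0 < `|u| < s -> q (fun=> u%:C) = 0 &
    forall z, polydisc (fun=> s) z -> f z = z tt ^+ n * q z].
  elim: n => [|n [q [qm qr fq]]].
    by exists f; rewrite expr0 divr1; split=> // z _; rewrite mul1r.
  have q0 := majorized_real_at0 s0 qm qr.
  have [p [m [pm le qE]]] := majorized_factor0 (fun=> s0) qm q0.
  exists (p tt); split=> [|u us|z sz].
  - apply: majorized_le (pm tt) _ _ => //; first by move=> _; exact: ltW.
    by rewrite exprSr invfM mulrA ler_pdivlMr// mulrC; move: le; rewrite sum_unit.
  - have us' : polydisc (fun _ : unit => s) (fun=> u%:C).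
      by move=> _; rewrite cabs_real ltW//; case/andP: us.
    have := qE _ us'; rewrite sum_unit (qr u us) => /esym/eqP.
    rewrite mulf_eq0 => /orP[/eqP|/eqP//].
    by case/andP: us => /[swap] _ /[swap] /complexI ->; rewrite normr0 ltxx.
  - by rewrite fq// qE// sum_unit exprSr mulrA.
have st : polydisc (fun _ : unit => s) (fun=> t) by move=> _; exact: ltW.
pose th := cabs t / s.
have th1 : `|th| < 1.
  by rewrite ger0_norm ?divr_ge0 ?cabs_ge0 ?ltW// ltr_pdivrMr// mul1r.
apply: (cabs_lim_uniq a0) => e e0.
have /cvgrPdist_le /(_ e e0) [N _ HN] := cvg_expr th1.
have := HN N (leqnn _); rewrite /= sub0r normrN => thN.
have [q [qm _ fq]] := IT N; rewrite fq// cabsM cabsX.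
apply: (@le_trans _ _ (cabs t ^+ N * (a / s ^+ N))).
  by rewrite ler_wpM2l ?exprn_ge0 ?cabs_ge0//; exact: majorized_bound qm st.
rewrite mulrCA -expr_div_n ler_wpM2l//; apply: le_trans thN.
exact: ler_norm.
Qed.

Lemma identity_theorem (I : finType) (r : I -> R) f a : (forall i, 0 < r i) ->
  majorized r f a ->
  (forall x : I -> R, (forall i, `|x i| < r i) -> f (fun i => (x i)%:C) = 0) ->
  forall z, (forall i, cabs (z i) < r i) -> f z = 0.
Proof.
move=> r0 fa fr.
have r0' i : 0 <= r i by exact: ltW.
(* Variables are released from the real axis one at a time; [l] lists those already allowed to be
   complex. *)
suff H (l : seq I) : forall z, (forall i, cabs (z i) < r i) ->
    (forall i, i \notin l -> complex.Im (z i) = 0) -> f z = 0.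
  by move=> z rz; apply: (H (enum I)) => // i; rewrite mem_enum.
elim: l => [|k l IH] z rz zr.
  have -> : z = fun i => (complex.Re (z i))%:C.
    by apply/funext => i; have := zr i isT; case: (z i) => x y /= ->.
  by apply: fr => i; exact: le_lt_trans (cabs_Re _) (rz i).
pose g (i : I) (w : unit -> C) := if i == k then w tt else z i.
have -> : z = fun i => g i (fun=> z k).
  by apply/funext => i; rewrite /g; case: eqP => [->|].
have gm i : majorized (fun _ : unit => r k) (g i) (r i).
  rewrite /g; have [->|ik] := eqVneq i k; first exact: (maj_var _ tt).
  by apply: majorized_cst => //; exact: ltW.
apply: (@identity1 (r k) (fun w => f (fun i => g i w)) a) => //.
  exact: majorized_comp r0' (fun=> r0' k) fa gm.
move=> t /andP[_ tr]; apply: IH => i.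
  by rewrite /g; case: eqP => [->|//]; rewrite cabs_real.
rewrite /g; have [->//|ik il] := eqVneq i k.
by apply: zr; rewrite inE (negPf ik).
Qed.

(* [1 / (1 + x) = 1 + y] with [y = - x - x y]. *)
Lemma majorized_inv1 : exists (rho s : R) (y : (unit -> C) -> C),
  [/\ 0 < rho, majorized (fun=> rho) y s & forall x, polydisc (fun=> rho) x ->
    (1 + x tt) * (1 + y x) = 1].
Proof.
pose Phi (_ : unit) (w : unit + unit -> C) := - w (inl tt) - w (inl tt) * w (inr tt).
have h18 : (0 : R) < 1 / 8 by rewrite divr_gt0.
pose r : unit + unit -> R := sumfun (fun _ : unit => 1 / 8) (fun _ : unit => 1).
have r0 k : 0 <= r k by case: k => k /=; rewrite ?ltW.
(* With radius 1 for the unknown the contraction needs the bound [1 / 4]; radius [1 / 8] for [x]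
   gives [1 / 8 + 1 / 8 * 1]. *)
have Phim j : majorized r (Phi j) (1 / 4).
  apply: (@majorized_le _ _ _ r0 (Phi j) _ (1 / 8 + 1 / 8 * 1)) => //.
    apply: majorizedB => //; last exact: maj_mul (maj_var r (inl tt)) (maj_var r (inr tt)).
    by apply: majorizedN => //; exact: (maj_var r (inl tt)).
  by lra.
have [y [ym yE]] := contraction_fixpoint (fun=> ltW h18) ltr01 Phim.
exists (1 / 8), (1 / 2), (y tt); split=> // x rx.
have e : y tt x = - x tt - x tt * y tt x := yE x rx tt.
have e2 : y tt x + x tt * y tt x = - x tt by rewrite {1}e; ring.
have -> : (1 + x tt) * (1 + y tt x) = 1 + x tt + (y tt x + x tt * y tt x) by ring.
by rewrite e2; ring.
Qed.

(* [(1 + y)^3 = 1 + x] with [y = (x - 3 y^2 - y^3) / 3]. *)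
Lemma majorized_cbrt1 : exists (rho s : R) (y : (unit -> C) -> C),
  [/\ 0 < rho, majorized (fun=> rho) y s & forall x, polydisc (fun=> rho) x ->
    (1 + y x) ^+ 3 = 1 + x tt].
Proof.
pose Phi (_ : unit) (w : unit + unit -> C) := 3^-1 * w (inl tt) - (w (inr tt) ^+ 2 + 3^-1 * w (inr tt) ^+ 3).
have h18 : (0 : R) < 1 / 32 by rewrite divr_gt0.
have h8 : (0 : R) < 1 / 8 by rewrite divr_gt0.
pose r : unit + unit -> R := sumfun (fun _ : unit => 1 / 32) (fun _ : unit => 1 / 8).
have r0 k : 0 <= r k by case: k => k /=; rewrite ltW.
have c3 : cabs (3^-1 : C) = 3^-1.
  by rewrite cabsV (_ : 3 = 3%:C) ?cabs_real ?ger0_norm// rmorph_nat.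
(* Radii [1 / 32] for [x] and [1 / 8] for [y] give the majorant [41 / 1536], just below the required
   [1 / 32]. *)
have Phim j : majorized r (Phi j) (1 / 8 / 4).
  apply: (@majorized_le _ _ _ r0 (Phi j) _ (3^-1 * (1 / 32) + ((1 / 8) ^+ 2 + 3^-1 * (1 / 8) ^+ 3))) => //.
    apply: majorizedB => //.
      by rewrite -{1}c3; apply: majorizedZ; exact: (maj_var r (inl tt)).
    apply: maj_add; first by apply: majorizedX => //; exact: (maj_var r (inr tt)).
    by rewrite -{1}c3; apply: majorizedZ; apply: majorizedX => //; exact: (maj_var r (inr tt)).
  by lra.
have [y [ym yE]] := contraction_fixpoint (fun=> ltW h18) h8 Phim.
exists (1 / 32), (1 / 8 / 2), (y tt); split=> // x rx.
have e : y tt x = 3^-1 * x tt - (y tt x ^+ 2 + 3^-1 * y tt x ^+ 3) := yE x rx tt.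
have {}e : 3 * y tt x = x tt - 3 * y tt x ^+ 2 - y tt x ^+ 3.
  by rewrite {1}e; field.
have -> : (1 + y tt x) ^+ 3 = 1 + 3 * y tt x + 3 * y tt x ^+ 2 + y tt x ^+ 3 by ring.
by rewrite e; ring.
Qed.

End Identity.

(** * Analytic functions as majorized series *)

Section PowerSeries.
Context {R : realType}.
Local Notation C := R[i].

Definition box_val (n N : nat) (k : {ffun 'I_n -> 'I_N}) : {ffun 'I_n -> nat} :=
  [ffun i => (k i : nat)].

Definition monomial (n : nat) (k : {ffun 'I_n -> nat}) (z : 'I_n -> C) : C :=
  \prod_(i < n) z i ^+ k i.

(** A box grows by the shell of multi-indices with an entry equal to [m]. Grouping by shells turns
    the limit over boxes in [analytic_at] into an ordinary series, the form that [maj_lim]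
    accepts. *)
Lemma box_sumS (V : zmodType) (n m : nat) (G : {ffun 'I_n -> nat} -> V) :
  \sum_(k : {ffun 'I_n -> 'I_m.+1}) G (box_val k) =
  \sum_(k : {ffun 'I_n -> 'I_m}) G (box_val k) +
  \sum_(k : {ffun 'I_n -> 'I_m.+1} | [exists i, k i == m :> nat]) G (box_val k).
Proof.
rewrite (bigID (fun k : {ffun 'I_n -> 'I_m.+1} => [exists i, k i == m :> nat])) /=.
rewrite addrC; congr (_ + _).
pose h (k : {ffun 'I_n -> 'I_m}) : {ffun 'I_n -> 'I_m.+1} :=
  [ffun i => widen_ord (leqnSn m) (k i)].
have hinj : injective h.
  move=> k k' /ffunP e; apply/ffunP => i; apply: val_inj.
  by have := e i; rewrite !ffunE => /(congr1 val).
transitivity (\sum_(k in h @: predT) G (box_val k)).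
  apply: eq_bigl => k; apply/idP/imsetP => [|[k' _ ->]].
    rewrite negb_exists => /forallP km.
    have lt i : (k i < m)%N by rewrite ltn_neqAle km -ltnS ltn_ord.
    exists [ffun i => Ordinal (lt i)] => //.
    by apply/ffunP => i; rewrite !ffunE; apply: val_inj.
  rewrite negb_exists; apply/forallP => i; rewrite ffunE /=.
  by rewrite neq_ltn ltn_ord.
rewrite big_imset /=; last by move=> ? ? _ _; exact: hinj.
apply: eq_big => [k|k _]; first by [].
by congr G; apply/ffunP => i; rewrite !ffunE.
Qed.

Lemma majorized_box (n : nat) (r : R) (c : {ffun 'I_n -> nat} -> C)
    (T : finType) (P : pred T) (k : T -> {ffun 'I_n -> nat}) : 0 <= r ->
  majorized (fun=> r) (fun z => \sum_(t | P t) c (k t) * monomial (k t) z)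
    (\sum_(t | P t) cabs (c (k t)) * \prod_(i < n) r ^+ k t i).
Proof.
move=> r0; apply: majorized_sum => // t; apply: maj_mul; first exact: maj_cst.
by apply: majorized_prod => // i; apply: majorizedX => //; exact: maj_var.
Qed.

Lemma majorized_of_analytic (n : nat) (f : 'rV[R]_n -> R) (a : 'rV[R]_n) :
  analytic_at f a -> exists (r : R) (F : ('I_n -> C) -> C) (b : R),
    [/\ 0 < r, majorized (fun=> r) F b & forall x : 'rV[R]_n,
       (forall i, `|x 0 i| <= r) -> (f (a + x))%:C = F (fun i => (x 0 i)%:C)].
Proof.
move=> [c [r [r0 cf]]]; pose s := r / 2.
have s0 : 0 < s by rewrite divr_gt0.
have sr : s < r by rewrite ltr_pdivrMr// ltr_pMr// ltr1n.
have s0' (i : 'I_n) : 0 <= s by exact: ltW.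
pose A N : R := \sum_(k : {ffun 'I_n -> 'I_N}) `|c (box_val k)| * \prod_(i < n) s ^+ box_val k i.
have Anneg N (P : pred {ffun 'I_n -> 'I_N}) :
    0 <= \sum_(k : {ffun 'I_n -> 'I_N} | P k) `|c (box_val k)| * \prod_(i < n) s ^+ box_val k i.
  apply: sumr_ge0 => k _; rewrite mulr_ge0// prodr_ge0// => i _.
  by rewrite exprn_ge0// ltW.
have AS N : A N.+1 = A N + \sum_(k : {ffun 'I_n -> 'I_N.+1} | [exists i, k i == N :> nat])
    `|c (box_val k)| * \prod_(i < n) s ^+ box_val k i.
  exact: (box_sumS N (fun k => `|c k| * \prod_(i < n) s ^+ k i)).
have And : nondecreasing_seq A by apply/nondecreasing_seqP => N; rewrite AS lerDl.
have Acv : cvgn A.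
  have [] := cf (a + const_mx s) _.
    by move=> i; rewrite !mxE addrAC subrr add0r gtr0_norm.
  move=> + _; rewrite (_ : box_sum _ _ = A)//; apply/funext => N.
  apply: eq_bigr => k _; congr (_ * _); apply: eq_bigr => i _.
  by rewrite !mxE addrAC subrr add0r gtr0_norm// ffunE.
pose cc k : C := (c k)%:C.
pose S N (z : 'I_n -> C) := \sum_(k : {ffun 'I_n -> 'I_N}) cc (box_val k) * monomial (box_val k) z.
(* Index 0 holds the box of side 0 and index [m'.+1] the shell that completes the box of side
   [m'.+1]; hence [N.+1] terms sum to the box of side [N]. *)
pose F m (z : 'I_n -> C) := if m is m'.+1 then
  \sum_(k : {ffun 'I_n -> 'I_m'.+1} | [exists i, k i == m' :> nat])
     cc (box_val k) * monomial (box_val k) z else S 0%N z.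
pose nu m := if m is m'.+1 then A m'.+1 - A m' else A 0%N.
have SF N z : \sum_(m < N.+1) F m z = S N z.
  elim: N => [|N IH]; first by rewrite big_ord_recr big_ord0 /= add0r.
  rewrite big_ord_recr IH /=; apply: esym.
  exact: (box_sumS N (fun k => cc k * monomial k z)).
have Anu N : \sum_(m < N.+1) nu m = A N.
  elim: N => [|N IH]; first by rewrite big_ord_recr big_ord0 /= add0r.
  by rewrite big_ord_recr IH /=; ring.
have cabsc k : cabs (cc k) = `|c k| by rewrite /cc cabs_real.
have Fnu m : majorized (fun _ : 'I_n => s) (F m) (nu m).
  case: m => [|m] /=.
    rewrite /A; under eq_bigr do rewrite -cabsc.
    by apply: majorized_box; exact: ltW.
  rewrite AS addrAC subrr add0r; under eq_bigr do rewrite -cabsc.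
  by apply: majorized_box; exact: ltW.
have nub N : \sum_(m < N) nu m <= limn A.
  case: N => [|N]; last by rewrite Anu; exact: nondecreasing_cvgn_le.
  rewrite big_ord0; apply: le_trans (nondecreasing_cvgn_le And Acv 0%N).
  exact: Anneg.
have [G Gm Gc] := majorized_series Fnu nub.
exists s, G, (limn A); split=> // x xs.
have xs' : polydisc (fun=> s) (fun i => (x 0 i)%:C).
  by move=> i; rewrite cabs_real.
have [] := cf (a + x) _.
  by move=> i; rewrite !mxE addrAC subrr add0r (le_lt_trans (xs i)).
move=> _ cvf; apply: cconv_uniq _ (Gc _ xs') => e e0.
have /cvgrPdist_le /(_ e e0)[N _ HN] := cvf.
exists N.+1 => -[//|m]; rewrite ltnS SF => /HN /=; rewrite distrC.
rewrite -cabs_real rmorphB; congr (cabs (_ - _) <= e).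
rewrite /box_sum rmorph_sum; apply: eq_bigr => k _.
rewrite rmorphM rmorph_prod; congr (_ * _); apply: eq_bigr => i _.
by rewrite rmorphXn !mxE addrAC subrr add0r ffunE.
Qed.

Lemma big_ffunS (V : nmodType) (n N : nat) (G : {ffun 'I_n.+1 -> 'I_N} -> V) :
  \sum_k G k = \sum_(j < N) \sum_(k : {ffun 'I_n -> 'I_N})
    G [ffun i => if unlift ord0 i is Some i' then k i' else j].
Proof.
rewrite pair_big /=.
pose h (p : 'I_N * {ffun 'I_n -> 'I_N}) : {ffun 'I_n.+1 -> 'I_N} :=
  [ffun i => if unlift ord0 i is Some i' then p.2 i' else p.1].
rewrite (reindex h) //=; exists (fun k => (k ord0, [ffun i => k (lift ord0 i)])).
  move=> [j k] _ /=; congr pair; first by rewrite ffunE unlift_none.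
  by apply/ffunP => i; rewrite !ffunE liftK.
move=> k _; apply/ffunP => i; rewrite ffunE /=.
by case: unliftP => [i' ->|->] //; rewrite ffunE.
Qed.

(** Iterated Hadamard splits in the last variable give a Taylor expansion whose coefficients are
    functions of the others. As no split loses weight, coefficients and remainder together stay
    within [a]. *)
Lemma majorized_iter (I : Type) (s : R) f a : 0 < s ->
  majorized (fun _ : I + unit => s) f a ->
  exists (f_ : nat -> (I -> C) -> C) (m q : nat -> R),
    [/\ forall j, majorized (fun=> s) (f_ j) (m j),
        forall N, \sum_(j < N) s ^+ j * m j + s ^+ N * q N <= a,
        forall N, 0 <= q N &
        forall N z, polydisc (fun=> s) z -> 
          cabs (f z - \sum_(j < N) z (inr tt) ^+ j * f_ j (z \o inl)) <=
             cabs (z (inr tt)) ^+ N * q N].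
Proof.
move=> s0 fa; have s0' (k : I + unit) : 0 <= s by exact: ltW.
(* A split is known to exist for each majorized function only; choice makes it a total map on pairs
   (function, bound), with a dummy value on all other pairs, so that it can be iterated. *)
have /choice[st stP] : forall X : ((I + unit -> C) -> C) * R,
    exists Y : (((I -> C) -> C) * R) * (((I + unit -> C) -> C) * R),
    majorized (fun _ : I + unit => s) X.1 X.2 ->
    [/\ majorized (fun=> s) Y.1.1 Y.1.2, majorized (fun=> s) Y.2.1 Y.2.2,
        Y.1.2 + s * Y.2.2 <= X.2 &
        forall z, polydisc (fun=> s) z ->
          X.1 z = Y.1.1 (z \o inl) + z (inr tt) * Y.2.1 z].
  move=> [g b]; have [gb|ngb] := pselect (majorized (fun _ : I + unit => s) g b); last first.
    by exists ((fun=> 0, 0), (fun=> 0, 0)).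
  have [f0 [m0 [q [m [h1 h2 h3 h4]]]]] := majorized_split s0' (fun=> s0) gb.
  exists ((f0, m0), (q tt, m tt)) => _; split=> //=; first by rewrite sum_unit in h3.
  by move=> z sz; rewrite h4// sum_unit.
pose X N := iter N (fun X => (st X).2) (f, a).
have XP N : majorized (fun _ : I + unit => s) (X N).1 (X N).2.
  by elim: N => //= N /stP[].
exists (fun j => (st (X j)).1.1), (fun j => (st (X j)).1.2), (fun N => (X N).2).
split=> [j|N|N|N z sz].
- by have [] := stP _ (XP j).
- elim: N => [|N IH]; first by rewrite big_ord0 add0r expr0 mul1r.
  apply: le_trans IH; rewrite big_ord_recr -addrA lerD2l exprSr -mulrA -mulrDr.
  by rewrite ler_pM2l ?exprn_gt0//; have [] := stP _ (XP N).
- exact: majorized_ge0 (XP N).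
- have -> : f z - \sum_(j < N) z (inr tt) ^+ j * (st (X j)).1.1 (z \o inl) =
      z (inr tt) ^+ N * (X N).1 z.
    elim: N => [|N IH]; first by rewrite big_ord0 subr0 expr0 mul1r.
    rewrite big_ord_recr opprD addrA IH /=.
    have [_ _ _ /(_ _ sz) {1}->] := stP _ (XP N).
    by rewrite exprSr; ring.
  rewrite cabsM cabsX ler_wpM2l ?exprn_ge0 ?cabs_ge0//.
  exact: majorized_bound (XP N) sz.
Qed.

(** The way back from derivations to genuine coefficients, by induction on the number of variables.
    On the polydisc shrunk by [th] the box sums converge at the rate [th ^+ N], each variable
    contributing one tail, whence the factor [n]. *)
Lemma majorized_coefs (n : nat) (s : R) (f : ('I_n -> C) -> C) a : 0 < s ->
  majorized (fun=> s) f a -> exists c : {ffun 'I_n -> nat} -> C,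
  (forall N, \sum_(k : {ffun 'I_n -> 'I_N})
     cabs (c (box_val k)) * \prod_(i < n) s ^+ box_val k i <= a) /\
  (forall th z, 0 <= th -> th <= 1 -> (forall i, cabs (z i) <= th * s) ->
     forall N, cabs (f z - \sum_(k : {ffun 'I_n -> 'I_N})
       c (box_val k) * monomial (box_val k) z) <= n%:R * a * th ^+ N).
Proof.
elim: n f a => [|n IH] f a s0 fa.
  pose k0 N : {ffun 'I_0 -> 'I_N} := [ffun i : 'I_0 => False_rect 'I_N (notF (valP i))].
  have u0 N (k : {ffun 'I_0 -> 'I_N}) : k = k0 N by apply/ffunP => -[].
  exists (fun=> f (fun=> 0)); split=> [N|th z _ _ _ N].
    rewrite (bigD1 (k0 N))//= [X in _ + X]big1 => [|k /eqP].
      rewrite addr0 big_ord0 mulr1; apply: majorized_bound fa _ => i.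
      by rewrite cabs0 ltW.
    by rewrite (u0 N k).
  rewrite (bigD1 (k0 N))//= [X in _ - (_ + X)]big1 => [|k /eqP].
    rewrite addr0 /monomial big_ord0 mulr1 (_ : z = fun=> 0) ?subrr ?cabs0 ?mul0r//.
    by apply/funext => -[].
  by rewrite (u0 N k).
have s0' (k : 'I_n.+1) : 0 <= s by exact: ltW.
have s0'' (k : 'I_n + unit) : 0 <= s by exact: ltW.
pose g (i : 'I_n.+1) (w : 'I_n + unit -> C) :=
  if unlift ord0 i is Some j then w (inl j) else w (inr tt).
have gm i : majorized (fun _ : 'I_n + unit => s) (g i) s.
  rewrite /g; case: unlift => [j|]; first exact: (maj_var _ (inl j)).
  exact: (maj_var _ (inr tt)).
have ga := majorized_comp s0' s0'' fa gm.
have [f_ [m [q [fm mq q0 fE]]]] := majorized_iter s0 ga.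
have /choice[c cP] := fun j => IH _ _ s0 (fm j).
have m0 j : 0 <= m j by apply: majorized_ge0 (fm j) => _; exact: ltW.
pose tl (k : {ffun 'I_n.+1 -> nat}) : {ffun 'I_n -> nat} := [ffun i => k (lift ord0 i)].
have tlE N (j : 'I_N) (k : {ffun 'I_n -> 'I_N}) :
  tl (box_val [ffun i => if unlift ord0 i is Some i' then k i' else j]) = box_val k.
  by apply/ffunP => i; rewrite !ffunE liftK.
have hdE N (j : 'I_N) (k : {ffun 'I_n -> 'I_N}) :
  box_val [ffun i => if unlift ord0 i is Some i' then k i' else j] ord0 = j.
  by rewrite !ffunE unlift_none.
have bE N (j : 'I_N) (k : {ffun 'I_n -> 'I_N}) i :
  box_val [ffun i => if unlift ord0 i is Some i' then k i' else j] (lift ord0 i) =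
  box_val k i by rewrite !ffunE liftK.
exists (fun k : {ffun 'I_n.+1 -> nat} => c (k ord0) (tl k)); split=> [N|th z th0 th1 zs N].
  rewrite big_ffunS; apply: (@le_trans _ _ (\sum_(j < N) s ^+ j * m j)).
    apply: ler_sum => j _; apply: le_trans (ler_wpM2l (exprn_ge0 j (ltW s0)) ((cP j).1 N)).
    rewrite mulr_sumr; apply: ler_sum => k _.
    rewrite tlE hdE big_ord_recl hdE mulrCA; under eq_bigr do rewrite bE.
    by [].
  apply: le_trans (mq N); rewrite lerDl; apply: mulr_ge0 => //.
  by apply: exprn_ge0; exact: ltW.
pose w : 'I_n + unit -> C := sumfun (fun i => z (lift ord0 i)) (fun=> z ord0).
have gw : (fun i => g i w) = z.
  by apply/funext => i; rewrite /g; case: unliftP => [j ->|->].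
have ths : th * s <= s by rewrite ger_pMl.
have sw : polydisc (fun=> s) w by move=> [i|i] /=; exact: le_trans (zs _) ths.
have := fE N w sw; rewrite gw /= => fz.
rewrite big_ffunS.
rewrite (_ : f z - _ = (f z - \sum_(j < N) z ord0 ^+ j * f_ j (w \o inl)) +
  \sum_(j < N) z ord0 ^+ j * (f_ j (w \o inl) -
    \sum_(k : {ffun 'I_n -> 'I_N}) c j (box_val k) * monomial (box_val k) (w \o inl))); last first.
  under [X in _ = _ + X]eq_bigr do rewrite mulrBr.
  rewrite sumrB addrA subrK; congr (_ - _); apply: eq_bigr => j _.
  rewrite mulr_sumr; apply: eq_bigr => k _.
  rewrite tlE hdE /monomial big_ord_recl hdE mulrCA; under eq_bigr do rewrite bE.
  by [].
rewrite (le_trans (cabsD _ _))//.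
have zth j : cabs (z ord0) ^+ j <= s ^+ j * th ^+ j.
  by rewrite -exprMn lerXn2r ?nnegrE ?cabs_ge0 ?mulr_ge0// ?(ltW s0)// mulrC.
have thj j : th ^+ j <= 1 by rewrite exprn_ile1.
have thj0 j : 0 <= th ^+ j by rewrite exprn_ge0.
have sj0 j : 0 <= s ^+ j by rewrite exprn_ge0// ltW.
have a0 : 0 <= a by apply: majorized_ge0 fa.
apply: (@le_trans _ _ (s ^+ N * q N * th ^+ N + \sum_(j < N) s ^+ j * (n%:R * m j * th ^+ N))).
  apply: lerD.
    by apply: le_trans fz _; rewrite mulrAC ler_wpM2r.
  rewrite (le_trans (cabs_sum _ _ _))//; apply: ler_sum => j _.
  rewrite cabsM cabsX; apply: ler_pM; rewrite ?exprn_ge0 ?cabs_ge0//.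
    by apply: le_trans (zth j) _; rewrite ger_pMr ?exprn_gt0.
  by apply: (cP j).2 => // i /=; exact: zs.
have -> : \sum_(j < N) s ^+ j * (n%:R * m j * th ^+ N) =
    n%:R * (\sum_(j < N) s ^+ j * m j) * th ^+ N.
  by rewrite mulr_sumr mulr_suml; apply: eq_bigr => j _; ring.
rewrite -mulrDl ler_wpM2r// -natr1 mulrDl mul1r [leRHS]addrC.
have le1 : s ^+ N * q N <= a.
  by apply: le_trans (mq N); rewrite lerDr sumr_ge0// => j _; rewrite mulr_ge0.
have le2 : \sum_(j < N) s ^+ j * m j <= a.
  by apply: le_trans (mq N); rewrite lerDl mulr_ge0.
by rewrite lerD// ler_wpM2l.
Qed.

End PowerSeries.

(** * Power series at real points *)

Section RealPoints.
Context {R : realType}.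
Local Notation C := R[i].

Lemma nbhs_box (n : nat) (p : 'rV[R]_n) (P : 'rV[R]_n -> Prop) :
  (\forall q \near p, P q) <->
  exists2 d : R, 0 < d & forall x : 'rV[R]_n, (forall i, `|x 0 i| <= d) -> P (p + x).
Proof.
split=> [/nbhs_ballP[e /= e0 eP]|[d d0 dP]].
  exists (e / 2); first by rewrite divr_gt0.
  move=> x xe; apply: eP; split=> // i j.
  rewrite ord1 /ball /= mxE opprD addrA subrr sub0r normrN.
  by rewrite (le_lt_trans (xe j))// ltr_pdivrMr// ltr_pMr// ltr1n.
apply/nbhs_ballP; exists d => //= q pq; have -> : q = p + (q - p) by rewrite addrC subrK.
by apply: dP => i; have := pq.2 0 i; rewrite /ball /= distrC !mxE => /ltW.
Qed.

Lemma nbhs0_box (n : nat) (P : 'rV[R]_n -> Prop) :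
  (\forall q \near (0 : 'rV[R]_n), P q) <->
  exists2 d : R, 0 < d & forall x : 'rV[R]_n, (forall i, `|x 0 i| <= d) -> P x.
Proof.
rewrite nbhs_box; split=> -[d d0 dP]; exists d => // x /dP; by rewrite add0r.
Qed.

Lemma near_shift0 (n : nat) (p : 'rV[R]_n) (P : 'rV[R]_n -> Prop) :
  (\forall q \near p, P q) <-> (\forall x \near (0 : 'rV[R]_n), P (p + x)).
Proof. by rewrite nbhs_box nbhs0_box. Qed.

Lemma near_near (n : nat) (p : 'rV[R]_n) (P : 'rV[R]_n -> Prop) :
  (\forall q \near p, P q) -> \forall q \near p, \forall q' \near q, P q'.
Proof.
move=> /nbhs_box[d d0 dP]; apply/nbhs_box; exists (d / 2); first by rewrite divr_gt0.
move=> x xd; apply/nbhs_box; exists (d / 2); first by rewrite divr_gt0.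
move=> y yd; rewrite -addrA; apply: dP => i; rewrite mxE [leRHS]splitr.
by rewrite (le_trans (ler_normD _ _))// lerD.
Qed.

Lemma near_at (n : nat) (p : 'rV[R]_n) (P : 'rV[R]_n -> Prop) :
  (\forall q \near p, P q) -> P p.
Proof. exact: nbhs_singleton. Qed.

Lemma near_forall (n : nat) (J : finType) (p : 'rV[R]_n) (P : J -> 'rV[R]_n -> Prop) :
  (forall j, \forall q \near p, P j q) -> \forall q \near p, forall j, P j q.
Proof.
move=> h; have /choice[d dP] j : exists d : R, 0 < d /\
    forall x : 'rV[R]_n, (forall i, `|x 0 i| <= d) -> P j (p + x).
  by have /nbhs_box[d d0 dP] := h j; exists d.
apply/nbhs_box; exists (\big[Num.min/1]_j d j).
  elim/big_ind: _ => // [x y ? ?|j _]; first by rewrite lt_min; apply/andP.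
  by have [] := dP j.
move=> x xd j; apply: (dP j).2 => i; apply: le_trans (xd i) _.
exact: bigmin_le_cond.
Qed.

Definition cpoint (n : nat) (x : 'rV[R]_n) (i : 'I_n) : C := (x 0 i)%:C.

(** The working form of real analyticity: near [p] the function is the restriction to real points of
    a majorized function of complex variables centred at [p], which serves as its
    complexification. *)
Definition cpseries_at (n : nat) (f : 'rV[R]_n -> C) (p : 'rV[R]_n) : Prop :=
  exists (r : R) (F : ('I_n -> C) -> C) (a : R),
    [/\ 0 < r, majorized (fun=> r) F a &
        forall x : 'rV[R]_n, (forall i, `|x 0 i| <= r) ->
          f (p + x) = F (cpoint x)].

Section Closure.
Variable n : nat.
Implicit Types (f g : 'rV[R]_n -> C) (p : 'rV[R]_n).

Lemma cpoint0 : cpoint (0 : 'rV[R]_n) = fun=> 0.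
Proof. by apply/funext => i; rewrite /cpoint mxE. Qed.

Lemma cpseries_near_eq f g p : (\forall q \near p, f q = g q) ->
  cpseries_at f p -> cpseries_at g p.
Proof.
move=> /nbhs_box[d d0 fg] [r [F [a [r0 Fa fF]]]].
exists (Num.min d r), F, a; split.
- by rewrite lt_min d0.
- apply: majorized_restrict Fa => i; last by rewrite ge_min lexx orbT.
  by rewrite ltW// lt_min d0.
- move=> x xd; rewrite -fg ?fF// => i; apply: le_trans (xd i) _.
    by rewrite ge_min lexx orbT.
  by rewrite ge_min lexx.
Qed.

Lemma cpseries_cst c p : cpseries_at (fun=> c) p.
Proof.
by exists 1, (fun=> c), (cabs c); split=> //; exact: maj_cst.
Qed.

Lemma cpseries_coord i p : cpseries_at (fun q : 'rV[R]_n => (q 0 i)%:C) p.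
Proof.
exists 1, (fun z => (p 0 i)%:C + z i), (cabs (p 0 i)%:C + 1); split=> //.
  by apply: maj_add; [exact: maj_cst|exact: (maj_var _ i)].
by move=> x _; rewrite mxE rmorphD.
Qed.

Lemma cpseries_common f g p : cpseries_at f p -> cpseries_at g p ->
  exists (r : R) (F G : ('I_n -> C) -> C) (a b : R),
    [/\ 0 < r, majorized (fun=> r) F a, majorized (fun=> r) G b &
        forall x : 'rV[R]_n, (forall i, `|x 0 i| <= r) ->
          f (p + x) = F (cpoint x) /\ g (p + x) = G (cpoint x)].
Proof.
move=> [r [F [a [r0 Fa fF]]]] [s [G [b [s0 Gb gG]]]].
pose t := Num.min r s; have t0 : 0 < t by rewrite lt_min r0.
have tr : t <= r by rewrite ge_min lexx.
have ts : t <= s by rewrite ge_min lexx orbT.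
exists t, F, G, a, b; split=> //.
- by apply: majorized_restrict Fa => // _; exact: ltW.
- by apply: majorized_restrict Gb => // _; exact: ltW.
- move=> x xt; split; [apply: fF|apply: gG] => i; exact: le_trans (xt i) _.
Qed.

Lemma cpseriesD f g p : cpseries_at f p -> cpseries_at g p ->
  cpseries_at (fun q => f q + g q) p.
Proof.
move=> fp gp; have [r [F [G [a [b [r0 Fa Gb E]]]]]] := cpseries_common fp gp.
exists r, (fun z => F z + G z), (a + b); split=> //; first exact: maj_add.
by move=> x /E[-> ->].
Qed.

Lemma cpseriesM f g p : cpseries_at f p -> cpseries_at g p ->
  cpseries_at (fun q => f q * g q) p.
Proof.
move=> fp gp; have [r [F [G [a [b [r0 Fa Gb E]]]]]] := cpseries_common fp gp.
exists r, (fun z => F z * G z), (a * b); split=> //; first exact: maj_mul.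
by move=> x /E[-> ->].
Qed.

Lemma cpseriesN f p : cpseries_at f p -> cpseries_at (fun q => - f q) p.
Proof.
move=> [r [F [a [r0 Fa fF]]]]; exists r, (fun z => - F z), a; split=> //.
  by apply: majorizedN => // _; exact: ltW.
by move=> x /fF ->.
Qed.

Lemma cpseriesB f g p : cpseries_at f p -> cpseries_at g p ->
  cpseries_at (fun q => f q - g q) p.
Proof. by move=> fp /cpseriesN; exact: cpseriesD. Qed.

Lemma cpseriesX f p k : cpseries_at f p -> cpseries_at (fun q => f q ^+ k) p.
Proof.
move=> fp; elim: k => [|k IH].
  rewrite (_ : (fun q => _) = fun=> 1); first exact: cpseries_cst.
  by apply/funext => q; rewrite expr0.
rewrite (_ : (fun q => _) = fun q => f q * f q ^+ k); first exact: cpseriesM.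
by apply/funext => q; rewrite exprS.
Qed.

Lemma cpseries_sum (T : Type) (s : seq T) (P : pred T) (f : T -> 'rV[R]_n -> C) p :
  (forall t, P t -> cpseries_at (f t) p) ->
  cpseries_at (fun q => \sum_(t <- s | P t) f t q) p.
Proof.
move=> fp; elim: s => [|t s IH].
  rewrite (_ : (fun q => _) = fun=> 0); first exact: cpseries_cst.
  by apply/funext => q; rewrite big_nil.
have [Pt|Pt] := boolP (P t).
  rewrite (_ : (fun q => _) = fun q => f t q + \sum_(t <- s | P t) f t q).
    by apply: cpseriesD => //; exact: fp.
  by apply/funext => q; rewrite big_cons Pt.
rewrite (_ : (fun q => _) = fun q => \sum_(t <- s | P t) f t q)//.
by apply/funext => q; rewrite big_cons (negPf Pt).
Qed.

Lemma cpseries_prod (T : Type) (s : seq T) (P : pred T) (f : T -> 'rV[R]_n -> C) p :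
  (forall t, P t -> cpseries_at (f t) p) ->
  cpseries_at (fun q => \prod_(t <- s | P t) f t q) p.
Proof.
move=> fp; elim: s => [|t s IH].
  rewrite (_ : (fun q => _) = fun=> 1); first exact: cpseries_cst.
  by apply/funext => q; rewrite big_nil.
have [Pt|Pt] := boolP (P t).
  rewrite (_ : (fun q => _) = fun q => f t q * \prod_(t <- s | P t) f t q).
    by apply: cpseriesM => //; exact: fp.
  by apply/funext => q; rewrite big_cons Pt.
rewrite (_ : (fun q => _) = fun q => \prod_(t <- s | P t) f t q)//.
by apply/funext => q; rewrite big_cons (negPf Pt).
Qed.

Lemma cpseries_conj f p : cpseries_at f p -> cpseries_at (fun q => (f q)^*) p.
Proof.
move=> [r [F [a [r0 Fa fF]]]].
exists r, (fun z => (F (fun i => (z i)^*))^*), a; split=> //.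
  exact: majorized_conj.
move=> x /fF ->; congr (F _)^*; apply/funext => i.
by rewrite /cpoint conjc_real.
Qed.

Lemma cpseries_near f p : cpseries_at f p -> \forall q \near p, cpseries_at f q.
Proof.
move=> [r [F [a [r0 Fa fF]]]]; apply/nbhs_box; exists (r / 2).
  by rewrite divr_gt0.
have r2 : 0 < r / 2 by rewrite divr_gt0.
move=> y yr; exists (r / 2), (fun z => F (fun i => (y 0 i)%:C + z i)), a; split=> //.
  apply: (majorized_comp (r := fun=> r) _ _ Fa (g := fun i z => (y 0 i)%:C + z i)).
  - by move=> _; exact: ltW.
  - by move=> _; exact: ltW.
  - move=> i; apply: majorized_le (maj_add (maj_cst _ _) (maj_var _ i)) _ _ => //.
      by move=> _; exact: ltW.
    by rewrite cabs_real [leRHS]splitr lerD2r.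
move=> x xr; rewrite -addrA fF.
  by congr F; apply/funext => i; rewrite /cpoint mxE rmorphD.
move=> i; rewrite mxE [leRHS]splitr (le_trans (ler_normD _ _))//.
exact: lerD.
Qed.

Lemma cpseries_factor f p : cpseries_at f p ->
  exists g : 'I_n -> 'rV[R]_n -> C, (forall i, cpseries_at (g i) p) /\
    \forall q \near p, f q = f p + \sum_i (q 0 i - p 0 i)%:C * g i q.
Proof.
move=> [r [F [a [r0 Fa fF]]]].
have fp : f p = F (fun=> 0).
  by rewrite -[p in LHS]addr0 fF ?cpoint0// => i; rewrite mxE normr0 ltW.
have Gm : majorized (fun _ : 'I_n => r) (fun z => F z - F (fun=> 0)) (a + cabs (F (fun=> 0))).
  by apply: majorizedB => //; [move=> _; exact: ltW|exact: maj_cst].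
have [q [m [qm _ qE]]] := majorized_factor0 (fun=> r0) Gm (subrr _).
exists (fun i x => q i (cpoint (x - p))); split.
  move=> i; exists r, (q i), (m i); split=> // x _.
  by rewrite addrAC subrr add0r.
apply/nbhs_box; exists r => // x xr; rewrite fF// fp.
rewrite (_ : p + x - p = x); last by rewrite addrAC subrr add0r.
under eq_bigr do rewrite mxE [p 0 _ + _ - _]addrAC subrr add0r.
rewrite -[X in _ + X](qE (cpoint x)); first by rewrite addrC subrK.
by move=> i; rewrite cabs_real.
Qed.

Lemma cpseries_cont f p : cpseries_at f p -> forall e : R, 0 < e ->
  \forall q \near p, cabs (f q - f p) <= e.
Proof.
move=> [r [F [a [r0 Fa fF]]]] e e0.
have fp : f p = F (fun=> 0).
  by rewrite -[p in LHS]addr0 fF ?cpoint0// => i; rewrite mxE normr0 ltW.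
have Gm : majorized (fun _ : 'I_n => r) (fun z => F z - F (fun=> 0)) (a + cabs (F (fun=> 0))).
  by apply: majorizedB => //; [move=> _; exact: ltW|exact: maj_cst].
have [m m0 sm] := majorized_small (fun=> r0) Gm (subrr _).
pose M := 1 + \sum_i m i; have M0 : 0 < M by rewrite ltr_wpDr// sumr_ge0.
pose d := Num.min r (e / M); have d0 : 0 < d by rewrite lt_min r0 divr_gt0.
have dr : d <= r by rewrite ge_min lexx.
apply/nbhs_box; exists d => // x xd.
rewrite fp fF; last by move=> i; exact: le_trans (xd i) _.
have := majorized_bound (sm (fun=> d) _) (z := cpoint x) _.
move=> h; apply: le_trans (h _ _) _ => [i|i|].
- by rewrite ltW.
- by rewrite cabs_real.
- rewrite -mulr_sumr; apply: (@le_trans _ _ (d * M)).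
    by rewrite ler_pM2l// lerDr.
  by rewrite -ler_pdivlMr// ge_min lexx orbT.
Qed.

Lemma cpseries_neq0 f p : cpseries_at f p -> f p != 0 ->
  \forall q \near p, f q != 0.
Proof.
move=> fp f0; have e0 : 0 < cabs (f p) / 2.
  by rewrite divr_gt0// lt_def cabs_ge0 cabs_eq0 f0.
apply: filterS (cpseries_cont fp e0) => q; apply: contraTN => /eqP ->.
by rewrite sub0r cabsN -ltNge ltr_pdivrMr// ltr_pMr ?ltr1n// lt_def cabs_ge0 cabs_eq0 f0.
Qed.

(** Since the [g j] vanish at [p], [majorized_small] yields a common radius on which all of them are
    majorized by [s], as the substitution into [F] requires. *)
Lemma cpseries_comp (J : finType) (s : R) (F : (J -> C) -> C) b
    (g : J -> 'rV[R]_n -> C) p : 0 < s -> majorized (fun=> s) F b ->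
  (forall j, cpseries_at (g j) p) -> (forall j, g j p = 0) ->
  cpseries_at (fun q => F (fun j => g j q)) p.
Proof.
move=> s0 Fb gp g0.
have /choice[X XP] j : exists X : (R * (('I_n -> C) -> C)) * ('I_n -> R),
  [/\ 0 < X.1.1, forall i, 0 <= X.2 i,
      forall t : R, 0 <= t <= X.1.1 -> majorized (fun=> t) X.1.2 (\sum_i t * X.2 i) &
      forall x : 'rV[R]_n, (forall i, `|x 0 i| <= X.1.1) -> g j (p + x) = X.1.2 (cpoint x)].
  have [r [G [a [r0 Ga gG]]]] := gp j.
  have G0 : G (fun=> 0) = 0.
    transitivity (g j p); last exact: g0.
    by rewrite -[p in RHS]addr0 gG ?cpoint0// => i; rewrite mxE normr0 ltW.
  have [m m0 sm] := majorized_small (fun=> r0) Ga G0.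
  exists (r, G, m); split=> //= t tr; exact: sm.
pose t := \big[Num.min/1]_j Num.min (X j).1.1 (s / (1 + \sum_i (X j).2 i)).
have M0 j : 0 < 1 + \sum_i (X j).2 i.
  by rewrite ltr_wpDr// sumr_ge0// => i _; have [_ h _ _] := XP j; exact: h.
have t0 : 0 < t.
  rewrite /t; elim/big_ind: _ => // [x y ? ?|j _]; rewrite lt_min; apply/andP => //.
  by split; [have [] := XP j|rewrite divr_gt0].
have tj j : t <= Num.min (X j).1.1 (s / (1 + \sum_i (X j).2 i)) by exact: bigmin_le_cond.
have tX j : t <= (X j).1.1 by apply: le_trans (tj j) _; rewrite ge_min lexx.
have Gm j : majorized (fun _ : 'I_n => t) (X j).1.2 s.
  have [_ h /(_ t) + _] := XP j; rewrite tX ltW// => /(_ isT) Xm.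
  apply: majorized_le Xm _ _ => //; first by move=> _; exact: ltW.
  rewrite -mulr_sumr; apply: (@le_trans _ _ (t * (1 + \sum_i (X j).2 i))).
    by rewrite ler_pM2l// lerDr.
  rewrite -ler_pdivlMr//; apply: le_trans (tj j) _; by rewrite ge_min lexx orbT.
exists t, (fun z => F (fun j => (X j).1.2 z)), b; split=> //.
  apply: majorized_comp Fb Gm => _; exact: ltW.
move=> x xt; congr F; apply/funext => j; have [_ _ _ ->]// := XP j.
by move=> i; exact: le_trans (xt i) (tX j).
Qed.

(** Normalization [f = f p * (1 + e)] with [e p = 0], then composition with the universal series of
    [1 / (1 + x)]. *)
Lemma cpseriesV f p : f p != 0 -> cpseries_at f p ->
  cpseries_at (fun q => (f q)^-1) p.
Proof.
move=> f0 fp; have [rho [s [y [rho0 ym yE]]]] := @majorized_inv1 R.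
pose e (_ : unit) q := (f p)^-1 * f q - 1.
have ep j : cpseries_at (e j) p.
  by apply: cpseriesB; [apply: cpseriesM => //|]; exact: cpseries_cst.
have e0 j : e j p = 0 by rewrite /e mulVf// subrr.
have := cpseriesM (cpseries_cst (f p)^-1 p) (cpseriesD (cpseries_cst 1 p) (cpseries_comp rho0 ym ep e0)).
apply: cpseries_near_eq.
have := cpseries_cont (ep tt) rho0; apply: filterS => q.
rewrite e0 subr0 => eq; have := yE (fun=> e tt q) (fun=> eq).
rewrite /e addrC subrK => h.
have fq0 : f q != 0.
  apply/eqP => fq; move: h; rewrite fq mulr0 mul0r => /eqP.
  by rewrite eq_sym oner_eq0.
apply: (mulfI fq0); rewrite divff// mulrA [f q * _]mulrC.
by rewrite addrC in h *.
Qed.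

(** The same normalization as for the inverse; the value [c] selects the branch of the root. *)
Lemma cpseries_cbrt f p c : f p != 0 -> c ^+ 3 = f p -> cpseries_at f p ->
  exists2 g : 'rV[R]_n -> C, cpseries_at g p &
    \forall q \near p, g q ^+ 3 = f q.
Proof.
move=> f0 c3 fp; have [rho [s [y [rho0 ym yE]]]] := @majorized_cbrt1 R.
pose e (_ : unit) q := (f p)^-1 * f q - 1.
have ep j : cpseries_at (e j) p.
  by apply: cpseriesB; [apply: cpseriesM => //|]; exact: cpseries_cst.
have e0 j : e j p = 0 by rewrite /e mulVf// subrr.
exists (fun q => c * (1 + y (fun j => e j q))).
  apply: cpseriesM; first exact: cpseries_cst.
  apply: cpseriesD; first exact: cpseries_cst.
  exact: cpseries_comp rho0 ym ep e0.
have := cpseries_cont (ep tt) rho0; apply: filterS => q.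
rewrite e0 subr0 => eq; have := yE (fun=> e tt q) (fun=> eq).
rewrite exprMn c3 => ->; rewrite /e [1 + _]addrC subrK.
by rewrite mulrA divff// mul1r.
Qed.

End Closure.

Lemma cpseries_comp_real (n m : nat) (f : 'rV[R]_m -> C) (h : 'rV[R]_n -> 'rV[R]_m) p :
  cpseries_at f (h p) -> (forall j, cpseries_at (fun q => (h q 0 j)%:C) p) ->
  cpseries_at (fun q => f (h q)) p.
Proof.
move=> [r [F [a [r0 Fa fF]]]] hp.
pose g (j : 'I_m) q := (h q 0 j)%:C - (h p 0 j)%:C : C.
have gp j : cpseries_at (g j) p by apply: cpseriesB => //; exact: cpseries_cst.
have g0 j : g j p = 0 by rewrite /g subrr.
apply: cpseries_near_eq (cpseries_comp r0 Fa gp g0).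
have : \forall q \near p, forall j, cabs (g j q - g j p) <= r.
  by apply: near_forall => j; exact: cpseries_cont.
apply: filterS => q gr; rewrite -[h q in RHS](addrNK (h p)) addrC fF.
  by congr F; apply/funext => j; rewrite /g /cpoint !mxE rmorphB.
move=> j; have := gr j; rewrite g0 subr0 /g -rmorphB cabs_real.
by rewrite !mxE.
Qed.

Lemma box_sumE (n : nat) (c : {ffun 'I_n -> nat} -> R) (v : 'rV[R]_n) (N : nat) :
  box_sum c v N = \sum_(k : {ffun 'I_n -> 'I_N})
    c (box_val k) * \prod_(i < n) v 0 i ^+ box_val k i.
Proof.
apply: eq_bigr => k _; congr (_ * _).
by apply: eq_bigr => i _; rewrite ffunE.
Qed.

(** The bridge between the definition of analyticity and [cpseries_at]. From right to left,
    monomials are real at real points, so the real parts of the coefficients represent the real part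
    of [f]; the imaginary part is the real part of [- 'i * f]. *)
Lemma canalytic_atP (n : nat) (f : 'rV[R]_n -> C) (p : 'rV[R]_n) :
  canalytic_at f p <-> cpseries_at f p.
Proof.
have toC g : analytic_at g p -> cpseries_at (fun q => (g q)%:C) p.
  by move=> /majorized_of_analytic[r [F [b [r0 Fb gF]]]]; exists r, F, b.
split=> [[fr fi]|].
  have := cpseriesD (toC _ fr) (cpseriesM (cpseries_cst 'i p) (toC _ fi)).
  apply: cpseries_near_eq; apply/nbhs_box; exists 1 => // q _.
  by rewrite -complexE.
have Re_an g : cpseries_at g p -> analytic_at (fun q => complex.Re (g q)) p.
  move=> [r [F [a [r0 Fa gF]]]].
  have [c [cb cE]] := majorized_coefs r0 Fa.
  exists (fun k => complex.Re (c k)), r; split=> // x xr; split.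
    apply: nondecreasing_is_cvgn.
      apply/nondecreasing_seqP => N; rewrite !box_sumE.
      rewrite (box_sumS N (fun k => `|complex.Re (c k)| *
        \prod_(i < n) (map_mx Num.norm (x - p)) 0 i ^+ k i)) lerDl.
      apply: sumr_ge0 => k _; rewrite mulr_ge0// prodr_ge0// => i _.
      by rewrite exprn_ge0// mxE.
    exists a => _ [N _ <-]; rewrite box_sumE; apply: le_trans (cb N).
    apply: ler_sum => k _; apply: ler_pM => //.
    - by rewrite prodr_ge0// => i _; rewrite exprn_ge0// mxE.
    - exact: cabs_Re.
    - apply: ler_prod => i _; rewrite exprn_ge0 ?mxE//= lerXn2r ?nnegrE//.
        exact: ltW.
      by rewrite ?mxE ltW.
  pose m := \big[Num.max/0]_i `|x 0 i - p 0 i|.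
  have m0 : 0 <= m by exact: bigmax_ge_id.
  have mr : m < r by apply: bigmax_lt => // i _.
  (* The ratio of the largest coordinate to the radius, strictly below 1; it turns the rate of
     [majorized_coefs] into convergence. *)
  pose th := m / r.
  have th0 : 0 <= th by rewrite divr_ge0// ltW.
  have th1 : th < 1 by rewrite ltr_pdivrMr// mul1r.
  have a0 : 0 <= a by apply: majorized_ge0 Fa => _; exact: ltW.
  have xth i : cabs (cpoint (x - p) i) <= th * r.
    rewrite cabs_real !mxE /th -mulrA mulVf ?mulr1 ?gt_eqF//.
    exact: (le_bigmax_cond _ (fun i => `|x 0 i - p 0 i|)).
  have := cvg_expr (z := th); rewrite ger0_norm// => /(_ th1) th_cvg.
  apply/cvgrPdist_le => e e0.
  have na1 : 0 < n%:R * a + 1 by rewrite ltr_wpDl// mulr_ge0.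
  have e1 : 0 < e / (n%:R * a + 1) by rewrite divr_gt0.
  have /cvgrPdist_le /(_ _ e1)[N _ HN] := th_cvg.
  exists N => // M /HN /=; rewrite sub0r normrN ger0_norm ?exprn_ge0// => thM.
  have := cE _ _ th0 (ltW th1) xth M.
  rewrite -gF; last by move=> i; rewrite !mxE ltW.
  rewrite (_ : p + (x - p) = x) => [h|]; last by rewrite addrC subrK.
  have -> : box_sum (fun k => complex.Re (c k)) (x - p) M =
      complex.Re (\sum_(k : {ffun 'I_n -> 'I_M}) c (box_val k) * monomial (box_val k) (cpoint (x - p))).
    rewrite box_sumE raddf_sum; apply: eq_bigr => k _.
    rewrite (_ : monomial _ _ = (\prod_(i < n) (x - p) 0 i ^+ box_val k i)%:C).
      by case: (c _) => u v /=; rewrite mulr0 subr0.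
    by rewrite /monomial rmorph_prod; apply: eq_bigr => i _; rewrite rmorphXn.
  rewrite -raddfB (le_trans (cabs_Re _))// (le_trans h)//.
  apply: (@le_trans _ _ ((n%:R * a + 1) * (e / (n%:R * a + 1)))).
    by apply: ler_pM; rewrite ?mulr_ge0 ?exprn_ge0// lerDl.
  by rewrite mulrCA divff ?mulr1// gt_eqF.
move=> fp; split; first exact: Re_an.
have := cpseriesM (cpseries_cst (- 'i) p) fp => /Re_an.
congr analytic_at; apply/funext => q.
by case: (f q) => a b /=; rewrite !(mul0r, mulN1r, oppr0, sub0r, opprK).
Qed.

End RealPoints.

(** * Differentiability of maps of row vectors *)

Section Differentiable.
Context {K : numFieldType}.

Lemma mx_norm_leP (m n : nat) (x : 'M[K]_(m, n)) (e : K) : 0 <= e ->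
  (`|x| <= e) <-> (forall i j, `|x i j| <= e).
Proof.
move=> e0; pose e' := NngNum e0.
rewrite -[`|x|]/(mx_norm x) mx_normE -[e]/(e'%:num) num_le; split.
  by move=> /bigmax_leP[_ h] i j; have := h (i, j) isT; rewrite -num_le.
by move=> h; apply/bigmax_leP; split=> // -[i j] _; rewrite -num_le /=; exact: h.
Qed.

Lemma mx_norm_entry (m n : nat) (x : 'M[K]_(m, n)) i j : `|x i j| <= `|x|.
Proof. by have /mx_norm_leP := lexx `|x|; apply. Qed.

Lemma mulmx_row_bound (m n : nat) (D : 'M[K]_(m.+1, n.+1)) (h : 'rV[K]_m.+1) :
  `|h *m D| <= `|h| * (m.+1%:R * `|D|).
Proof.
apply/mx_norm_leP; first by rewrite !mulr_ge0.
move=> i j; rewrite mxE (le_trans (ler_norm_sum _ _ _))//.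
have -> : `|h| * (m.+1%:R * `|D|) = \sum_(k < m.+1) `|h| * `|D|.
  by rewrite sumr_const card_ord -[RHS]mulr_natl mulrCA.
by apply: ler_sum => k _; rewrite normrM ler_pM// mx_norm_entry.
Qed.

Lemma mulmxr_continuous (m n : nat) (D : 'M[K]_(m.+1, n.+1)) :
  continuous (mulmxr D : {linear 'rV[K]_m.+1 -> 'rV[K]_n.+1}).
Proof.
apply/(linear_bounded_continuous (mulmxr D : {linear 'rV[K]_m.+1 -> 'rV[K]_n.+1})).
apply/linear_boundedP.
near=> M => h /=; apply: le_trans (mulmx_row_bound _ _) _.
by rewrite mulrC ler_wpM2r//; near: M; apply: nbhs_pinfty_ge; rewrite rpredM.
Unshelve. all: by end_near. Qed.

(** The general field is meant for two uses: over [R] for maps between parameter domains, and over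
    [C] for holomorphic maps of [C^4]. *)
Lemma differentiable_rowP (m n : nat) (f : 'rV[K]_m.+1 -> 'rV[K]_n.+1)
    (x : 'rV[K]_m.+1) (D : 'M[K]_(m.+1, n.+1)) :
  (forall e : K, 0 < e -> \forall h \near (0 : 'rV[K]_m.+1),
     `|f (x + h) - f x - h *m D| <= e * `|h|) ->
  differentiable f x /\ jacobian f x = D.
Proof.
move=> fD.
have fE : f \o shift x = cst (f x) + mulmxr D +o_ (0 : 'rV[K]_m.+1) id.
  apply/eqaddoP => e e0; have := fD e e0; apply: filterS => h.
  by rewrite /= !fctE opprD addrA [h + x]addrC.
have dE := diff_unique (df := (mulmxr D : {linear 'rV[K]_m.+1 -> 'rV[K]_n.+1})) (@mulmxr_continuous _ _ D) fE.
split.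
  by apply/diff_locallyP; rewrite dE; split=> //; exact: mulmxr_continuous.
apply/row_matrixP => i; rewrite !rowE mul_rV_lin1 /=.
by rewrite -[LHS]/('d f x (delta_mx 0 i)) dE.
Qed.

Lemma differentiable_row (m n : nat) (f : 'rV[K]_m.+1 -> 'rV[K]_n.+1)
    (x : 'rV[K]_m.+1) : differentiable f x ->
  forall e : K, 0 < e -> \forall h \near (0 : 'rV[K]_m.+1),
     `|f (x + h) - f x - h *m jacobian f x| <= e * `|h|.
Proof.
move=> fx e e0; have /eqaddoP /(_ e e0) := diff_locally fx; apply: filterS => h.
rewrite /= !fctE opprD addrA [h + x]addrC.
by rewrite mul_rV_lin1.
Qed.

End Differentiable.

(** * Real derivatives of complex functions *)

Section RealDerivative.
Context {R : realType}.
Local Notation C := R[i].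

(** Real Frechet differentiability of a complex-valued function, kept as a relation so that calculus
    rules compose; [rderiv_cpartial5] extracts the partial derivatives at the end. *)
Definition rderiv (n : nat) (f : 'rV[R]_n -> C) (p : 'rV[R]_n) (d : 'I_n -> C) :=
  forall e : R, 0 < e -> \forall x \near (0 : 'rV[R]_n),
    cabs (f (p + x) - f p - \sum_i (x 0 i)%:C * d i) <= e * \sum_i `|x 0 i|.

Section Rules.
Variable n : nat.
Implicit Types (f g : 'rV[R]_n -> C) (p : 'rV[R]_n) (d : 'I_n -> C).

Lemma l1_ge0 (x : 'rV[R]_n) : 0 <= \sum_i `|x 0 i|.
Proof. exact: sumr_ge0. Qed.

Lemma rderiv_near_eq f g p d : (\forall q \near p, f q = g q) ->
  rderiv f p d -> rderiv g p d.
Proof.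
move=> fg fd e e0; have := near_at fg => fgp.
move/near_shift0: fg => fg; have := fd e e0; apply: filterS2 fg => x.
by rewrite fgp => ->.
Qed.

(* The second hypothesis says that, near [p], [k] is a differentiable function of
   the [g j]. *)
Lemma rderiv_chain (J : finType) (g : J -> 'rV[R]_n -> C) (d : J -> 'I_n -> C)
    (k : 'rV[R]_n -> C) (D : J -> C) p :
  (forall j, rderiv (g j) p (d j)) ->
  (forall e : R, 0 < e -> \forall x \near (0 : 'rV[R]_n),
    cabs (k (p + x) - k p - \sum_j (g j (p + x) - g j p) * D j) <=
      e * \sum_j cabs (g j (p + x) - g j p)) ->
  rderiv k p (fun i => \sum_j d j i * D j).
Proof.
move=> gd kD e e0.
(* [A] bounds the total increment of the [g j] relative to the l^1 norm of [x], and [B] the outer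
   derivative; each of the two error terms is then allotted [e / 2]. *)
pose A := 1 + \sum_j (1 + \sum_i cabs (d j i)).
pose B := 1 + \sum_j cabs (D j).
have A0 : 0 < A.
  rewrite ltr_wpDr// sumr_ge0// => j _; rewrite addr_ge0// sumr_ge0// => i _.
  exact: cabs_ge0.
have B0 : 0 < B by rewrite ltr_wpDr// sumr_ge0// => j _; exact: cabs_ge0.
have e1 : 0 < e / 2 / A by rewrite !divr_gt0.
pose u := Num.min 1 (e / 2 / B).
have u0 : 0 < u by rewrite lt_min ltr01 !divr_gt0.
have := near_forall (fun j => gd j u u0); apply: filterS2 (kD _ e1) => x kx gx.
set X := \sum_i `|x 0 i| in gx *.
have X0 : 0 <= X := l1_ge0 x.
have gX j : cabs (g j (p + x) - g j p) <= (1 + \sum_i cabs (d j i)) * X.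
  have -> : g j (p + x) - g j p = (g j (p + x) - g j p - \sum_i (x 0 i)%:C * d j i) +
    \sum_i (x 0 i)%:C * d j i by ring.
  rewrite (le_trans (cabsD _ _))// mulrDl lerD//.
    by apply: le_trans (gx j) _; rewrite ler_wpM2r// ge_min lexx.
  rewrite (le_trans (cabs_sum _ _ _))// mulr_suml ler_sum// => i _.
  rewrite cabsM cabs_real mulrC ler_wpM2l ?cabs_ge0//.
  by rewrite /X (bigD1 i)//= lerDl sumr_ge0.
have -> : k (p + x) - k p - \sum_i (x 0 i)%:C * (\sum_j d j i * D j) =
  (k (p + x) - k p - \sum_j (g j (p + x) - g j p) * D j) +
  \sum_j (g j (p + x) - g j p - \sum_i (x 0 i)%:C * d j i) * D j.
  under [X in _ = _ + X]eq_bigr do rewrite mulrBl.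
  rewrite sumrB addrA subrK; congr (_ - _).
  under eq_bigr do rewrite mulr_sumr; rewrite exchange_big.
  apply: eq_bigr => j _; rewrite mulr_suml; apply: eq_bigr => i _.
  by rewrite mulrA.
rewrite (le_trans (cabsD _ _))// [e]splitr mulrDl lerD//.
  apply: le_trans kx _; apply: (@le_trans _ _ (e / 2 / A * (A * X))).
    rewrite ler_wpM2l ?(ltW e1)// /A mulrDl mul1r mulr_suml.
    by apply: ler_wpDl => //; apply: ler_sum => j _.
  by rewrite mulrA divfK// gt_eqF.
apply: le_trans (cabs_sum _ _ _) _.
apply: (@le_trans _ _ (\sum_j u * X * cabs (D j))).
  by apply: ler_sum => j _; rewrite cabsM ler_wpM2r ?cabs_ge0.
rewrite -mulr_sumr mulrAC ler_wpM2r//.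
apply: (@le_trans _ _ (e / 2 / B * B)); last by rewrite divfK// gt_eqF.
apply: ler_pM => //; rewrite ?(ltW u0) ?ge_min ?lexx ?orbT ?lerDr//.
by rewrite sumr_ge0// => j _; exact: cabs_ge0.
Qed.

Lemma rderiv_cst c p : rderiv (fun=> c) p (fun=> 0).
Proof.
move=> e e0; apply/nbhs0_box; exists 1 => // x _.
rewrite big1 => [|i _]; last by rewrite mulr0.
by rewrite !subrr cabs0 mulr_ge0 ?l1_ge0// ltW.
Qed.

Lemma rderiv_coord i p : rderiv (fun q : 'rV[R]_n => (q 0 i)%:C) p (fun j => (j == i)%:R).
Proof.
move=> e e0; apply/nbhs0_box; exists 1 => // x _.
rewrite (bigD1 i)//= eqxx mulr1 big1 => [|j /negPf ->]; last by rewrite mulr0.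
rewrite mxE rmorphD addr0 (_ : _ - _ - _ = 0); last by rewrite /=; ring.
by rewrite cabs0 mulr_ge0 ?l1_ge0// ltW.
Qed.

Lemma rderiv_lipschitz f p d : rderiv f p d -> forall e : R, 0 < e ->
  \forall x \near (0 : 'rV[R]_n), cabs (f (p + x) - f p) <= e.
Proof.
move=> fd e e0; pose M := 1 + \sum_i (1 + cabs (d i)).
have M0 : 0 < M.
  by rewrite ltr_wpDr// sumr_ge0// => i _; rewrite addr_ge0// cabs_ge0.
have h : \forall x \near (0 : 'rV[R]_n), (forall i : 'I_n, `|(x : 'rV[R]_n) 0 i| <= e / M).
  by apply/nbhs0_box; exists (e / M); rewrite ?divr_gt0.
have := fd 1 ltr01; apply: filterS2 h => x xe fx.
have -> : f (p + x) - f p = (f (p + x) - f p - \sum_i (x 0 i)%:C * d i) +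
  \sum_i (x 0 i)%:C * d i by ring.
rewrite (le_trans (cabsD _ _))//.
apply: (@le_trans _ _ (\sum_i `|x 0 i| * (1 + cabs (d i)))).
  under [leRHS]eq_bigr do rewrite mulrDr mulr1.
  rewrite big_split lerD//; first by rewrite mul1r in fx.
  rewrite (le_trans (cabs_sum _ _ _))// ler_sum// => i _.
  by rewrite cabsM cabs_real.
apply: (@le_trans _ _ (e / M * M)); last by rewrite divfK// gt_eqF.
apply: (@le_trans _ _ (e / M * \sum_i (1 + cabs (d i)))).
  by rewrite mulr_sumr ler_sum// => i _; rewrite ler_wpM2r// addr_ge0 ?cabs_ge0.
by rewrite ler_wpM2l ?lerDr// divr_ge0// ltW.
Qed.

Lemma rderiv_ext f p d d' : rderiv f p d -> d =1 d' -> rderiv f p d'.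
Proof. by move=> + /funext <-. Qed.

(** The sum and product rules are instances of [rderiv_chain] with the two functions indexed by
    [bool]. *)
Lemma rderivD f g p d d' : rderiv f p d -> rderiv g p d' ->
  rderiv (fun q => f q + g q) p (fun i => d i + d' i).
Proof.
move=> fd gd; apply: rderiv_ext (rderiv_chain (J := bool)
  (g := fun b => if b then f else g) (d := fun b => if b then d else d')
  (D := fun=> 1) _ _) _ => [[]|e e0|i] //.
  apply/nbhs0_box; exists 1 => // x _; rewrite big_bool /= !mulr1.
  rewrite (_ : _ - _ = 0) ?cabs0; last by ring.
  by rewrite mulr_ge0 ?(ltW e0)// sumr_ge0// => ? _; exact: cabs_ge0.
by rewrite big_bool !mulr1.
Qed.

Lemma rderivM f g p d d' : rderiv f p d -> rderiv g p d' ->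
  rderiv (fun q => f q * g q) p (fun i => d i * g p + d' i * f p).
Proof.
move=> fd gd; apply: rderiv_ext (rderiv_chain (J := bool)
  (g := fun b => if b then f else g) (d := fun b => if b then d else d')
  (D := fun b => if b then g p else f p) _ _) _ => [[]|e e0|i] //; last first.
  by rewrite big_bool.
(* The linearization error of a product is the product of the two increments, one of which is at
   most [e] by continuity. *)
have := rderiv_lipschitz fd e0; apply: filterS => x fx; rewrite !big_bool /=.
rewrite (_ : _ - _ = (f (p + x) - f p) * (g (p + x) - g p)); last by ring.
rewrite cabsM mulrDr ler_wpDl//; first by rewrite mulr_ge0 ?cabs_ge0 ?(ltW e0).
by rewrite ler_wpM2r ?cabs_ge0.
Qed.

Lemma rderivZ c f p d : rderiv f p d -> rderiv (fun q => c * f q) p (fun i => c * d i).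
Proof.
move=> fd; apply: rderiv_ext (rderivM (rderiv_cst c p) fd) _ => i.
by rewrite mul0r add0r mulrC.
Qed.

Lemma rderivN f p d : rderiv f p d -> rderiv (fun q => - f q) p (fun i => - d i).
Proof.
move=> /(rderivZ (-1)) h; rewrite (_ : (fun q => _) = fun q => -1 * f q).
  by apply: rderiv_ext h _ => i; rewrite mulN1r.
by apply/funext => q; rewrite mulN1r.
Qed.

Lemma rderivB f g p d d' : rderiv f p d -> rderiv g p d' ->
  rderiv (fun q => f q - g q) p (fun i => d i - d' i).
Proof. by move=> fd /rderivN; exact: rderivD. Qed.

Lemma rderiv_sum (T : Type) (s : seq T) (f : T -> 'rV[R]_n -> C) (d : T -> 'I_n -> C) p :
  (forall t, rderiv (f t) p (d t)) ->
  rderiv (fun q => \sum_(t <- s) f t q) p (fun i => \sum_(t <- s) d t i).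
Proof.
move=> fd; elim: s => [|t s IH].
  rewrite (_ : (fun q => _) = fun=> 0); last by apply/funext => q; rewrite big_nil.
  by apply: rderiv_ext (rderiv_cst _ _) _ => i; rewrite big_nil.
rewrite (_ : (fun q => _) = fun q => f t q + \sum_(t <- s) f t q); last first.
  by apply/funext => q; rewrite big_cons.
by apply: rderiv_ext (rderivD (fd t) IH) _ => i; rewrite big_cons.
Qed.

Lemma rderiv_conj f p d : rderiv f p d ->
  rderiv (fun q => (f q)^*) p (fun i => (d i)^*).
Proof.
move=> fd e e0; have := fd e e0; apply: filterS => x; apply: le_trans.
rewrite le_eqVlt; apply/orP; left; apply/eqP; rewrite -cabs_conj; congr cabs.
rewrite !rmorphB rmorph_sum /= !conjcK; congr (_ - _); apply: eq_bigr => i _.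
by rewrite rmorphM; congr (_ * _); [exact: conjc_real|exact: conjcK].
Qed.

End Rules.

Lemma rderiv_comp_complex (n : nat) (J : finType) (F : (J -> C) -> C)
    (g : J -> 'rV[R]_n -> C) (d : J -> 'I_n -> C) (D : J -> C) p :
  cderiv F (fun j => g j p) D -> (forall j, rderiv (g j) p (d j)) ->
  rderiv (fun q => F (fun j => g j q)) p (fun i => \sum_j d j i * D j).
Proof.
move=> FD gd; apply: rderiv_chain => // e e0.
have [u u0 hu] := FD e e0.
have := near_forall (fun j => rderiv_lipschitz (gd j) u0); apply: filterS => x gx.
have := hu _ gx.
rewrite (_ : (fun i => g i p + _) = fun i => g i (p + x))//.
by apply/funext => j; rewrite addrC subrK.
Qed.

Lemma rderiv_comp_real (n m : nat) (f : 'rV[R]_m -> C) (h : 'rV[R]_n -> 'rV[R]_m)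
    (d : 'I_m -> 'I_n -> C) (D : 'I_m -> C) p :
  rderiv f (h p) D -> (forall j, rderiv (fun q => (h q 0 j)%:C) p (d j)) ->
  rderiv (fun q => f (h q)) p (fun i => \sum_j d j i * D j).
Proof.
move=> fD hd; apply: (rderiv_chain (g := fun j q => (h q 0 j)%:C)) => // e e0.
have /nbhs0_box[u u0 hu] := fD e e0.
have := near_forall (fun j => rderiv_lipschitz (hd j) u0); apply: filterS => x gx.
have := hu (h (p + x) - h p) _; rewrite [h p + _]addrC subrK => h1.
have E j : (h (p + x) 0 j)%:C - (h p 0 j)%:C = ((h (p + x) - h p) 0 j)%:C.
  by rewrite !mxE rmorphB.
under eq_bigr do rewrite E; under [X in _ <= _ * X]eq_bigr do rewrite E cabs_real.
by apply: h1 => j; have := gx j; rewrite E cabs_real.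
Qed.

Lemma cderiv_rderiv (n : nat) (F : ('I_n -> C) -> C) (f : 'rV[R]_n -> C) p
    (x : 'rV[R]_n) (r : R) d :
  (forall x : 'rV[R]_n, (forall i, `|x 0 i| <= r) -> f (p + x) = F (cpoint x)) ->
  (forall i, `|x 0 i| < r) -> cderiv F (cpoint x) d -> rderiv f (p + x) d.
Proof.
move=> fF xr Fd e e0; have [u u0 hu] := Fd e e0.
have r0 : forall i, 0 < r - `|x 0 i| by move=> i; rewrite subr_gt0.
apply/nbhs0_box; exists (\big[Num.min/u]_i (r - `|x 0 i|)).
  by elim/big_ind: _ => // y z ? ?; rewrite lt_min; apply/andP.
move=> y yr; have := hu (cpoint y) _.
rewrite -[p + x + y]addrA (fF x); last by move=> i; exact: ltW.
rewrite fF; last first.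
  move=> i; rewrite mxE (le_trans (ler_normD _ _))// -lerBrDl.
  apply: le_trans (yr i) _; exact: bigmin_le_cond.
rewrite (_ : cpoint (x + y) = fun i => cpoint x i + cpoint y i); last first.
  by apply/funext => i; rewrite /cpoint mxE rmorphD.
move=> h; have := h _ => {h}.
under [X in _ <= _ * X]eq_bigr do rewrite cabs_real.
apply=> i; rewrite cabs_real; apply: le_trans (yr i) _; exact: bigmin_le_id.
Qed.

Lemma rderiv_cpartial5 (f : 'rV[R]_5 -> C) p d i : rderiv f p d ->
  cpartial i f p = d i.
Proof.
move=> fd.
(* [g] stands for the real or the imaginary part, so both directional derivatives come from one
   argument. *)
have D (g : C -> R) : (forall x y, g (x - y) = g x - g y) ->
    (forall (t : R) z, g (t%:C * z) = t * g z) ->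
    (forall z, `|g z| <= cabs z) ->
  'D_(delta_mx 0 i) (fun q => g (f q)) p = g (d i).
  move=> gB gZ gn; apply/cvg_lim => //; apply/cvgrPdist_le => e e0.
  have /nbhs0_box[u u0 hu] := fd e e0.
  near=> h.
  have h0 : h != 0 by near: h; exact: nbhs_dnbhs_neq.
  have hu' : `|h| <= u by near: h; exact: dnbhs0_le.
  have := hu (h *: delta_mx 0 i) _; rewrite (bigD1 i)//= big1; last first.
    by move=> j /negPf ji; rewrite !mxE ji andbF mulr0 mul0r.
  rewrite [\sum_i0 _](bigD1 i)//= big1; last first.
    by move=> j /negPf ji; rewrite !mxE ji andbF mulr0 normr0.
  rewrite !mxE !eqxx /= mulr1 !addr0 => hh.
  rewrite /= -[_ *: _]/(h^-1 * _) -[g (d i)](mulKf h0) -mulrBr normrM normfV.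
  rewrite ler_pdivrMl ?normr_gt0// distrC [leRHS]mulrC.
  rewrite -gZ -gB -gB [h *: _ + p]addrC; apply: le_trans (gn _) (hh _) => j.
  by rewrite !mxE; case: (j == i); rewrite ?mulr1 ?mulr0 ?normr0 ?(ltW u0)//.
rewrite /cpartial D; last first.
- exact: cabs_Re.
- by move=> t [a b] /=; rewrite mul0r subr0.
- by move=> x y; rewrite raddfB.
rewrite D; first by case: (d i).
- by move=> x y; rewrite raddfB.
- by move=> t [a b] /=; rewrite mul0r addr0.
- exact: cabs_Im.
Unshelve. all: by end_near. Qed.

End RealDerivative.

(** * Partial derivatives of analytic functions *)

Section Partial.
Context {R : realType}.
Local Notation C := R[i].

(** The first-order Taylor coefficients are themselves majorized on half the polydisc, so partial
    derivatives are again analytic and can be differentiated further. *)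
Lemma cpseries_deriv (n : nat) (f : 'rV[R]_n -> C) (p : 'rV[R]_n) :
  cpseries_at f p -> exists D : 'I_n -> 'rV[R]_n -> C,
    (forall i, cpseries_at (D i) p) /\
    \forall q \near p, rderiv f q (fun i => D i q).
Proof.
move=> [r [F [a [r0 Fa fF]]]].
have r2 : 0 < r / 2 by rewrite divr_gt0.
have [|D [m [Dm FD]]] := majorized_cderiv (fun _ : 'I_n => ltW r2) (fun=> r2) (f := F) (a := a).
  by rewrite (_ : (fun=> _) = fun=> r)//; apply/funext => _; rewrite -splitr.
exists (fun i q => D i (cpoint (q - p))); split=> [i|].
  exists (r / 2), (D i), (m i); split=> // x _.
  by rewrite addrAC subrr add0r.
apply/nbhs_box; exists (r / 2) => // x xr.
rewrite (_ : p + x - p = x); last by rewrite addrAC subrr add0r.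
apply: cderiv_rderiv fF _ _ => [i|].
  by rewrite (le_lt_trans (xr i))// ltr_pdivrMr// ltr_pMr// ltr1n.
by apply: FD => i; rewrite cabs_real.
Qed.

Local Notation pt := 'rV[R]_5.
Implicit Types (f g : pt -> C) (p : pt) (X Y : pt -> 'rV[C]_5).

Lemma cpseries_cpartial i f p : cpseries_at f p -> cpseries_at (cpartial i f) p.
Proof.
move=> /cpseries_deriv[D [Dp fD]]; apply: cpseries_near_eq (Dp i).
by apply: filterS fD => q /(@rderiv_cpartial5 _ _ _ _ i) ->.
Qed.

Lemma cpseries_rderiv f p : cpseries_at f p ->
  rderiv f p (fun i => cpartial i f p).
Proof.
move=> /cpseries_deriv[D [_ /near_at fD]].
by apply: rderiv_ext (fD) _ => i; rewrite (rderiv_cpartial5 i fD).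
Qed.

Lemma cpartial_near_eq i f g p : (\forall q \near p, f q = g q) ->
  cpartial i f p = cpartial i g p.
Proof.
move=> fg; rewrite /cpartial; congr Complex; apply: near_eq_derive.
- by apply: filterS fg => q ->.
- by apply: filterS fg => q ->.
Qed.

Lemma cpartial_cst i c p : cpartial i (fun=> c) p = 0.
Proof. by rewrite (rderiv_cpartial5 i (rderiv_cst c p)). Qed.

Lemma cpartial_real i (g : pt -> R) p :
  cpartial i (fun q => (g q)%:C) p = ('D_(delta_mx 0 i) g p)%:C.
Proof. by rewrite /cpartial derive_cst. Qed.

Lemma cpartialD i f g p : cpseries_at f p -> cpseries_at g p ->
  cpartial i (fun q => f q + g q) p = cpartial i f p + cpartial i g p.
Proof.
by move=> /cpseries_rderiv fp /cpseries_rderiv gp;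
  rewrite (rderiv_cpartial5 i (rderivD fp gp)).
Qed.

Lemma cpartialB i f g p : cpseries_at f p -> cpseries_at g p ->
  cpartial i (fun q => f q - g q) p = cpartial i f p - cpartial i g p.
Proof.
by move=> /cpseries_rderiv fp /cpseries_rderiv gp;
  rewrite (rderiv_cpartial5 i (rderivB fp gp)).
Qed.

Lemma cpartialM i f g p : cpseries_at f p -> cpseries_at g p ->
  cpartial i (fun q => f q * g q) p = cpartial i f p * g p + cpartial i g p * f p.
Proof.
by move=> /cpseries_rderiv fp /cpseries_rderiv gp;
  rewrite (rderiv_cpartial5 i (rderivM fp gp)).
Qed.

Lemma cpartial_sum i (T : Type) (s : seq T) (f : T -> pt -> C) p :
  (forall t, cpseries_at (f t) p) ->
  cpartial i (fun q => \sum_(t <- s) f t q) p = \sum_(t <- s) cpartial i (f t) p.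
Proof.
move=> fp; have fd t := cpseries_rderiv (fp t).
by rewrite (rderiv_cpartial5 i (rderiv_sum s fd)).
Qed.

Lemma cpartial_conj i f p : cpseries_at f p ->
  cpartial i (fun q => (f q)^*) p = (cpartial i f p)^*.
Proof.
by move=> /cpseries_rderiv fp; rewrite (rderiv_cpartial5 i (rderiv_conj fp)).
Qed.

Lemma cpartial_comp i f (h : pt -> pt) p : cpseries_at f (h p) ->
  (forall j, cpseries_at (fun q => (h q 0 j)%:C) p) ->
  cpartial i (fun q => f (h q)) p =
  \sum_j cpartial i (fun q => (h q 0 j)%:C) p * cpartial j f (h p).
Proof.
move=> /cpseries_rderiv fp hp; have hd j := cpseries_rderiv (hp j).
by rewrite (rderiv_cpartial5 i (rderiv_comp_real fp hd)).
Qed.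

(* Write [f = c + sum_i x_i g_i] around [p]; then [d_k f = g_k + sum_i x_i d_k g_i],
   so [d_l d_k f (p) = d_l g_k (p) + d_k g_l (p)], which is symmetric. *)
Lemma cpartial_schwarz k l f p : cpseries_at f p ->
  cpartial k (cpartial l f) p = cpartial l (cpartial k f) p.
Proof.
move=> fp; have [g [gp fE]] := cpseries_factor fp.
pose x (i : 'I_5) (q : pt) : C := (q 0 i - p 0 i)%:C.
have {}fE : \forall q \near p, f q = f p + \sum_i x i q * g i q := fE.
have xE i q : x i q = (q 0 i)%:C - (p 0 i)%:C by rewrite /x rmorphB.
have xp i q : cpseries_at (x i) q.
  rewrite (_ : x i = fun q => (q 0 i)%:C - (p 0 i)%:C); last exact/funext.
  by apply: cpseriesB; [exact: cpseries_coord|exact: cpseries_cst].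
have xd m i q : cpartial m (x i) q = (m == i)%:R.
  rewrite (_ : x i = fun q => (q 0 i)%:C - (p 0 i)%:C); last exact/funext.
  rewrite cpartialB; [|exact: cpseries_coord|exact: cpseries_cst].
  by rewrite cpartial_cst subr0 (rderiv_cpartial5 m (rderiv_coord i q)).
have E m : \forall q \near p, cpartial m f q = g m q + \sum_i x i q * cpartial m (g i) q.
  have := near_forall (fun i => cpseries_near (gp i)).
  apply: filterS2 (near_near fE) => q fq gq.
  rewrite (cpartial_near_eq m fq) cpartialD; [|exact: cpseries_cst|]; last first.
    by apply: cpseries_sum => i _; exact: (cpseriesM (xp i q) (gq i)).
  rewrite cpartial_cst add0r cpartial_sum => [|i]; last exact: cpseriesM.
  under eq_bigr do rewrite cpartialM// xd.
  rewrite big_split /=; congr (_ + _).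
    rewrite (bigD1 m)//= eqxx mul1r big1 ?addr0// => i.
    by rewrite eq_sym => /negPf ->; rewrite mul0r.
  by apply: eq_bigr => i _; rewrite mulrC.
have x0 i : x i p = 0 by rewrite /x subrr.
have F m n : cpartial n (cpartial m f) p = cpartial n (g m) p + cpartial m (g n) p.
  rewrite (cpartial_near_eq n (E m)) cpartialD//; last first.
    by apply: cpseries_sum => i _; apply: cpseriesM => //; exact: cpseries_cpartial.
  congr (_ + _); rewrite cpartial_sum => [|i]; last first.
    by apply: cpseriesM => //; exact: cpseries_cpartial.
  rewrite (eq_bigr (fun t => (n == t)%:R * cpartial m (g t) p)); last first.
    move=> t _; rewrite cpartialM//; last exact: cpseries_cpartial.
    by rewrite xd x0 mulr0 addr0.
  rewrite (bigD1 n)//= eqxx mul1r big1 ?addr0// => i.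
  by rewrite eq_sym => /negPf ->; rewrite mul0r.
by rewrite !F addrC.
Qed.

Lemma analytic_cpseries (n : nat) (f : 'rV[R]_n -> R) (p : 'rV[R]_n) :
  analytic_at f p ->
  cpseries_at (fun q => (f q)%:C) p.
Proof.
by move=> /majorized_of_analytic[r [F [b [r0 Fb gF]]]]; exists r, F, b.
Qed.

Lemma vanalytic_differentiable (h : pt -> pt) p : vanalytic_at h p ->
  differentiable h p /\ forall i j, cjacobian h p i j = cpartial i (fun q => (h q 0 j)%:C) p.
Proof.
move=> hp; pose D : 'M[R]_5 := \matrix_(i, j) 'D_(delta_mx 0 i) (fun q => h q 0 j) p.
have Dc i j : (D i j)%:C = cpartial i (fun q => (h q 0 j)%:C) p.
  by rewrite mxE cpartial_real.
have [|dh jE] := @differentiable_rowP _ _ _ h p D.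
  (* The l^1 norm of a row with five entries is at most five times its maximum norm. *)
  move=> e e0; have e5 : 0 < e / 5 by rewrite divr_gt0.
  have hd j := cpseries_rderiv (analytic_cpseries (hp j)).
  have := near_forall (fun j => hd j _ e5); apply: filterS => x hx.
  apply/mx_norm_leP; first by rewrite mulr_ge0// ltW.
  move=> i j; rewrite (ord1 i) -cabs_real; have := hx j => {}hx.
  rewrite !mxE !rmorphB rmorph_sum /=.
  rewrite (eq_bigr (fun k => (x 0 k)%:C * cpartial k (fun q => (h q 0 j)%:C) p)); last first.
    by move=> k _; rewrite rmorphM -Dc.
  apply: le_trans hx _; rewrite mulrAC ler_pdivrMr// -mulrA ler_pM2l//.
  have -> : `|x| * 5 = \sum_(i < 5) `|x| by rewrite sumr_const card_ord mulr_natr.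
  by apply: ler_sum => k _; exact: mx_norm_entry.
split=> // i j; by rewrite mxE jE -Dc.
Qed.

End Partial.

(** * Brackets, frames and related fields *)

Section VectorFields.
Context {R : realType}.
Local Notation C := R[i].
Local Notation pt := 'rV[R]_5.
Implicit Types (f g a b : pt -> C) (p q : pt) (X Y Z : pt -> 'rV[C]_5).

Definition field_analytic X p := forall k, cpseries_at (fun q => X q 0 k) p.

Lemma field_analytic_near X p : field_analytic X p ->
  \forall q \near p, field_analytic X q.
Proof. by move=> Xp; apply: near_forall => k; exact: cpseries_near. Qed.

Lemma field_analyticZ a X p : cpseries_at a p -> field_analytic X p ->
  field_analytic (fun q => a q *: X q) p.
Proof.
move=> ap Xp k; apply: cpseries_near_eq (cpseriesM ap (Xp k)).
by apply/nbhs_box; exists 1 => // x _; rewrite mxE.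
Qed.

Lemma field_analyticD X Y p : field_analytic X p -> field_analytic Y p ->
  field_analytic (fun q => X q + Y q) p.
Proof.
move=> Xp Yp k; apply: cpseries_near_eq (cpseriesD (Xp k) (Yp k)).
by apply/nbhs_box; exists 1 => // x _; rewrite mxE.
Qed.

Lemma field_analytic_conj X p : field_analytic X p ->
  field_analytic (conj_field X) p.
Proof.
move=> Xp k; apply: cpseries_near_eq (cpseries_conj (Xp k)).
by apply/nbhs_box; exists 1 => // x _; rewrite mxE.
Qed.

Lemma cpseries_apply X f p : field_analytic X p -> cpseries_at f p ->
  cpseries_at (apply_field X f) p.
Proof.
move=> Xp fp; apply: cpseries_sum => i _.
by apply: cpseriesM => //; exact: cpseries_cpartial.
Qed.

Lemma field_analytic_bracket X Y p : field_analytic X p -> field_analytic Y p ->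
  field_analytic (bracket X Y) p.
Proof.
move=> Xp Yp k; apply: cpseries_near_eq
  (cpseriesB (cpseries_apply Xp (Yp k)) (cpseries_apply Yp (Xp k))).
by apply/nbhs_box; exists 1 => // x _; rewrite mxE.
Qed.

Lemma apply_field_near_eq X f g p : (\forall q \near p, f q = g q) ->
  apply_field X f p = apply_field X g p.
Proof.
by move=> fg; apply: eq_bigr => i _; rewrite (cpartial_near_eq i fg).
Qed.

Lemma apply_fieldD X f g p : cpseries_at f p -> cpseries_at g p ->
  apply_field X (fun q => f q + g q) p = apply_field X f p + apply_field X g p.
Proof.
move=> fp gp; rewrite -big_split; apply: eq_bigr => i _.
by rewrite cpartialD// mulrDr.
Qed.

Lemma apply_fieldM X f g p : cpseries_at f p -> cpseries_at g p ->
  apply_field X (fun q => f q * g q) p =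
  apply_field X f p * g p + f p * apply_field X g p.
Proof.
move=> fp gp; rewrite mulr_suml mulr_sumr -big_split; apply: eq_bigr => i _ /=.
by rewrite cpartialM//; ring.
Qed.

Lemma apply_field_sum X (T : Type) (s : seq T) (f : T -> pt -> C) p :
  (forall t, cpseries_at (f t) p) ->
  apply_field X (fun q => \sum_(t <- s) f t q) p = \sum_(t <- s) apply_field X (f t) p.
Proof.
move=> fp; rewrite /apply_field exchange_big; apply: eq_bigr => i _ /=.
by rewrite cpartial_sum// mulr_sumr.
Qed.

Lemma apply_fieldZl (c : C) X Y f p : Y p = c *: X p ->
  apply_field Y f p = c * apply_field X f p.
Proof.
by move=> e; rewrite mulr_sumr; apply: eq_bigr => i _; rewrite e mxE mulrA.
Qed.

Lemma apply_fieldDl X Y Z f p : Z p = X p + Y p ->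
  apply_field Z f p = apply_field X f p + apply_field Y f p.
Proof.
move=> e; rewrite -big_split; apply: eq_bigr => i _ /=.
by rewrite e mxE mulrDl.
Qed.

Lemma apply_field_conj X f p : cpseries_at f p ->
  apply_field (conj_field X) (fun q => (f q)^*) p = (apply_field X f p)^*.
Proof.
move=> fp; rewrite rmorph_sum; apply: eq_bigr => i _ /=.
by rewrite cpartial_conj// mxE rmorphM.
Qed.

Lemma bracketC X Y p : bracket X Y p = - bracket Y X p.
Proof. by apply/rowP => k; rewrite !mxE opprB. Qed.

Lemma bracket_near_eq X X' Y Y' p : (\forall q \near p, X q = X' q) ->
  (\forall q \near p, Y q = Y' q) -> bracket X Y p = bracket X' Y' p.
Proof.
move=> XX' YY'; apply/rowP => k; rewrite !mxE.
have sub Z Z' W : (\forall q \near p, Z q = Z' q) -> (\forall q \near p, W q = Z q) ->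
  forall f g, (\forall q \near p, f q = g q) -> apply_field Z f p = apply_field Z' g p.
  move=> ZZ' _ f g fg; rewrite (apply_field_near_eq Z fg).
  by rewrite /apply_field (near_at ZZ').
congr (_ - _).
  apply: (sub _ _ X XX'); first by apply/nbhs_box; exists 1.
  by apply: filterS YY' => q ->.
apply: (sub _ _ Y YY'); first by apply/nbhs_box; exists 1.
by apply: filterS XX' => q ->.
Qed.

Lemma bracket_conj X Y p : field_analytic X p -> field_analytic Y p ->
  bracket (conj_field X) (conj_field Y) p = conj_mx (bracket X Y p).
Proof.
move=> Xp Yp; apply/rowP => k; rewrite !mxE rmorphB /=.
have cE Z : (fun q => conj_field Z q 0 k) = (fun q => (Z q 0 k)^*).
  by apply/funext => q; rewrite mxE.
by rewrite !cE !apply_field_conj.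
Qed.

Lemma bracketDr X Y Z p : field_analytic X p -> field_analytic Y p ->
  field_analytic Z p ->
  bracket X (fun q => Y q + Z q) p = bracket X Y p + bracket X Z p.
Proof.
move=> Xp Yp Zp; apply/rowP => k; rewrite !mxE.
rewrite (_ : (fun q => (Y q + Z q) 0 k) = fun q => Y q 0 k + Z q 0 k); last first.
  by apply/funext => q; rewrite mxE.
by rewrite apply_fieldD// (apply_fieldDl (X := Y) (Y := Z) (Z := fun q => Y q + Z q))// opprD addrACA.
Qed.

Lemma bracketZ a b X Y p : cpseries_at a p -> cpseries_at b p ->
  field_analytic X p -> field_analytic Y p ->
  bracket (fun q => a q *: X q) (fun q => b q *: Y q) p =
  (a p * b p) *: bracket X Y p + (a p * apply_field X b p) *: Y p
  - (b p * apply_field Y a p) *: X p.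
Proof.
move=> ap bp Xp Yp; apply/rowP => k; rewrite !mxE.
have sE c Z : (fun q => (c q *: Z q) 0 k) = fun q => c q * Z q 0 k.
  by apply/funext => q; rewrite mxE.
rewrite !sE !apply_fieldM//.
rewrite !(apply_fieldZl (c := a p) (X := X) (Y := fun q => a q *: X q))//.
by rewrite !(apply_fieldZl (c := b p) (X := Y) (Y := fun q => b q *: Y q))//; ring.
Qed.

Definition related (h : pt -> pt) X X' p := X p *m cjacobian h p = X' (h p).

(* The second derivatives of [h] cancel in the bracket. *)
Lemma related_bracket (h : pt -> pt) X X' Y Y' p : vanalytic_at h p ->
  field_analytic X p -> field_analytic Y p ->
  field_analytic X' (h p) -> field_analytic Y' (h p) ->
  (\forall q \near p, related h X X' q) -> (\forall q \near p, related h Y Y' q) ->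
  related h (bracket X Y) (bracket X' Y') p.
Proof.
move=> hp Xp Yp Xp' Yp' XX' YY'; apply/rowP => l; rewrite !mxE.
have hc j : cpseries_at (fun q => (h q 0 j)%:C) p by exact: analytic_cpseries.
have Jc k : cpseries_at (cpartial k (fun q => (h q 0 l)%:C)) p by exact: cpseries_cpartial.
have hn : \forall q \near p, forall j, cpseries_at (fun q => (h q 0 j)%:C) q.
  by apply: near_forall => j; exact: cpseries_near.
have hn' : \forall q \near p, vanalytic_at h q.
  apply: filterS hn => q hq j; have /canalytic_atP[+ _] := hq j.
  by [].
have JE : \forall q \near p, forall i j, cjacobian h q i j = cpartial i (fun q => (h q 0 j)%:C) q.
  by apply: filterS hn' => q /vanalytic_differentiable[_].
(* Along [h] the component [l] of [W'] is [W] applied to the component [l] of [h]. Differentiating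
   it along [Z] with the Leibniz rule isolates the second derivatives of [h] in a double sum, to be
   compared for the two orders of the fields. *)
have push Z Z' W W' : field_analytic Z p -> field_analytic W p ->
    field_analytic W' (h p) -> (\forall q \near p, related h Z Z' q) ->
    (\forall q \near p, related h W W' q) ->
    apply_field Z' (fun q => W' q 0 l) (h p) =
    \sum_k apply_field Z (fun q => W q 0 k) p * cpartial k (fun q => (h q 0 l)%:C) p +
    \sum_k \sum_j W p 0 k * (Z p 0 j * cpartial j (cpartial k (fun q => (h q 0 l)%:C)) p).
  move=> Zp Wp Wp' ZZ' WW'.
  transitivity (apply_field Z (fun q => W' (h q) 0 l) p).
    rewrite /apply_field; under [RHS]eq_bigr do rewrite (cpartial_comp _ (Wp' l) hc) mulr_sumr.
    rewrite exchange_big /=; apply: eq_bigr => j _.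
    rewrite -(near_at ZZ') mxE mulr_suml; apply: eq_bigr => i _.
    by rewrite (near_at JE) mulrA.
  transitivity (apply_field Z (fun q => \sum_k W q 0 k * cpartial k (fun q => (h q 0 l)%:C) q) p).
    apply: apply_field_near_eq; apply: filterS2 JE WW' => q Jq <-.
    by rewrite mxE; apply: eq_bigr => k _; rewrite Jq.
  rewrite apply_field_sum => [|k]; last exact: cpseriesM.
  rewrite -big_split /=; apply: eq_bigr => k _.
  by rewrite apply_fieldM// mulr_sumr.
rewrite (push X X' Y Y')// (push Y Y' X X')//.
rewrite (eq_bigr (fun k => apply_field X (fun q => Y q 0 k) p * cpartial k (fun q => (h q 0 l)%:C) p
  - apply_field Y (fun q => X q 0 k) p * cpartial k (fun q => (h q 0 l)%:C) p)); last first.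
  by move=> k _; rewrite mxE (near_at JE) mulrBl.
rewrite sumrB opprD addrACA -[LHS]addr0; congr (_ + _); apply/eqP.
rewrite eq_sym subr_eq0 exchange_big /=; apply/eqP; apply: eq_bigr => j _.
by apply: eq_bigr => k _; rewrite (cpartial_schwarz j k (hc l)) mulrCA.
Qed.

Section Frames.

(** The frame construction for an arbitrary generator in place of [fieldL], so that [L] and
    [L / A_0] are treated by the same lemmas. *)
Definition fieldT_of (E : pt -> 'rV[C]_5) p := 'i *: bracket E (conj_field E) p.
Definition fieldS_of E : pt -> 'rV[C]_5 := bracket E (fieldT_of E).
Definition fieldSbar_of E : pt -> 'rV[C]_5 := bracket (conj_field E) (fieldT_of E).
Definition frame_of E p : 'M[C]_5 :=
  \matrix_(i < 5) [:: fieldSbar_of E p; fieldS_of E p; fieldT_of E p;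
                      conj_field E p; E p]`_i.
Definition fundR_of E p : C :=
  (bracket E (fieldS_of E) p *m invmx (frame_of E p)) 0 0.

Variable E : pt -> 'rV[C]_5.

Lemma field_analytic_T p : field_analytic E p -> field_analytic (fieldT_of E) p.
Proof.
move=> Ep; apply: field_analyticZ; first exact: cpseries_cst.
by apply: field_analytic_bracket => //; exact: field_analytic_conj.
Qed.

Lemma field_analytic_S p : field_analytic E p -> field_analytic (fieldS_of E) p.
Proof.
by move=> Ep; apply: field_analytic_bracket => //; exact: field_analytic_T.
Qed.

Lemma field_analytic_Sbar p : field_analytic E p -> field_analytic (fieldSbar_of E) p.
Proof.
move=> Ep; apply: field_analytic_bracket; first exact: field_analytic_conj.
exact: field_analytic_T.
Qed.

Lemma conj_mxK (m n : nat) (A : 'M[C]_(m, n)) : conj_mx (conj_mx A) = A.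
Proof. by apply/matrixP => i j; rewrite !mxE conjcK. Qed.

Lemma conj_fieldK X : conj_field (conj_field X) = X.
Proof. by apply/funext => p; exact: conj_mxK. Qed.

Lemma conj_mxZ (m n : nat) c (A : 'M[C]_(m, n)) : conj_mx (c *: A) = c^* *: conj_mx A.
Proof. by apply/matrixP => i j; rewrite !mxE rmorphM. Qed.

Lemma conj_mxD (m n : nat) (A B : 'M[C]_(m, n)) : conj_mx (A + B) = conj_mx A + conj_mx B.
Proof. by apply/matrixP => i j; rewrite !mxE rmorphD. Qed.

Lemma fieldT_real p : field_analytic E p -> conj_mx (fieldT_of E p) = fieldT_of E p.
Proof.
move=> Ep; rewrite /fieldT_of conj_mxZ -bracket_conj//; last exact: field_analytic_conj.
rewrite conj_fieldK bracketC scalerN -scaleNr; congr (_ *: _).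
by apply/eqP; rewrite eq_complex /= oppr0 opprK !eqxx.
Qed.

Lemma fieldSbar_conj p : field_analytic E p -> fieldSbar_of E p = conj_mx (fieldS_of E p).
Proof.
move=> Ep; rewrite /fieldS_of -bracket_conj//; last exact: field_analytic_T.
apply: bracket_near_eq; first by apply/nbhs_box; exists 1.
by apply: filterS (field_analytic_near Ep) => q Eq; rewrite /conj_field fieldT_real.
Qed.

End Frames.

Lemma related_conj (h : pt -> pt) X X' p : related h X X' p ->
  related h (conj_field X) (conj_field X') p.
Proof.
rewrite /related /conj_field => <-; apply/rowP => j; rewrite !mxE rmorph_sum.
by apply: eq_bigr => i _; rewrite rmorphM !mxE; congr (_ * _); apply: esym; exact: conjc_real.
Qed.

Lemma relatedZ (h : pt -> pt) c X X' p : related h X X' p ->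
  related h (fun q => c *: X q) (fun q => c *: X' q) p.
Proof. by rewrite /related => <-; rewrite -scalemxAl. Qed.

Section RelatedFrames.
Variables (h : pt -> pt) (E E' : pt -> 'rV[C]_5) (p : pt).
Hypotheses (hp : vanalytic_at h p) (Ep : field_analytic E p)
  (Ep' : field_analytic E' (h p)) (EE' : \forall q \near p, related h E E' q).

Lemma near_vanalytic : \forall q \near p, vanalytic_at h q.
Proof.
have : \forall q \near p, forall j, cpseries_at (fun q => (h q 0 j)%:C) q.
  by apply: near_forall => j; apply: cpseries_near; exact: analytic_cpseries.
by apply: filterS => q hq j; have /canalytic_atP[+ _] := hq j.
Qed.

Lemma near_image (P : pt -> Prop) : (\forall q \near h p, P q) ->
  \forall q \near p, P (h q).
Proof.
have [dh _] := vanalytic_differentiable hp.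
exact: (differentiable_continuous dh).
Qed.

(** A bracket at a point uses relatedness of its arguments on a neighbourhood. The conclusion is
    therefore carried near [p], and [near_near] reopens the neighbourhood before each new
    bracket. *)
Lemma related_frame_near : \forall q \near p,
  [/\ related h (fieldT_of E) (fieldT_of E') q,
      related h (fieldS_of E) (fieldS_of E') q,
      related h (fieldSbar_of E) (fieldSbar_of E') q &
      related h (bracket E (fieldS_of E)) (bracket E' (fieldS_of E')) q].
Proof.
have En := field_analytic_near Ep.
have En' := near_image (field_analytic_near Ep').
have hn := near_vanalytic; have EEn := near_near EE'.
have cEn q : (\forall q \near q, related h E E' q) ->
    \forall q \near q, related h (conj_field E) (conj_field E') q.
  by apply: filterS => q'; exact: related_conj.
have Tn : \forall q \near p, related h (fieldT_of E) (fieldT_of E') q.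
  apply: filterS2 (filterI En En') (filterI hn EEn) => q [Eq Eq'] [hq EEq].
  apply: relatedZ; apply: related_bracket => //; try exact: field_analytic_conj.
  exact: cEn.
have Sn : \forall q \near p, related h (fieldS_of E) (fieldS_of E') q.
  apply: filterS3 (filterI En En') (filterI hn EEn) (near_near Tn) => q [Eq Eq'] [hq EEq] Tq.
  by apply: related_bracket => //; exact: field_analytic_T.
have Sbn : \forall q \near p, related h (fieldSbar_of E) (fieldSbar_of E') q.
  apply: filterS3 (filterI En En') (filterI hn EEn) (near_near Tn) => q [Eq Eq'] [hq EEq] Tq.
  apply: related_bracket => //; try exact: field_analytic_conj; try exact: field_analytic_T.
  exact: cEn.
have Bn : \forall q \near p, related h (bracket E (fieldS_of E)) (bracket E' (fieldS_of E')) q.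
  apply: filterS3 (filterI En En') (filterI hn EEn) (near_near Sn) => q [Eq Eq'] [hq EEq] Sq.
  by apply: related_bracket => //; exact: field_analytic_S.
by apply: filterS3 (filterI Tn Sn) Sbn Bn => q [].
Qed.

Lemma related_frame : frame_of E p *m cjacobian h p = frame_of E' (h p).
Proof.
have [T S Sb _] := near_at related_frame_near; have EEp := near_at EE'.
apply/row_matrixP => i; rewrite row_mul !rowK.
case: i => -[|[|[|[|[|//]]]]] ? /=; rewrite ?T ?S ?Sb//.
exact: related_conj.
Qed.

Lemma related_fundR : frame_of E p \in unitmx -> frame_of E' (h p) \in unitmx ->
  fundR_of E p = fundR_of E' (h p).
Proof.
move=> uE uE'; have [_ _ _ B] := near_at related_frame_near.
rewrite /fundR_of -B -related_frame; congr (fun_of_matrix _ 0 0).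
apply: (canRL (mulmxK _)); first by rewrite related_frame.
by rewrite mulmxA mulmxKV.
Qed.

End RelatedFrames.

End VectorFields.

(** * Rescaling the generating field *)

Lemma numconjE (R : realType) (z : R[i]) : Num.conj z = conjc z.
Proof. by []. Qed.

Section Rescaling.
Context {R : realType}.
Local Notation C := R[i].
Local Notation pt := 'rV[R]_5.
Variables (a : pt -> C) (L : pt -> 'rV[C]_5).

Let E q := a q *: L q.
Let Lb := conj_field L.
Let T := fieldT_of L.
Let S := fieldS_of L.
Let Sb := fieldSbar_of L.

Lemma near_true (P : pt -> Prop) (p : pt) : (forall q, P q) -> \forall q \near p, P q.
Proof. by move=> Pq; apply/nbhs_box; exists 1. Qed.

Lemma bracketXX (X : pt -> 'rV[C]_5) p : bracket X X p = 0.
Proof. by apply/rowP => k; rewrite !mxE subrr. Qed.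

Lemma bracket_LLb p : bracket L Lb p = - 'i *: T p.
Proof.
rewrite /T /fieldT_of scalerA (_ : - 'i * 'i = 1) ?scale1r//.
by rewrite mulNr -expr2 sqr_i opprK.
Qed.

Lemma rescale_conj : conj_field E = fun q => conjc (a q) *: Lb q.
Proof. by apply/funext => q; rewrite /conj_field /E conj_mxZ. Qed.

(** The Leibniz terms fall on fields lower in the filtration. Their coefficients remain existential,
    since the final rule sees leading coefficients only, but they must be analytic because the next
    bracket differentiates them. *)
Lemma rescale_T p : cpseries_at a p -> field_analytic L p ->
  exists al be : pt -> C, [/\ cpseries_at al p, cpseries_at be p &
    \forall q \near p, fieldT_of E q =
      (a q * conjc (a q)) *: T q + al q *: Lb q + be q *: L q].
Proof.
move=> ap Lp; have abp := cpseries_conj ap.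
have Lbp : field_analytic Lb p by exact: field_analytic_conj.
exists (fun q => 'i * (a q * apply_field L (fun q => conjc (a q)) q)).
exists (fun q => - ('i * (conjc (a q) * apply_field Lb a q))); split.
- apply: cpseriesM; first exact: cpseries_cst.
  by apply: cpseriesM => //; exact: cpseries_apply.
- apply: cpseriesN; apply: cpseriesM; first exact: cpseries_cst.
  by apply: cpseriesM => //; exact: cpseries_apply.
apply: filterS2 (cpseries_near ap) (field_analytic_near Lp) => q aq Lq.
rewrite /fieldT_of rescale_conj bracketZ//.
- rewrite /T /fieldT_of -/Lb.
  move: (bracket L Lb q) (Lb q) (L q) => vB vLb vL.
  by apply/rowP => k; rewrite !mxE; ring.
- exact: cpseries_conj.
- exact: field_analytic_conj.
Qed.

Lemma rescale_S p : cpseries_at a p -> field_analytic L p ->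
  exists c1 c2 c3 : pt -> C,
    [/\ cpseries_at c1 p, cpseries_at c2 p, cpseries_at c3 p &
    \forall q \near p, fieldS_of E q =
      (a q ^+ 2 * conjc (a q)) *: S q + (c1 q *: T q + (c2 q *: Lb q + c3 q *: L q))].
Proof.
move=> ap Lp; have [al [be [alp bep TE]]] := rescale_T ap Lp.
pose n q := a q * conjc (a q).
have np : cpseries_at n p by apply: cpseriesM => //; exact: cpseries_conj.
have Lbp : field_analytic Lb p by exact: field_analytic_conj.
have Tp : field_analytic T p by exact: field_analytic_T.
exists (fun q => a q * apply_field L n q - 'i * (a q * al q)).
exists (fun q => a q * apply_field L al q).
exists (fun q => a q * apply_field L be q - be q * apply_field L a q
   - n q * apply_field T a q - al q * apply_field Lb a q); split.
- apply: cpseriesB; first by apply: cpseriesM => //; exact: cpseries_apply.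
  apply: cpseriesM; first exact: cpseries_cst.
  exact: cpseriesM.
- by apply: cpseriesM => //; exact: cpseries_apply.
- by do ! apply: cpseriesB; apply: cpseriesM => //; exact: cpseries_apply.
have aln : \forall q \near p, cpseries_at al q /\ cpseries_at be q.
  exact: filterI (cpseries_near alp) (cpseries_near bep).
apply: filterS3 (filterI (cpseries_near ap) aln) (field_analytic_near Lp)
  (near_near TE) => q [aq [alq beq]] Lq TEq.
have nq : cpseries_at n q by apply: cpseriesM => //; exact: cpseries_conj.
have Lbq : field_analytic Lb q by exact: field_analytic_conj.
have Tq : field_analytic T q by exact: field_analytic_T.
rewrite /fieldS_of (bracket_near_eq (X' := E) (Y' := fun q =>
  (n q *: T q + al q *: Lb q) + be q *: L q) (near_true _ _) TEq)//.
have aEq := field_analyticZ aq Lq.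
rewrite !bracketDr//; try exact: field_analyticZ; last first.
  by apply: field_analyticD; exact: field_analyticZ.
rewrite !bracketZ// bracketXX scaler0 add0r bracket_LLb.
rewrite -/(fieldS_of L q) -/(S q) -/(T q); move: (S q) (T q) (L q) (Lb q) => vS vT vL vLb.
by apply/rowP => k; rewrite !mxE /n; ring.
Qed.

Lemma rescale_LS p : cpseries_at a p -> field_analytic L p ->
  exists e0 e1 e2 e3 : C, bracket E (fieldS_of E) p =
    (a p ^+ 3 * conjc (a p)) *: bracket L S p +
    (e0 *: S p + (e1 *: T p + (e2 *: Lb p + e3 *: L p))).
Proof.
move=> ap Lp; have [c1 [c2 [c3 [c1p c2p c3p SE]]]] := rescale_S ap Lp.
pose n q := a q ^+ 2 * conjc (a q).
have np : cpseries_at n p.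
  by apply: cpseriesM; [exact: cpseriesX|exact: cpseries_conj].
have Lbp : field_analytic Lb p by exact: field_analytic_conj.
have Tp : field_analytic T p by exact: field_analytic_T.
have Sp : field_analytic S p by exact: field_analytic_S.
have aEp := field_analyticZ ap Lp.
exists (a p * apply_field L n p + a p * c1 p).
exists (a p * apply_field L c1 p - 'i * (a p * c2 p)).
exists (a p * apply_field L c2 p).
exists (a p * apply_field L c3 p - c3 p * apply_field L a p - c2 p * apply_field Lb a p
   - c1 p * apply_field T a p - n p * apply_field S a p).
rewrite (bracket_near_eq (X' := E) (Y' := fun q => n q *: S q +
  (c1 q *: T q + (c2 q *: Lb q + c3 q *: L q))) (near_true _ _) SE)//.
have SZ := field_analyticZ np Sp; have TZ := field_analyticZ c1p Tp.
have LbZ := field_analyticZ c2p Lbp; have LZ := field_analyticZ c3p Lp.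
have D1 := field_analyticD LbZ LZ; have D2 := field_analyticD TZ D1.
rewrite (bracketDr aEp SZ D2) (bracketDr aEp TZ D1) (bracketDr aEp LbZ LZ).
rewrite !bracketZ// bracketXX scaler0 add0r bracket_LLb.
rewrite -[bracket L T p]/(S p); move: (bracket L S p) (S p) (T p) (L p) (Lb p) => vB vS vT vL vLb.
by apply/rowP => k; rewrite !mxE /n; ring.
Qed.

(** The change of frame in the order (Sbar, S, T, Ebar, E): apart from lower terms the fields are
    only multiplied by the diagonal, and neither Sbar and S nor Ebar and E mix. *)
Definition utrig5 (d0 d1 d2 d3 d4 x02 x03 x04 x12 x13 x14 x23 x24 : C) : 'M[C]_5 :=
  \matrix_(i, j) nth 0 (nth [::] [:: [:: d0; 0; x02; x03; x04];
    [:: 0; d1; x12; x13; x14]; [:: 0; 0; d2; x23; x24];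
    [:: 0; 0; 0; d3; 0]; [:: 0; 0; 0; 0; d4]] i) j.

Lemma utrig5_unit d0 d1 d2 d3 d4 x02 x03 x04 x12 x13 x14 x23 x24 :
  d0 != 0 -> d1 != 0 -> d2 != 0 -> d3 != 0 -> d4 != 0 ->
  utrig5 d0 d1 d2 d3 d4 x02 x03 x04 x12 x13 x14 x23 x24 \in unitmx.
Proof.
move=> h0 h1 h2 h3 h4; rewrite -unitmx_tr unitmxE det_trig.
  by rewrite !big_ord_recl big_ord0 !mxE /= mulr1 unitfE !mulf_neq0.
apply/is_trig_mxP => i j ij; rewrite !mxE.
by case: i j ij => -[|[|[|[|[|//]]]]] ? [[|[|[|[|[|//]]]]] ?].
Qed.

(** Comparison of the coefficients of Sbar. In the old frame, [[E, S_E]] has [a^3 conj a * R_L], as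
    its lower terms involve no Sbar; in the new frame it is [R_E] times the corner entry
    [(conj a)^2 a]. The quotient is [a^2 / conj a]. *)
Lemma rescale_frame p : cpseries_at a p -> field_analytic L p -> a p != 0 ->
  frame_of L p \in unitmx ->
  frame_of E p \in unitmx /\ fundR_of E p = a p ^+ 2 / conjc (a p) * fundR_of L p.
Proof.
move=> ap Lp a0 uL; have ab0 : conjc (a p) != 0 by rewrite conjc_eq0.
have Ep : field_analytic E p by exact: field_analyticZ.
have [al [be [_ _ /near_at TE]]] := rescale_T ap Lp.
have [c1 [c2 [c3 [_ _ _ /near_at SE]]]] := rescale_S ap Lp.
have [e0 [e1 [e2 [e3 BE]]]] := rescale_LS ap Lp.
have SbE : fieldSbar_of E p = ((conjc (a p)) ^+ 2 * a p) *: Sb p +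
    (conjc (c1 p) *: T p + (conjc (c2 p) *: L p + conjc (c3 p) *: Lb p)).
  rewrite fieldSbar_conj// SE !conj_mxD (conj_mxZ _ (S p)) (conj_mxZ _ (T p)).
  rewrite (conj_mxZ _ (Lb p)) (conj_mxZ _ (L p)).
  rewrite (fieldT_real Lp : conj_mx (T p) = T p) -(fieldSbar_conj Lp : Sb p = conj_mx (S p)).
  by rewrite !numconjE rmorphM rmorphXn /= conjcK /Lb /conj_field conj_mxK.
pose M := utrig5 ((conjc (a p)) ^+ 2 * a p) (a p ^+ 2 * conjc (a p)) (a p * conjc (a p))
  (conjc (a p)) (a p) (conjc (c1 p)) (conjc (c3 p)) (conjc (c2 p)) (c1 p) (c2 p) (c3 p)
  (al p) (be p).
have uM : M \in unitmx by rewrite utrig5_unit// ?mulf_neq0 ?expf_neq0.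
have FE : frame_of E p = M *m frame_of L p.
  apply/row_matrixP => i; rewrite row_mul /frame_of mulmx_rows5 rowK.
  rewrite -/(Sb p) -/(S p) -/(T p) -/(Lb p).
  case: i => -[|[|[|[|[|//]]]]] ? /=; rewrite ?SbE ?SE ?TE ?rescale_conj -?[E p]/(a p *: L p);
    move: (Sb p) (S p) (T p) (L p) (Lb p) => vSb vS vT vL vLb;
    by apply/rowP => k; rewrite !mxE /=; ring.
have uE : frame_of E p \in unitmx by rewrite FE unitmx_mul uM.
split=> //; rewrite /fundR_of.
set u := bracket E _ p *m _.
have uB : bracket E (fieldS_of E) p *m invmx (frame_of L p) = u *m M.
  rewrite -[bracket E _ p](mulmxKV uE) -/u FE mulmxA mulmxK//.
have dual v i : row i (frame_of L p) = v -> v *m invmx (frame_of L p) = delta_mx 0 i.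
  by move=> <-; rewrite -row_mul mulmxV// row1.
have dS : S p *m invmx (frame_of L p) = delta_mx 0 1 by apply: dual; rewrite rowK.
have dT : T p *m invmx (frame_of L p) = delta_mx 0 2 by apply: dual; rewrite rowK.
have dLb : Lb p *m invmx (frame_of L p) = delta_mx 0 3 by apply: dual; rewrite rowK.
have dL : L p *m invmx (frame_of L p) = delta_mx 0 4 by apply: dual; rewrite rowK.
move: (congr1 (fun v : 'rV_5 => v 0 0) uB); rewrite BE.
rewrite -/S; set W := invmx (frame_of L p) in dS dT dLb dL *.
move: (bracket L S p) (S p) (T p) (Lb p) (L p) dS dT dLb dL => vB vS vT vLb vL dS dT dLb dL.
rewrite !mulmxDl -!scalemxAl dS dT dLb dL.
rewrite [RHS]mxE 5!big_ord_recl big_ord0 !mxE /= !mulr0 !addr0 => e.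
have d0 : (conjc (a p)) ^+ 2 * a p != 0 by rewrite mulf_neq0// expf_neq0.
rewrite (_ : ord0 = 0) in e; last exact: val_inj.
apply: (mulIf d0); rewrite -e; field.
by rewrite ab0.
Qed.

End Rescaling.

(** * The adapted coframe *)

Section MatrixFunctions.
Context {R : realType}.
Local Notation C := R[i].
Variable N : nat.

Definition mx_analytic (m n : nat) (A : 'rV[R]_N -> 'M[C]_(m, n)) (p : 'rV[R]_N) :=
  forall i j, cpseries_at (fun q => A q i j) p.

Lemma cpseries_ext (f g : 'rV[R]_N -> C) p : f =1 g -> cpseries_at f p -> cpseries_at g p.
Proof. by move=> /funext ->. Qed.

Lemma mx_analytic_mul (m n l : nat) (A : 'rV[R]_N -> 'M[C]_(m, n))
    (B : 'rV[R]_N -> 'M[C]_(n, l)) p :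
  mx_analytic A p -> mx_analytic B p -> mx_analytic (fun q => A q *m B q) p.
Proof.
move=> Ap Bp i j.
apply: (@cpseries_ext (fun q => \sum_k A q i k * B q k j)) => [q|].
  by rewrite mxE.
by apply: cpseries_sum => k _; exact: cpseriesM.
Qed.

Lemma mx_analytic_det (n : nat) (A : 'rV[R]_N -> 'M[C]_n) p :
  mx_analytic A p -> cpseries_at (fun q => \det (A q)) p.
Proof.
move=> Ap; apply: cpseries_sum => s _; apply: cpseriesM; first exact: cpseries_cst.
by apply: cpseries_prod => i _; exact: Ap.
Qed.

Lemma mx_analytic_inv (n : nat) (A : 'rV[R]_N -> 'M[C]_n) p :
  A p \in unitmx -> mx_analytic A p -> mx_analytic (fun q => invmx (A q)) p.
Proof.
move=> uA Ap i j.
have d0 : \det (A p) != 0 by rewrite -unitfE -unitmxE.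
have dp := mx_analytic_det Ap.
have adj : cpseries_at (fun q => (\adj (A q)) i j) p.
  apply: (@cpseries_ext (fun q => (-1) ^+ (j + i) * \det (row' j (col' i (A q))))) => [q|].
    by rewrite mxE.
  apply: cpseriesM; first exact: cpseries_cst.
  by apply: mx_analytic_det => k l; apply: cpseries_ext (Ap (lift j k) (lift i l)) => q; rewrite !mxE.
apply: cpseries_near_eq (cpseriesM (cpseriesV d0 dp) adj).
apply: filterS (cpseries_neq0 dp d0) => q dq.
by rewrite /invmx unitmxE unitfE dq [RHS]mxE.
Qed.

End MatrixFunctions.

Section Adapted.
Context {R : realType}.
Local Notation C := R[i].
Local Notation pt := 'rV[R]_5.
Implicit Types (phi : pt -> 'rV[R]_3) (p q : pt) (D : set pt).

Lemma graph_map_analytic phi p j : vanalytic_at phi p ->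
  cpseries_at (fun q => graph_map phi q 0 j) p.
Proof.
move=> php; have cplx (f g : pt -> R) : cpseries_at (fun q => (f q)%:C) p ->
    cpseries_at (fun q => (g q)%:C) p -> cpseries_at (fun q => f q +i* g q) p.
  move=> fp gp; apply: cpseries_ext (cpseriesD fp (cpseriesM (cpseries_cst 'i p) gp)) => q.
  by rewrite [RHS]complexE.
have co i : cpseries_at (fun q : pt => (q 0 i)%:C) p by exact: cpseries_coord.
rewrite /graph_map; case: (@split_ordP 1 3 j) => k ->.
  apply: cpseries_ext (cplx _ _ (co 0) (co 1)) => q.
  by rewrite (@row_mxEl _ 1 1 3) mxE.
apply: cpseries_ext (cplx _ _ (co (coord_u k)) (analytic_cpseries (php k))) => q.
by rewrite (@row_mxEr _ 1 1 3) mxE.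
Qed.

Lemma graph_diff_analytic phi p : vanalytic_at phi p -> mx_analytic (graph_diff phi) p.
Proof.
move=> php i j; apply: (@cpseries_ext _ _ (cpartial i (fun q => graph_map phi q 0 j))) => [q|].
  by rewrite mxE.
by apply: cpseries_cpartial; exact: graph_map_analytic.
Qed.

Lemma fieldLbar0 phi p : fieldLbar phi p 0 0 = 2^-1.
Proof. by rewrite /fieldLbar (@row_mx_val _ 2 3 _ _ _ 0) ?mxE. Qed.

(** Adding [X] to the generator gives another (0,1) vector with the same normalization, so the
    uniqueness in [fieldLbarP] forces [X = 0]. *)
Lemma T01_eq0 phi p X : cr_generic_at phi p -> T01 phi p (fieldLbar phi p) ->
  T01 phi p X -> X 0 0 = 0 -> X = 0.
Proof.
move=> gen TL TX X0; apply: (addIr (fieldLbar phi p)); rewrite add0r.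
apply: fieldLbarP => //; first by rewrite /T01 /= mulmxDl TL TX addr0.
by rewrite mxE X0 add0r fieldLbar0.
Qed.

Lemma T01_line phi p X : cr_generic_at phi p -> T01 phi p (fieldLbar phi p) ->
  T01 phi p X -> X = (2 * X 0 0) *: fieldLbar phi p.
Proof.
move=> gen TL TX; apply/eqP; rewrite -subr_eq0; apply/eqP.
apply: (T01_eq0 gen TL); first by rewrite /T01 /= mulmxBl -scalemxAl TL TX scaler0 subr0.
by rewrite mxE [X in _ + X]mxE [X in - X]mxE fieldLbar0 mulrAC divff ?mul1r ?subrr// pnatr_eq0.
Qed.

Lemma mulmx0_unit (n : nat) (A : 'M[C]_n) :
  (forall v : 'rV[C]_n, v *m A = 0 -> v = 0) -> A \in unitmx.
Proof.
move=> h; rewrite -row_free_unit -kermx_eq0; apply/eqP/row_matrixP => i.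
by rewrite row0; apply: h; rewrite -row_mul mulmx_ker row0.
Qed.

(** A row killed by this block, padded with zeros, is a (0,1) vector without z-component, hence
    zero. The invertibility makes the formula of [fieldLbar] analytic. *)
Lemma drsubmx_unit phi p : cr_generic_at phi p -> T01 phi p (fieldLbar phi p) ->
  drsubmx (graph_diff phi p : 'M[C]_(2 + 3, 1 + 3)) \in unitmx.
Proof.
move=> gen TL; apply: mulmx0_unit => v vG.
pose X : 'rV[C]_(2 + 3) := row_mx 0 v.
have X0 : X 0 0 = 0 by rewrite /X (@row_mx_val _ 2 3 _ _ _ 0) ?mxE.
have X1 : X 0 1 = 0 by rewrite /X (@row_mx_val _ 2 3 _ _ _ 1) ?mxE.
have XG : T01 phi p X.
  pose G : 'M[C]_(2 + 3, 1 + 3) := graph_diff phi p.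
  rewrite /T01 /= -[LHS]/(X *m G) -[LHS](@hsubmxK _ 1 1 3).
  have -> : rsubmx (X *m G) = 0.
    by rewrite -(submxK G) mul_row_block row_mxKr mul0mx add0r.
  have -> : lsubmx (X *m G) = 0.
    apply/rowP => k; rewrite !mxE ord1.
    have := graph_diff_col0 phi p X; rewrite X0 X1 mulr0 addr0 mxE => e.
    rewrite (_ : lshift 3 0 = 0); last exact: val_inj.
    exact: e.
  by apply/rowP => k; rewrite !mxE; case: splitP => ? _; rewrite mxE.
rewrite -(row_mxKr (0 : 'rV[C]_2) v) -/X (T01_eq0 gen TL XG X0).
by apply/rowP => k; rewrite !mxE.
Qed.

Lemma fieldLbar_analytic phi p : vanalytic_at phi p -> cr_generic_at phi p ->
  T01 phi p (fieldLbar phi p) -> field_analytic (fieldLbar phi) p.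
Proof.
move=> php gen TL k; have Gp := graph_diff_analytic php.
rewrite /fieldLbar; set d := (\row_k0 _).
have dp : mx_analytic (fun _ : pt => - d) p by move=> i j; exact: cpseries_cst.
have urp : mx_analytic (fun q => ursubmx (graph_diff phi q : 'M[C]_(2 + 3, 1 + 3))) p.
  by move=> i j; apply: cpseries_ext (Gp (lshift 3 i) (rshift 1 j)) => q; rewrite !mxE.
have drp : mx_analytic (fun q => drsubmx (graph_diff phi q : 'M[C]_(2 + 3, 1 + 3))) p.
  by move=> i j; apply: cpseries_ext (Gp (rshift 2 i) (rshift 1 j)) => q; rewrite !mxE.
have := mx_analytic_mul (mx_analytic_mul dp urp) (mx_analytic_inv (drsubmx_unit gen TL) drp).
case: (@split_ordP 2 3 k) => l -> h.
  apply: cpseries_ext (cpseries_cst (d 0 l) p) => q.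
  by rewrite (@row_mxEl _ 1 2 3).
apply: cpseries_ext (h 0 l) => q.
by rewrite (@row_mxEr _ 1 2 3) mulNmx.
Qed.

Lemma conj_fieldL phi : conj_field (fieldL phi) = fieldLbar phi.
Proof. exact: conj_fieldK. Qed.

Lemma frame_of_fieldL phi : frame_of (fieldL phi) = frame_mx phi.
Proof.
by apply/funext => p; rewrite /frame_of /fieldSbar_of /fieldS_of /fieldT_of conj_fieldL.
Qed.

Lemma fundR_of_fieldL phi : fundR_of (fieldL phi) = fundR phi.
Proof.
apply/funext => p; rewrite /fundR_of frame_of_fieldL.
by rewrite /fieldS_of /fieldT_of conj_fieldL.
Qed.

Lemma frame_of_near_eq (E E' : pt -> 'rV[C]_5) p :
  (\forall q \near p, E q = E' q) -> frame_of E p = frame_of E' p.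
Proof.
move=> EE'.
have cE : \forall q \near p, conj_field E q = conj_field E' q.
  by apply: filterS EE' => q e; rewrite /conj_field e.
have TT' : \forall q \near p, fieldT_of E q = fieldT_of E' q.
  by apply: filterS2 (near_near EE') (near_near cE) => q e ce; congr (_ *: _); exact: bracket_near_eq.
apply/row_matrixP => i; rewrite !rowK.
case: i => -[|[|[|[|[|//]]]]] ? /=.
- exact: bracket_near_eq.
- exact: bracket_near_eq.
- exact: near_at TT'.
- exact: near_at cE.
- exact: near_at EE'.
Qed.

Lemma frame_of_analytic (E : pt -> 'rV[C]_5) p : field_analytic E p ->
  mx_analytic (frame_of E) p.
Proof.
move=> Ep i j; apply: (@cpseries_ext _ _ (fun q =>
  [:: fieldSbar_of E q; fieldS_of E q; fieldT_of E q; conj_field E q; E q]`_i 0 j)) => [q|].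
  by rewrite mxE.
case: i => -[|[|[|[|[|//]]]]] ? /=.
- exact: field_analytic_Sbar.
- exact: field_analytic_S.
- exact: field_analytic_T.
- exact: field_analytic_conj.
- exact: Ep.
Qed.

Lemma fundR_of_analytic (E : pt -> 'rV[C]_5) p : field_analytic E p ->
  frame_of E p \in unitmx -> cpseries_at (fundR_of E) p.
Proof.
move=> Ep uE.
have Bp : mx_analytic (bracket E (fieldS_of E)) p.
  move=> i j; rewrite (ord1 i); apply: field_analytic_bracket => //.
  exact: field_analytic_S.
exact: (mx_analytic_mul Bp (mx_analytic_inv uE (frame_of_analytic Ep)) 0 0).
Qed.

(** The permutation of the frame under conjugation: Sbar and S are exchanged, Ebar and E as well,
    and the real field T is fixed. *)
Definition conj_index (i : 'I_5) : 'I_5 := nth 0 [:: 1; 0; 2; 4; 3] i.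

Lemma conj_indexK : involutive conj_index.
Proof.
by case=> -[|[|[|[|[|//]]]]] ?; apply: val_inj.
Qed.

Lemma conj_frame_row (E : pt -> 'rV[C]_5) p i : field_analytic E p ->
  conj_mx (row i (frame_of E p)) = row (conj_index i) (frame_of E p).
Proof.
move=> Ep; rewrite !rowK; case: i => -[|[|[|[|[|//]]]]] ? /=.
- by rewrite fieldSbar_conj// conj_mxK.
- by rewrite fieldSbar_conj.
- exact: fieldT_real.
- by rewrite conj_mxK.
- by [].
Qed.

(** The dual coframe inherits the conjugation symmetry of the frame; both columns are compared
    through their pairings with the frame. *)
Lemma conj_coframe_col (E : pt -> 'rV[C]_5) p i : field_analytic E p ->
  frame_of E p \in unitmx ->
  conj_mx (col i (invmx (frame_of E p))) = col (conj_index i) (invmx (frame_of E p)).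
Proof.
move=> Ep uE; set F := frame_of E p; set W := invmx F.
have FW j : F *m col j W = col j 1%:M by rewrite !colE mulmxA mulmxV.
apply: (can_inj (mulKmx uE)); rewrite FW; apply/colP => k; rewrite mxE.
have cF l : F k l = conjc (F (conj_index k) l).
  have := congr1 (fun v : 'rV_5 => v 0 l) (conj_frame_row (conj_index k) Ep).
  by rewrite conj_indexK !mxE => <-; rewrite -/F; congr conjc.
transitivity (conjc ((F *m col i W) (conj_index k) 0)).
  rewrite [in RHS]mxE rmorph_sum; apply: eq_bigr => l _.
  by rewrite rmorphM; congr (_ * _); [exact: cF|rewrite mxE].
rewrite FW !mxE (_ : (k == conj_index i) = (conj_index k == i)).
  by rewrite conjc_nat.
by apply/eqP/eqP => [->|<-]; rewrite conj_indexK.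
Qed.

Definition adapted_field phi (A0 : pt -> C) q := (A0 q)^-1 *: fieldL phi q.

(** The columns of the inverse frame matrix are the dual 1-forms. Columns 1, 2 and 4 are dual to S,
    T and E; the remaining two are conjugates of columns 1 and 4. *)
Definition adapted_coframe phi A0 : coframe R :=
  let W q := invmx (frame_of (adapted_field phi A0) q) in
  Coframe (fun q => col 1 (W q)) (fun q => col 2 (W q)) (fun q => col 4 (W q)).

Lemma adapted_sigma phi A0 p : sigma (adapted_coframe phi A0) p =
  col 1 (invmx (frame_of (adapted_field phi A0) p)).
Proof. by []. Qed.
Lemma adapted_rho phi A0 p : rho (adapted_coframe phi A0) p =
  col 2 (invmx (frame_of (adapted_field phi A0) p)).
Proof. by []. Qed.
Lemma adapted_zeta phi A0 p : zeta (adapted_coframe phi A0) p =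
  col 4 (invmx (frame_of (adapted_field phi A0) p)).
Proof. by []. Qed.

Lemma adapted_coframe_mx phi A0 p : field_analytic (adapted_field phi A0) p ->
  frame_of (adapted_field phi A0) p \in unitmx ->
  coframe_mx (adapted_coframe phi A0) p = invmx (frame_of (adapted_field phi A0) p).
Proof.
move=> Ep uE; apply/matrixP => i j; rewrite mxE adapted_sigma adapted_rho adapted_zeta.
rewrite !(conj_coframe_col _ Ep uE).
by case: j => -[|[|[|[|[|//]]]]] ? /=; rewrite mxE; congr (invmx _ i _); exact: val_inj.
Qed.

Lemma adapted_coframe_local phi1 phi2 (A1 A2 : pt -> C) (V : set pt) p :
  open V -> (forall p, V p -> phi1 p = phi2 p /\ A1 p = A2 p) -> V p ->
  coframe_eq_at (adapted_coframe phi1 A1) (adapted_coframe phi2 A2) p.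
Proof.
move=> oV h; move: p.
have nV p : V p -> \forall q \near p, V q by move=> Vp; exact: open_nbhs_nbhs.
have G p : V p -> graph_diff phi1 p = graph_diff phi2 p.
  move=> Vp; apply/matrixP => i j; rewrite !mxE; apply: cpartial_near_eq.
  by apply: filterS (nV _ Vp) => q /h[e _]; rewrite /graph_map e.
have L p : V p -> adapted_field phi1 A1 p = adapted_field phi2 A2 p.
  move=> Vp; rewrite /adapted_field /fieldL /conj_field /fieldLbar G//.
  by have [_ ->] := h p Vp.
move=> p Vp; have F : frame_of (adapted_field phi1 A1) p = frame_of (adapted_field phi2 A2) p.
  by apply: frame_of_near_eq; apply: filterS (nV _ Vp).
have S k := congr1 (fun M => col k (invmx M)) F.
by split; [exact: (S 1)|exact: (S 2)|exact: (S 4)].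
Qed.

(** Either side forces [|z| = |r|]: the first by multiplying with its conjugate, the second by
    taking moduli. Then [z^3 = r z conj z = r |r|^2]. The cubic form is holomorphic in [z], so
    analytic roots exist and can be counted. *)
Lemma cube_choice (z r : C) : r != 0 -> (z ^+ 2 / conjc z = r) <-> z ^+ 3 = r ^+ 2 * conjc r.
Proof.
move=> r0; have r0' : conjc r != 0 by rewrite conjc_eq0.
split=> h.
  have z0 : z != 0 by apply: contraNneq r0 => z0; rewrite -h z0 expr2 mul0r mul0r.
  have z0' : conjc z != 0 by rewrite conjc_eq0.
  have zE : z ^+ 2 = r * conjc z by rewrite -h divfK.
  have zE' : (conjc z) ^+ 2 = conjc r * z.
    by have := congr1 conjc zE; rewrite rmorphXn rmorphM /= conjcK.
  have n : (z * conjc z) * (z * conjc z) = (r * conjc r) * (z * conjc z).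
    rewrite (_ : _ * _ = z ^+ 2 * (conjc z) ^+ 2); last by ring.
    by rewrite zE zE'; ring.
  have {}n := mulIf (mulf_neq0 z0 z0') n.
  by rewrite exprS zE (_ : _ * _ = r * (z * conjc z)); [rewrite n|]; ring.
have z0 : z != 0.
  apply/eqP => z0; move: h; rewrite z0 expr0n /= => /esym/eqP.
  by rewrite mulf_eq0 expf_eq0 /= (negPf r0) (negPf r0').
have z0' : conjc z != 0 by rewrite conjc_eq0.
have n : cabs z = cabs r.
  have := congr1 cabs h; rewrite cabsX cabsM cabsX cabs_conj -exprSr.
  by move/eqP; rewrite eqrXn2 ?cabs_ge0// => /eqP.
have nz w : w * conjc w = ((cabs w) ^+ 2)%:C by rewrite rmorphXn /= cabsE sqr_normc.
apply: (mulIf z0'); rewrite divfK//; apply: (mulIf z0).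
by rewrite -exprSr h -mulrA [conjc z * z]mulrC nz n -nz; ring.
Qed.

Section OnClass.
Variables (D : set pt) (phi : pt -> 'rV[R]_3).
Hypothesis cls : class_III1 D phi.

Lemma class_near p : D p -> \forall q \near p, D q.
Proof. by case: cls => -[oD _] _ _ _ _ Dp; exact: open_nbhs_nbhs. Qed.

Lemma fieldL_analytic p : D p -> field_analytic (fieldL phi) p.
Proof.
case: cls => _ ph _ gen _ Dp; have [g t] := gen p Dp.
by apply: field_analytic_conj; apply: fieldLbar_analytic => //; exact: ph.
Qed.

Lemma frame_fieldL_unit p : D p -> frame_of (fieldL phi) p \in unitmx.
Proof. by rewrite frame_of_fieldL; case: cls => _ _ _ _; apply. Qed.

Lemma fundR_analytic p : D p -> cpseries_at (fundR phi) p.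
Proof.
move=> Dp; rewrite -fundR_of_fieldL; apply: fundR_of_analytic.
  exact: fieldL_analytic.
exact: frame_fieldL_unit.
Qed.

Lemma locus_near p : locus_R_neq0 D phi p -> \forall q \near p, locus_R_neq0 D phi q.
Proof.
move=> [Dp r0]; have := cpseries_neq0 (fundR_analytic Dp) r0.
by apply: filterS2 (class_near Dp) => q; split.
Qed.

Lemma choice_A0P p (A0 : pt -> C) : locus_R_neq0 D phi p ->
  (A0 p ^+ 2 / Num.conj (A0 p) = fundR phi p) <->
  A0 p ^+ 3 = fundR phi p ^+ 2 * conjc (fundR phi p).
Proof. by move=> [_ r0]; rewrite numconjE; exact: cube_choice. Qed.

Lemma choice_neq0 p (A0 : pt -> C) : locus_R_neq0 D phi p ->
  A0 p ^+ 2 / Num.conj (A0 p) = fundR phi p -> A0 p != 0.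
Proof.
by move=> [_ r0] e; apply: contraNneq r0 => z0; rewrite -e z0 expr2 mul0r mul0r.
Qed.

Lemma adapted_analytic p (A0 : pt -> C) : locus_R_neq0 D phi p ->
  cpseries_at A0 p -> A0 p != 0 ->
  [/\ field_analytic (adapted_field phi A0) p,
      frame_of (adapted_field phi A0) p \in unitmx &
      (fundR_of (adapted_field phi A0) p = 1 <->
       A0 p ^+ 2 / Num.conj (A0 p) = fundR phi p)].
Proof.
move=> lp Ap z0; have [Dp r0] := lp; have Lp := fieldL_analytic Dp.
have Vp := cpseriesV z0 Ap.
have V0 : (A0 p)^-1 != 0 by rewrite invr_eq0.
have [uE RE] := rescale_frame Vp Lp V0 (frame_fieldL_unit Dp).
split=> //; first exact: field_analyticZ.
have c0 : conjc (A0 p) != 0 by rewrite conjc_eq0.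
have {}RE : fundR_of (adapted_field phi A0) p =
    fundR phi p * (conjc (A0 p) / A0 p ^+ 2).
  by rewrite RE fundR_of_fieldL conjc_inv; field; rewrite z0 c0.
rewrite RE numconjE; split=> [e|<-]; last by field; rewrite z0 c0.
by rewrite -[LHS]mul1r -e; field; rewrite z0 c0.
Qed.

Lemma adapted_parallelism V (A0 : pt -> C) : open V -> V `<=` locus_R_neq0 D phi ->
  choice_A0 phi V A0 -> parallelism_on V (adapted_coframe phi A0).
Proof.
move=> oV VD chA.
have key q : V q -> field_analytic (adapted_field phi A0) q /\
    frame_of (adapted_field phi A0) q \in unitmx.
  move=> Vq; have [/canalytic_atP Aq Rq] := chA q Vq.
  by have [] := adapted_analytic (VD q Vq) Aq (choice_neq0 (VD q Vq) Rq).
move=> p Vp; have [Ep uE] := key p Vp; split.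
- move=> i j; apply/canalytic_atP.
  apply: cpseries_near_eq (mx_analytic_inv uE (frame_of_analytic Ep) i j).
  have : \forall q \near p, V q by exact: open_nbhs_nbhs.
  by apply: filterS => q Vq; have [Eq uEq] := key q Vq; rewrite adapted_coframe_mx.
- by rewrite adapted_rho conj_coframe_col.
- by rewrite adapted_coframe_mx// unitmx_inv.
Qed.

(** An analytic cube root [A] of [R^2 conj R] and its multiples by the cube roots of unity are the
    choices. Exhaustiveness is a statement on germs: which multiple occurs is decided at [p] and
    persists nearby by continuity. *)
Lemma choice_exists p : locus_R_neq0 D phi p ->
  exists (V : set pt) (k : nat) (A : 'I_k.+1 -> pt -> C),
    [/\ open V, V p, V `<=` locus_R_neq0 D phi,
        forall j, choice_A0 phi V (A j) &
        forall (W : set pt) (A0 : pt -> C),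
          open W -> W p -> choice_A0 phi W A0 ->
          exists j, \forall q \near p, A0 q = A j q].
Proof.
move=> lp; have [Dp r0] := lp.
have Rp := fundR_analytic Dp.
have Rcp := cpseries_conj Rp.
pose g q := fundR phi q ^+ 2 * conjc (fundR phi q).
have gp : cpseries_at g p by apply: cpseriesM => //; exact: cpseriesX.
have g0 : g p != 0 by rewrite mulf_neq0 ?expf_neq0 ?conjc_eq0.
have [A Ap A3] := cpseries_cbrt g0 (rootCK (isT : (0 < 3)%N) (g p)) gp.
(* A primitive cube root of unity; only [w ^+ 2 = - 1 - w], [w ^+ 3 = 1], [w != 1] and [w != 0] are
   kept. *)
pose s : C := sqrtc (-3); pose w : C := (s - 1) / 2.
have s2 : s ^+ 2 = -3 by exact: sqr_sqrtc.
have w1 : w ^+ 2 = - 1 - w.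
  rewrite /w expr_div_n sqrrB s2.
  by field.
have w3 : w ^+ 3 = 1 by rewrite exprS w1 mulrBr mulrN mulr1 -expr2 w1; ring.
have s0 : s != 0 by rewrite sqrtc_eq0 oppr_eq0 pnatr_eq0.
have wn1 : w - 1 != 0.
  apply/eqP => e; have : s ^+ 2 = 9.
    have -> : s = 2 * (w - 1) + 3 by rewrite /w; field.
    by rewrite e; ring.
  rewrite s2 => /eqP; rewrite eq_sym -subr_eq0 opprK -natrD.
  by rewrite pnatr_eq0.
have w0 : w != 0 by apply/eqP => e; move: w3; rewrite e expr0n => /esym/eqP; rewrite oner_eq0.
clearbody w.
have nP : \forall q \near p, (A q ^+ 3 = g q /\ locus_R_neq0 D phi q) /\ cpseries_at A q.
  by apply: filterI (filterI A3 (locus_near lp)) (cpseries_near Ap).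
have : nbhs p [set q | (A q ^+ 3 = g q /\ locus_R_neq0 D phi q) /\ cpseries_at A q] by exact: nP.
rewrite nbhsE => -[V [oV Vp] VP].
exists V, 2%N, (fun j q => w ^+ j * A q); split;
  [exact: oV|exact: Vp|move=> q Vq|move=> j q Vq|move=> W A0 oW Wp chA].
- by have [[]] := VP q Vq.
- have [[A3q lq] Aq] := VP q Vq; split.
    by apply/canalytic_atP; apply: cpseriesM => //; exact: cpseries_cst.
  apply/(choice_A0P (fun q => w ^+ j * A q) lq).
  by rewrite exprMn -exprM mulnC exprM w3 expr1n mul1r A3q.
have nW : \forall q \near p, W q by exact: open_nbhs_nbhs.
have [/canalytic_atP A0p _] := chA p Wp.
(* The product is [A0^3 - A^3], since [1 + w + w^2 = 0]. *)
have A0A : \forall q \near p, (A0 q - w ^+ 0 * A q) * ((A0 q - w ^+ 1 * A q) * (A0 q - w ^+ 2 * A q)) = 0.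
  apply: filterS3 A3 (locus_near lp) nW => q A3q lq /chA[_ /(choice_A0P A0 lq)].
  rewrite -/(g q) -A3q => e.
  rewrite expr0 mul1r expr1 (_ : _ * _ = A0 q ^+ 3 - w ^+ 3 * A q ^+ 3
     - (1 + w + w ^+ 2) * A0 q ^+ 2 * A q + w * (1 + w + w ^+ 2) * A0 q * A q ^+ 2); last by ring.
  by rewrite e w3 w1; ring.
have A0n : A p != 0.
  by apply: contraNneq g0 => A0'; rewrite -(near_at A3) A0' expr0n.
have fac j : cpseries_at (fun q => A0 q - w ^+ j * A q) p.
  by apply: cpseriesB => //; apply: cpseriesM => //; exact: cpseries_cst.
have nz i j : w ^+ i - w ^+ j != 0 -> A0 p - w ^+ i * A p = 0 ->
    \forall q \near p, A0 q - w ^+ j * A q != 0.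
  move=> ij e; apply: cpseries_neq0 (fac j) _.
  rewrite (_ : _ - _ = (A0 p - w ^+ i * A p) + (w ^+ i - w ^+ j) * A p); last by ring.
  by rewrite e add0r mulf_neq0.
have wd i j : (i < 3)%N -> (j < 3)%N -> i != j -> w ^+ i - w ^+ j != 0.
  have h01 : w ^+ 0 - w ^+ 1 != 0 by rewrite expr0 expr1 -oppr_eq0 opprB.
  have h12 : w ^+ 1 - w ^+ 2 != 0.
    by rewrite (_ : _ - _ = - (w * (w - 1))) ?oppr_eq0 ?mulf_neq0//; ring.
  have h02 : w ^+ 0 - w ^+ 2 != 0.
    rewrite (_ : _ - _ = w ^+ 2 * (w - 1)) ?mulf_neq0 ?expf_neq0//.
    by rewrite mulrBr mulr1 -exprSr w3 expr0.
  by case: i => [|[|[|//]]]; case: j => [|[|[|//]]] // _ _ _;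
    rewrite // -oppr_eq0 opprB.
(* If the factor [j] vanishes at [p], the other two do not, as [A p != 0]; they stay nonzero nearby,
   so the factor [j] vanishes nearby. *)
have pick (j : 'I_3) : A0 p - w ^+ j * A p = 0 -> \forall q \near p, A0 q = w ^+ j * A q.
  move=> e; have n i : (i < 3)%N -> j != i :> nat -> \forall q \near p, A0 q - w ^+ i * A q != 0.
    by move=> i3 ji; apply: nz e; exact: wd.
  case: j e n => -[|[|[|//]]] jp /= e n.
  - apply: filterS3 A0A (n 1%N isT isT) (n 2%N isT isT) => q /eqP + n1 n2.
    by rewrite mulf_eq0 (negPf (mulf_neq0 n1 n2)) orbF subr_eq0 => /eqP.
  - apply: filterS3 A0A (n 0%N isT isT) (n 2%N isT isT) => q /eqP + n1 n2.
    by rewrite mulf_eq0 (negPf n1) mulf_eq0 (negPf n2) orbF subr_eq0 => /eqP.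
  - apply: filterS3 A0A (n 0%N isT isT) (n 1%N isT isT) => q /eqP + n1 n2.
    by rewrite mulf_eq0 (negPf n1) mulf_eq0 (negPf n2) subr_eq0 => /eqP.
have /eqP := near_at A0A; rewrite !mulf_eq0 => /or3P[] /eqP e.
- by exists 0; exact: (pick 0).
- by exists 1; exact: (pick 1).
- by exists 2; exact: (pick 2).
Qed.

End OnClass.

End Adapted.

(** * The intrinsic equivalence problem *)

Section Diffeo.
Context {R : realType}.
Local Notation C := R[i].
Local Notation pt := 'rV[R]_5.

Lemma cjacobian_unit (h g : pt -> pt) p : vanalytic_at h p -> vanalytic_at g (h p) ->
  (\forall q \near p, g (h q) = q) -> cjacobian h p \in unitmx.
Proof.
move=> hp gp gh.
have [_ Jh] := vanalytic_differentiable hp; have [_ Jg] := vanalytic_differentiable gp.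
suff e : cjacobian h p *m cjacobian g (h p) = 1%:M.
  by have [u _] := mulmx1_unit e; exact: u.
apply/matrixP => i l; rewrite !mxE.
have hc j : cpseries_at (fun q => (h q 0 j)%:C) p by exact: analytic_cpseries.
have gc : cpseries_at (fun q => (g q 0 l)%:C) (h p) by exact: analytic_cpseries.
have := cpartial_comp i gc hc.
rewrite (@cpartial_near_eq _ i _ (fun q => (q 0 l)%:C)); last first.
  by apply: filterS gh => q ->.
rewrite (rderiv_cpartial5 i (rderiv_coord l p)) => ->.
by apply: eq_bigr => j _; exact: (congr2 *%R (Jh i j) (Jg j l)).
Qed.

Lemma cjacobian_analytic (h : pt -> pt) p : vanalytic_at h p -> mx_analytic (cjacobian h) p.
Proof.
move=> hp i j; have hj : cpseries_at (fun q => (h q 0 j)%:C) p by exact: analytic_cpseries.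
apply: cpseries_near_eq (cpseries_cpartial i hj).
apply: filterS (near_vanalytic hp) => q hq.
by have [_ ->] := vanalytic_differentiable hq.
Qed.

Lemma conj_cjacobian (h : pt -> pt) p : conj_mx (cjacobian h p) = cjacobian h p.
Proof. by apply/matrixP => i j; rewrite !mxE; exact: conjc_real. Qed.

Lemma conj_mx_mul (m n l : nat) (A : 'M[C]_(m, n)) (B : 'M[C]_(n, l)) :
  conj_mx (A *m B) = conj_mx A *m conj_mx B.
Proof. exact: map_mxM. Qed.

Lemma push_coframe (J F F' : 'M[C]_5) : conj_mx J = J -> F \in unitmx -> F' \in unitmx ->
  (forall i, conj_mx (col i (invmx F)) = col (conj_index i) (invmx F)) ->
  (forall i, conj_mx (col i (invmx F')) = col (conj_index i) (invmx F')) ->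
  [/\ J *m col 1 (invmx F') = col 1 (invmx F), J *m col 2 (invmx F') = col 2 (invmx F) &
      J *m col 4 (invmx F') = col 4 (invmx F)] <-> F *m J = F'.
Proof.
move=> Jr uF uF' cF cF'.
split=> [[e1 e2 e4]|FJ].
  have cj i : J *m col i (invmx F') = col i (invmx F) ->
      J *m col (conj_index i) (invmx F') = col (conj_index i) (invmx F).
    by move=> e; rewrite -cF -e conj_mx_mul Jr cF'.
  have JF : J *m invmx F' = invmx F.
    have e0 := cj 1 e1; have e3 := cj 4 e4; apply/matrixP => i j.
    suff : col j (J *m invmx F') = col j (invmx F) by move/colP/(_ i); rewrite !mxE.
    rewrite colE -mulmxA -colE.
    case: j => -[|[|[|[|[|//]]]]] jp.
    - by rewrite (_ : Ordinal jp = conj_index 1)//; exact: val_inj.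
    - by rewrite (_ : Ordinal jp = 1)//; exact: val_inj.
    - by rewrite (_ : Ordinal jp = 2)//; exact: val_inj.
    - by rewrite (_ : Ordinal jp = conj_index 4)//; exact: val_inj.
    - by rewrite (_ : Ordinal jp = 4)//; exact: val_inj.
  by rewrite -[F'](mulKVmx uF) -JF -!mulmxA mulVmx// mulmx1.
have JF : J *m invmx F' = invmx F.
  by apply: (can_inj (mulKmx uF)); rewrite mulmxA FJ !mulmxV.
by rewrite !colE !mulmxA JF.
Qed.

End Diffeo.

Section Intrinsic.
Context {R : realType}.
Local Notation C := R[i].
Local Notation pt := 'rV[R]_5.
Variables (D D' : set pt) (phi phi' : pt -> 'rV[R]_3) (V V' : set pt) (h : pt -> pt).
Hypotheses (cls : class_III1 D phi) (cls' : class_III1 D' phi')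
  (VD : V `<=` locus_R_neq0 D phi) (VD' : V' `<=` locus_R_neq0 D' phi')
  (hV : analytic_diffeo V V' h).

Lemma diffeo_image p : V p -> V' (h p).
Proof. by case: hV => _ _ <- _ _ Vp; exists p. Qed.

Lemma diffeo_near p : V p -> \forall q \near p, V q.
Proof. by case: hV => oV _ _ _ _ Vp; exact: open_nbhs_nbhs. Qed.

Lemma diffeo_analytic p : V p -> vanalytic_at h p.
Proof. by case: hV => _ _ _ hp _; exact: hp. Qed.

Lemma diffeo_unit p : V p -> cjacobian h p \in unitmx.
Proof.
move=> Vp; have nV := diffeo_near Vp.
case: hV => _ _ _ hp [g [gp gh _]]; apply: (@cjacobian_unit _ h g); first exact: hp.
  exact: gp (diffeo_image Vp).
by apply: filterS nV => q /gh.
Qed.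

Lemma source_generic p : V p -> cr_generic_at phi p /\ T01 phi p (fieldLbar phi p).
Proof. by move=> /VD[Dp _]; case: cls => _ _ _ + _; apply. Qed.

Lemma target_generic p : V p ->
  cr_generic_at phi' (h p) /\ T01 phi' (h p) (fieldLbar phi' (h p)).
Proof. by move=> /diffeo_image/VD'[Dp _]; case: cls' => _ _ _ + _; apply. Qed.

(** The (0,1) spaces are lines on both sides, so the image of the generator decides the matter;
    invertibility of the Jacobian gives the reverse implication. *)
Lemma T01_transport p (c : C) : V p -> c != 0 ->
  fieldLbar phi p *m cjacobian h p = c *: fieldLbar phi' (h p) ->
  forall X : 'rV[C]_5, T01 phi p X <-> T01 phi' (h p) (X *m cjacobian h p).
Proof.
move=> Vp c0 LJ X; have [gen TL] := source_generic Vp.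
have [gen' TL'] := target_generic Vp; split=> [TX|TX].
  rewrite (T01_line gen TL TX) -scalemxAl LJ scalerA /T01 /= -scalemxAl.
  by rewrite (TL' : _ *m _ = 0) scaler0.
have := T01_line gen' TL' TX; set t := 2 * _ => e.
have -> : X = (t / c) *: fieldLbar phi p.
  apply: (can_inj (mulmxK (diffeo_unit Vp))).
  by rewrite e -scalemxAl LJ scalerA divfK.
by rewrite /T01 /= -scalemxAl (TL : _ *m _ = 0) scaler0.
Qed.

Lemma carries_frame (A0 A0' : pt -> C) p :
  field_analytic (adapted_field phi A0) p ->
  frame_of (adapted_field phi A0) p \in unitmx ->
  field_analytic (adapted_field phi' A0') (h p) ->
  frame_of (adapted_field phi' A0') (h p) \in unitmx ->
  carries_at h (adapted_coframe phi A0) (adapted_coframe phi' A0') p <->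
  frame_of (adapted_field phi A0) p *m cjacobian h p =
  frame_of (adapted_field phi' A0') (h p).
Proof.
move=> Ep uE Ep' uE'.
exact: (push_coframe (conj_cjacobian h p) uE uE' (fun i => conj_coframe_col i Ep uE)
  (fun i => conj_coframe_col i Ep' uE')).
Qed.

Lemma carried_cr_map :
  (forall p, V p -> exists (W : set pt) (A0 A0' : pt -> C),
    [/\ open W /\ W p, W `<=` V, choice_A0 phi W A0, choice_A0 phi' (h @` W) A0' &
      forall q, W q -> carries_at h (adapted_coframe phi A0) (adapted_coframe phi' A0') q]) ->
  cr_map_on phi phi' V h.
Proof.
move=> car p Vp; have [W [A0 [A0' [[oW Wp] WV chA chA' /(_ p Wp) cp]]]] := car p Vp.
have lp := VD Vp; have lp' := VD' (diffeo_image Vp).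
have [/canalytic_atP Ap Rp] := chA p Wp.
have [/canalytic_atP Ap' Rp'] : canalytic_at A0' (h p) /\
  A0' (h p) ^+ 2 / Num.conj (A0' (h p)) = fundR phi' (h p) by apply: chA'; exists p.
have a0 := choice_neq0 lp Rp; have a0' := choice_neq0 lp' Rp'.
have [Ep uE _] := adapted_analytic cls lp Ap a0.
have [Ep' uE' _] := adapted_analytic cls' lp' Ap' a0'.
have FJ : frame_of (adapted_field phi A0) p *m cjacobian h p =
  frame_of (adapted_field phi' A0') (h p) by apply/carries_frame.
have : adapted_field phi A0 p *m cjacobian h p = adapted_field phi' A0' (h p).
  have r4J := congr1 (row 4) FJ; rewrite row_mul in r4J.
  have r4 (E : pt -> 'rV[C]_5) q : row 4 (frame_of E q) = E q by rewrite rowK.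
  have lhs := congr1 (mulmxr (cjacobian h p)) (r4 (adapted_field phi A0) p).
  exact: (etrans (esym lhs) (etrans r4J (r4 (adapted_field phi' A0') (h p)))).
(* The last row of the frames relates multiples of [L]; conjugation by the real Jacobian turns this
   into a relation between multiples of [Lbar]. *)
have cJ (X Y : 'rV[C]_5) (u v : C) (J : 'M[C]_5) : conj_mx J = J ->
    (u *: conj_mx X) *m J = v *: conj_mx Y -> conjc u *: (X *m J) = conjc v *: Y.
  move=> Jr /(congr1 (@conj_mx R 1 5)).
  by rewrite conj_mx_mul Jr !conj_mxZ !conj_mxK !numconjE -scalemxAl.
move=> /(cJ (fieldLbar phi p) (fieldLbar phi' (h p)) _ _ _ (conj_cjacobian h p)).
have c0 : conjc (A0 p)^-1 != 0 by rewrite conjc_eq0 invr_eq0.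
have c0' : conjc (A0' (h p))^-1 != 0 by rewrite conjc_eq0 invr_eq0.
move=> e; apply: (@T01_transport p ((conjc (A0 p)^-1)^-1 * conjc (A0' (h p))^-1)) => //.
  by rewrite mulf_neq0// invr_eq0.
by rewrite -scalerA -e scalerA mulVf// scale1r.
Qed.

(** A choice [a] on the source determines the one on the target: it is the function [a'] for which
    [h] relates [L / a] to [L' / a']. Related fields have corresponding coframes. *)
Lemma cr_map_carried : cr_map_on phi phi' V h ->
  forall p, V p -> exists (W : set pt) (A0 A0' : pt -> C),
    [/\ open W /\ W p, W `<=` V, choice_A0 phi W A0, choice_A0 phi' (h @` W) A0' &
      forall q, W q -> carries_at h (adapted_coframe phi A0) (adapted_coframe phi' A0') q].
Proof.
move=> cr p Vp; have [W0 [k [A [oW0 W0p W0D chA _]]]] := choice_exists cls (VD Vp).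
pose a := A ord0; have {}chA := chA ord0; rewrite -/a in chA.
pose W := W0 `&` V; have oV : open V by case: hV.
have oW : open W by exact: openI.
have WV : W `<=` V by move=> q [].
pose c q : C := 2 * (fieldLbar phi q *m cjacobian h q) 0 0.
have LbE q : V q -> fieldLbar phi q *m cjacobian h q = c q *: fieldLbar phi' (h q).
  move=> Vq; have [gen' TL'] := target_generic Vq; have [_ TL] := source_generic Vq.
  by apply: (T01_line gen' TL'); apply/(cr q Vq).
have c0 q : V q -> c q != 0.
  move=> Vq; apply/eqP => c0; have := LbE q Vq; rewrite c0 scale0r => /(congr1 (mulmxr (invmx (cjacobian h q)))).
  rewrite /= mulmxK ?diffeo_unit// mul0mx => /(congr1 (fun v : 'rV_5 => v 0 0)).
  by rewrite fieldLbar0 mxE => /eqP; rewrite invr_eq0 pnatr_eq0.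
have LE q : V q -> fieldL phi q *m cjacobian h q = conjc (c q) *: fieldL phi' (h q).
  move=> Vq; rewrite -conj_cjacobian -[fieldL phi q]/(conj_mx (fieldLbar phi q)).
  by rewrite -conj_mx_mul LbE// conj_mxZ.
have cp q : V q -> cpseries_at c q.
  move=> Vq; have [gen TL] := source_generic Vq.
  have php : vanalytic_at phi q by case: cls => _ + _ _ _; apply; have [] := VD Vq.
  have Lq : mx_analytic (fieldLbar phi) q.
    by move=> i j; rewrite (ord1 i); exact: fieldLbar_analytic.
  have Jq := cjacobian_analytic (diffeo_analytic Vq).
  by apply: cpseriesM; [exact: cpseries_cst|exact: (mx_analytic_mul Lq Jq 0 0)].
clearbody c.
have [g [gp gh hg]] : exists g : pt -> pt, [/\ forall q, V' q -> vanalytic_at g q,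
    forall p, V p -> g (h p) = p & forall q, V' q -> h (g q) = q] by case: hV.
(* As [h] sends [L] to [conj c] times [L'], it sends [L / a] to [L' / a'] with [a' = a / conj c],
   carried to the target by the inverse [g]. *)
pose b q := a q * (conjc (c q))^-1; pose a' q := b (g q).
have aW q : W q -> [/\ cpseries_at a q, a q != 0 & a q ^+ 2 / Num.conj (a q) = fundR phi q].
  move=> [W0q Vq]; have [/canalytic_atP aq Rq] := chA q W0q.
  by split=> //; exact: choice_neq0 (VD Vq) Rq.
have a'W q : W q -> [/\ cpseries_at a' (h q) & a' (h q) = a q / conjc (c q)].
  move=> Wq; have Vq := WV _ Wq; have [aq _ _] := aW q Wq; have gq := gh q Vq.
  split; last by rewrite /a' gq.
  apply: cpseries_comp_real; last first.
    by move=> j; apply: analytic_cpseries; exact: (gp _ (diffeo_image Vq)).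
  rewrite gq; apply: cpseriesM => //; apply: cpseriesV; first by rewrite conjc_eq0 c0.
  by apply: cpseries_conj; exact: cp.
have rel q : W q -> related h (adapted_field phi a) (adapted_field phi' a') q.
  move=> Wq; have Vq := WV _ Wq; have [_ a0 _] := aW q Wq; have [_ a'E] := a'W q Wq.
  have K (X Y : 'rV[C]_5) (J : 'M[C]_5) (u v w : C) : X *m J = w *: Y -> v = u / w ->
      (u^-1 *: X) *m J = v^-1 *: Y.
    by move=> e ->; rewrite -scalemxAl e scalerA invfM invrK.
  exact: (K _ _ _ _ _ _ (LE q Vq) a'E).
clearbody a'; have FW q : W q -> [/\ carries_at h (adapted_coframe phi a) (adapted_coframe phi' a') q,
    cpseries_at a' (h q) & a' (h q) ^+ 2 / Num.conj (a' (h q)) = fundR phi' (h q)].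
  move=> Wq; have Vq := WV _ Wq; have [aq a0 Rq] := aW q Wq; have [a'q a'E] := a'W q Wq.
  have a'0 : a' (h q) != 0 by rewrite a'E mulf_neq0// invr_eq0 conjc_eq0 c0.
  have [Eq uE [_ /(_ Rq) RE]] := adapted_analytic cls (VD Vq) aq a0.
  have [Eq' uE' RE'] := adapted_analytic cls' (VD' (diffeo_image Vq)) a'q a'0.
  have nrel : \forall q \near q, related h (adapted_field phi a) (adapted_field phi' a') q.
    have : \forall q \near q, W q by exact: open_nbhs_nbhs.
    exact: filterS.
  have hq := diffeo_analytic Vq.
  split; [|exact: a'q|].
    by apply/(carries_frame Eq uE Eq' uE'); exact: (related_frame hq Eq Eq' nrel).
  (* [R] is preserved by relatedness, so it equals 1 for the target field too, which is the
     condition on [a']. *)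
  by apply/RE'; exact: (etrans (esym (related_fundR hq Eq Eq' nrel uE uE')) RE).
exists W, a, a'; split.
- by split.
- exact: WV.
- by move=> q [W0q _]; exact: chA.
- by move=> _ [q Wq <-]; have [_ /canalytic_atP ? ?] := FW q Wq.
- by move=> q /FW[].
Qed.

End Intrinsic.

(** * Holomorphic extension of CR functions *)

Section Extension.
Context {R : realType}.
Local Notation C := R[i].
Local Notation pt := 'rV[R]_5.
Implicit Types (phi : pt -> 'rV[R]_3) (p q : pt).

Lemma majorized_shrink (I J : finType) (r e : R) (f : J -> (I -> C) -> C) (a : J -> R) :
  0 < r -> 0 < e -> (forall j, majorized (fun=> r) (f j) (a j)) ->
  (forall j, f j (fun=> 0) = 0) ->
  exists2 s, 0 < s & forall t, 0 <= t <= s -> t <= r /\ forall j, majorized (fun=> t) (f j) e.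
Proof.
move=> r0 e0 fa f0.
have /choice[m mP] j : exists m : I -> R, (forall i, 0 <= m i) /\
    forall s, (forall i, 0 <= s i <= r) -> majorized s (f j) (\sum_i s i * m i).
  by have [m ? ?] := majorized_small (fun=> r0) (fa j) (f0 j); exists m.
pose N := 1 + \sum_j \sum_i m j i.
have S0 j : 0 <= \sum_i m j i by apply: sumr_ge0 => i _; exact: (mP j).1.
have N0 : 0 < N by rewrite /N ltr_wpDr// sumr_ge0.
exists (Num.min r (e / N)); first by rewrite lt_min r0 divr_gt0.
move=> t /andP[t0]; rewrite le_min => /andP[tr te]; split=> // j.
have mj : majorized (fun=> t) (f j) (\sum_i t * m j i) by apply: (mP j).2 => _; rewrite t0.
apply: majorized_le mj _ _ => //.
rewrite -mulr_sumr; apply: (@le_trans _ _ (t * N)); last by rewrite -ler_pdivlMr.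
by rewrite ler_wpM2l//; apply: term_le_sum1.
Qed.

Lemma cpseries_family (n : nat) (J : finType) (g : J -> 'rV[R]_n -> C) (p : 'rV[R]_n) :
  (forall j, cpseries_at (g j) p) ->
  exists (r : R) (F : J -> ('I_n -> C) -> C) (a : J -> R),
    [/\ 0 < r, forall j, majorized (fun=> r) (F j) (a j) &
        forall x : 'rV[R]_n, (forall i, `|x 0 i| <= r) -> forall j, g j (p + x) = F j (cpoint x)].
Proof.
move=> gp.
have /choice[X XP] j : exists X : (R * R) * (('I_n -> C) -> C),
    [/\ 0 < X.1.1, majorized (fun=> X.1.1) X.2 X.1.2 &
      forall x : 'rV[R]_n, (forall i, `|x 0 i| <= X.1.1) -> g j (p + x) = X.2 (cpoint x)].
  by have [r [F [a ?]]] := gp j; exists (r, a, F).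
pose t := \big[Num.min/1]_j (X j).1.1.
have t0 : 0 < t.
  by rewrite /t; elim/big_ind: _ => // [x y ? ?|j _]; [rewrite lt_min; apply/andP|have [] := XP j].
have tX j : t <= (X j).1.1 by exact: bigmin_le_cond.
exists t, (fun j => (X j).2), (fun j => (X j).1.2); split=> // [j|x xt j].
  by have [_ + _] := XP j; apply: majorized_restrict => _ //; exact: ltW.
by have [_ _] := XP j; apply => i; exact: le_trans (xt i) (tX j).
Qed.

(* Subdividing the segment from [z k = 0] to [z], the quadratic errors add up to
   [O(1/n)]. *)
Lemma const_direction (I : finType) (k : I) (t s M : R) (f : (I -> C) -> C)
    (D : I -> (I -> C) -> C) (z : I -> C) : t <= s -> 0 <= M ->
  (forall x h, polydisc (fun=> s) x -> polydisc (fun=> s) h ->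
     cabs (f (fun i => x i + h i) - f x - \sum_i h i * D i x) <= M * (\sum_i cabs (h i)) ^+ 2) ->
  (forall x, polydisc (fun=> t) x -> D k x = 0) ->
  polydisc (fun=> t) z -> f z = f (fun i => if i == k then 0 else z i).
Proof.
move=> ts M0 fD Dk zt.
pose y (c : R) i := if i == k then c%:C * z i else z i.
have yt c : 0 <= c <= 1 -> polydisc (fun=> t) (y c).
  move=> /andP[c0 c1] i; rewrite /y; case: eqP => // _.
  by rewrite cabsM cabs_real (ger0_norm c0) (le_trans _ (zt i))// ler_piMl ?cabs_ge0.
have -> : z = y 1 by apply/funext => i; rewrite /y mul1r; case: eqP.
have -> : (fun i => if i == k then 0 else y 1 i) = y 0.
  by apply/funext => i; rewrite /y mul0r; case: eqP.
apply/eqP; rewrite -subr_eq0; apply/eqP.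
have A0 : 0 <= M * cabs (z k) ^+ 2 by rewrite mulr_ge0// exprn_ge0// cabs_ge0.
apply: (cabs_lim_uniq A0) => e e0.
(* [n] exceeds [1 / e]; each of the [n] steps costs at most [M |z k|^2 / n^2], in total at most
   [M |z k|^2 e]. *)
pose n := (Num.truncn e^-1).+1.
have n0 : 0 < n%:R :> R by rewrite ltr0n.
have ne : n%:R^-1 <= e.
  by rewrite -[e]invrK lef_pV2 ?posrE ?invr_gt0// ltW// truncnS_gt.
have step m : (m < n)%N -> cabs (f (y (m.+1%:R / n%:R)) - f (y (m%:R / n%:R))) <=
    M * cabs (z k) ^+ 2 * n%:R^-1 ^+ 2.
  move=> mn; pose h i : C := if i == k then (n%:R^-1)%:C * z k else 0.
  have hE : y (m.+1%:R / n%:R) = fun i => y (m%:R / n%:R) i + h i.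
    apply/funext => i; rewrite /y /h; case: eqP => [->|_]; last by rewrite addr0.
    by rewrite -mulrDl -rmorphD /= -[m.+1]addn1 natrD mulrDl mul1r.
  have yS : polydisc (fun=> t) (y (m%:R / n%:R)).
    apply: yt; rewrite divr_ge0// ?ler0n//= ler_pdivrMr// mul1r ler_nat.
    exact: ltnW.
  have hS : polydisc (fun=> s) h.
    move=> i; rewrite /h; case: eqP => _; last first.
      by rewrite cabs0 (le_trans _ ts)// (le_trans _ (zt k)) ?cabs_ge0.
    rewrite cabsM cabs_real ger0_norm ?invr_ge0 ?ler0n// (le_trans _ ts)//.
    rewrite (le_trans _ (zt k))// ler_piMl ?cabs_ge0// invf_le1// ler1n//.
  have := fD _ _ (fun i => le_trans (yS i) ts) hS; rewrite -hE.
  rewrite (bigD1 k)//= big1 => [|i /negPf ik]; last by rewrite /h ik mul0r.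
  rewrite Dk// mulr0 addr0 subr0 (bigD1 k)//= big1 => [|i /negPf ik]; last first.
    by rewrite /h ik cabs0.
  rewrite addr0 /h eqxx cabsM cabs_real ger0_norm ?invr_ge0 ?ler0n//.
  by rewrite exprMn [_^-1 ^+ 2 * _]mulrC mulrA.
have tel m : (m <= n)%N -> cabs (f (y (m%:R / n%:R)) - f (y 0)) <=
    m%:R * (M * cabs (z k) ^+ 2 * n%:R^-1 ^+ 2).
  elim: m => [|m IH] mn; first by rewrite !mul0r subrr cabs0.
  rewrite (_ : _ - _ = (f (y (m.+1%:R / n%:R)) - f (y (m%:R / n%:R))) +
    (f (y (m%:R / n%:R)) - f (y 0))); last by ring.
  have S (A : R) : m.+1%:R * A = A + m%:R * A by rewrite -add1n natrD mulrDl mul1r.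
  rewrite (le_trans (cabsD _ _))// [leRHS]S lerD ?step//.
  exact: IH (ltnW mn).
have := tel n (leqnn n); rewrite divff ?gt_eqF// => /le_trans; apply.
rewrite mulrCA ler_wpM2l// expr2 mulrA divff ?gt_eqF// mul1r.
exact: ne.
Qed.

(** A (0,1) vector kills [z], that is [v_0 = - i v_1]; on the conjugate of [z] it takes the value
    [v_0 - i v_1 = 2 v_0]. *)
Lemma conj_partial phi p q (v : 'rV[C]_5) c : vanalytic_at phi q -> T01 phi q v ->
  \sum_i v 0 i * cpartial i (fun q => conjc (graph_map phi q 0 0 - c)) q = 2 * v 0 0.
Proof.
move=> phq Tv.
have gq : cpseries_at (fun q => graph_map phi q 0 0) q by exact: graph_map_analytic.
have zE := graph_diff_col0 phi q v; rewrite (Tv : _ *m _ = 0) mxE in zE.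
have zcE := graph_diff_col0 phi q (conj_mx v).
have E i : cpartial i (fun q => conjc (graph_map phi q 0 0 - c)) q = conjc (graph_diff phi q i 0).
  rewrite (@cpartial_conj _ i (fun q => graph_map phi q 0 0 - c)); last first.
    by apply: cpseriesB => //; exact: cpseries_cst.
  by rewrite cpartialB ?cpartial_cst ?subr0 ?mxE//; exact: cpseries_cst.
rewrite (eq_bigr (fun i => conjc (conj_mx v 0 i * graph_diff phi q i 0))); last first.
  move=> i _; have K (a b : C) : conjc (conjc a * b) = a * conjc b by rewrite rmorphM /= conjcK.
  have cv : conj_mx v 0 i = conjc (v 0 i) by rewrite mxE.
  by rewrite E cv; exact: (esym (K _ _)).
rewrite -rmorph_sum /= -[X in conjc X](_ : (conj_mx v *m graph_diff phi q) 0 0 = _); last by rewrite mxE.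
have K (a b : C) : conjc (conjc a + 'i * conjc b) = a - 'i * b.
  case: a b => [x y] [z w]; apply/eqP; rewrite eq_complex /=.
  by apply/andP; split; apply/eqP; ring.
rewrite zcE mxE [X in _ + _ * X]mxE K.
have v1 : v 0 0 = - ('i * v 0 1) by apply/eqP; rewrite -addr_eq0 -zE.
by rewrite -v1; ring.
Qed.

Definition pin_last (w : 'I_4 -> C) (k : 'I_(4 + 1)) : C :=
  match fintype.split k with inl j => w j | inr _ => 0 end.

(* In the complexification, the holomorphic coordinates of [C^4] and the conjugate of
   [z] form a coordinate system, and the CR equation says that [f] does not depend on
   the latter. *)
Lemma cr_extension phi p (f : pt -> C) : vanalytic_at phi p -> cr_generic_at phi p ->
  (\forall q \near p, vanalytic_at phi q /\ T01 phi q (fieldLbar phi q)) ->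
  cpseries_at f p ->
  (\forall q \near p, \sum_i fieldLbar phi q 0 i * cpartial i f q = 0) ->
  exists (r : R) (F : ('I_4 -> C) -> C) (a : R),
    [/\ 0 < r, majorized (fun=> r) F a &
      \forall q \near p, f q = F (fun j => graph_map phi q 0 j - graph_map phi p 0 j)].
Proof.
move=> php gen phn fp fL; have [_ TL] := near_at phn.
(* The five coordinates on the complexification, centred at [p]: those of [C^4], then the conjugate
   of [z]. *)
pose psi (k : 'I_(4 + 1)) q : C := match fintype.split k with
  inl j => graph_map phi q 0 j - graph_map phi p 0 j
| inr _ => conjc (graph_map phi q 0 0 - graph_map phi p 0 0) end.
pose kz : 'I_(4 + 1) := rshift 4 ord0.
have psiz q : psi kz q = conjc (graph_map phi q 0 0 - graph_map phi p 0 0).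
  by rewrite /psi (unsplitK (inr ord0)).
have psij j q : psi (lshift 1 j) q = graph_map phi q 0 j - graph_map phi p 0 j.
  by rewrite /psi (unsplitK (inl j)).
have psi0 k : psi k p = 0 by rewrite /psi; case: fintype.split => ?; rewrite subrr ?conjc0.
have psip k : cpseries_at (psi k) p.
  have gp j : cpseries_at (fun q => graph_map phi q 0 j - graph_map phi p 0 j) p.
    by apply: cpseriesB; [exact: graph_map_analytic|exact: cpseries_cst].
  by rewrite /psi; case: fintype.split => ?; [exact: gp|apply: cpseries_conj; exact: gp].
have psid q v k : vanalytic_at phi q -> T01 phi q v ->
    \sum_i v 0 i * cpartial i (psi k) q = if k == kz then 2 * v 0 0 else 0.
  move=> phq Tv; case: (split_ordP k) => j ->.
    rewrite (_ : (_ == kz) = false) ?eq_lrshift//.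
    have -> : psi (lshift 1 j) = fun q => graph_map phi q 0 j - graph_map phi p 0 j.
      by apply/funext => ?; exact: psij.
    have := congr1 (fun M : 'rV_4 => M 0 j) (Tv : _ *m _ = 0).
    rewrite !mxE => e; rewrite -[RHS]e; apply: eq_bigr => i _.
    rewrite cpartialB ?cpartial_cst ?subr0 ?mxE//; last exact: cpseries_cst.
    exact: graph_map_analytic.
  have -> : psi (rshift 4 j) = fun q => conjc (graph_map phi q 0 0 - graph_map phi p 0 0).
    by apply/funext => ?; rewrite (ord1 j); exact: psiz.
  by rewrite (ord1 j) eqxx; exact: conj_partial.
pose fam (k : option 'I_(4 + 1)) := if k is Some k then psi k else f.
have [|r [F [a [r0 Fa FE]]]] := cpseries_family (g := fam) (p := p).
  by case.
pose Psi k := F (Some k).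
have PE (x : pt) : (forall i, `|x 0 i| <= r) -> forall k, psi k (p + x) = Psi k (cpoint x).
  by move=> xr k; exact: (FE x xr (Some k)).
have FfE (x : pt) : (forall i, `|x 0 i| <= r) -> f (p + x) = F None (cpoint x).
  by move=> xr; exact: (FE x xr None).
have z0r : forall i, `|(0 : pt) 0 i| <= r by move=> i; rewrite mxE normr0 ltW.
have Psi0 k : Psi k (fun=> 0) = 0 by rewrite -cpoint0 -PE// addr0 psi0.
pose M : 'M[C]_5 := \matrix_(i, k) cpartial i (psi k) p.
(* A vector killed by the first four differentials is of type (0,1); killed by the fifth too, it has
   no z-component, hence is zero. *)
have uM : M \in unitmx.
  apply: mulmx0_unit => v vM.
  have vk k : \sum_i v 0 i * cpartial i (psi k) p = 0.
    have := congr1 (fun M : 'rV_5 => M 0 k) vM; rewrite !mxE => e; rewrite -[RHS]e.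
    by apply: eq_bigr => i _; rewrite mxE.
  have Tv : T01 phi p v.
    rewrite /T01 /=; apply/rowP => j; rewrite !mxE -[RHS](vk (lshift 1 j)).
    apply: eq_bigr => i _; rewrite mxE; congr (_ * _).
    have -> : psi (lshift 1 j) = fun q => graph_map phi q 0 j - graph_map phi p 0 j.
      by apply/funext => ?; exact: psij.
    rewrite cpartialB ?cpartial_cst ?subr0//; last exact: cpseries_cst.
    exact: graph_map_analytic.
  apply: (T01_eq0 gen TL Tv); have := psid p v kz php Tv; rewrite vk eqxx => /esym/eqP.
  by rewrite mulf_eq0 pnatr_eq0 /= => /eqP.
have PsiD k : cderiv (Psi k) (fun=> 0) (fun i => M i k).
  have r2 : 0 < r / 2 by rewrite divr_gt0.
  have [|D [m [_ FD]]] := majorized_cderiv (fun _ : 'I_5 => ltW r2) (fun=> r2)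
      (f := Psi k) (a := a (Some k)).
    by rewrite (_ : (fun=> _) = fun=> r); [exact: Fa|apply/funext => _; rewrite -splitr].
  have D0 := FD _ (polydisc0 (fun _ : 'I_5 => ltW r2)).
  rewrite (_ : (fun i => M i k) = fun i => D i (fun=> 0))//.
  apply/funext => i; rewrite mxE.
  apply: (@rderiv_cpartial5 _ (psi k) p (fun i => D i (fun=> 0))).
  rewrite -[p in rderiv _ p]addr0.
  apply: (@cderiv_rderiv _ _ (Psi k) (psi k) p 0 r).
  - by move=> x xr; exact: PE.
  - by move=> i0; rewrite mxE normr0.
  - by rewrite cpoint0.
have MB i j : \sum_k M i k * invmx M k j = (i == j)%:R.
  by have := congr1 (fun A : 'M[C]_5 => A i j) (mulmxV uM); rewrite !mxE.
have BM i j : \sum_k invmx M i k * M k j = (i == j)%:R.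
  by have := congr1 (fun A : 'M[C]_5 => A i j) (mulVmx uM); rewrite !mxE.
have [s [t [U [[s0 sr t0] Um PU UP]]]] := inverse_function r0 (fun k => Fa (Some k)) Psi0 PsiD MB BM.
(* [f] written in the new coordinates, [U] being the inverse coordinate change. *)
pose G w := F None (fun j => U j w).
have Gm : majorized (fun=> t) G (a None).
  apply: (@majorized_comp _ _ _ (fun=> s) (fun=> t) (F None)) => [i|j||j]; try exact: ltW.
    by apply: majorized_restrict (Fa None) => // _; exact: ltW.
  exact: Um.
have t2 : 0 < t / 2 by rewrite divr_gt0.
have [|D [m [K [Dm K0 GT]]]] := majorized_taylor1 (fun _ : 'I_(4 + 1) => ltW t2) (fun=> t2)
    (f := G) (a := a None).
  by rewrite (_ : (fun=> _) = fun=> t)//; apply/funext => _; rewrite -splitr.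
have Gd x : polydisc (fun=> t / 2) x -> cderiv G x (fun i => D i x).
  by move=> xt; apply: (taylor_cderiv (fun=> t2) K0) => h; exact: GT.
have psin (e : R) : 0 < e -> \forall q \near p, forall k, cabs (psi k q) <= e.
  move=> e0; apply: near_forall => k; have := cpseries_cont (psip k) e0.
  by apply: filterS => q; rewrite psi0 subr0.
have fG : \forall q \near p, f q = G (fun k => psi k q).
  have nr : \forall q \near p, forall i, `|(q - p) 0 i| <= Num.min r s.
    apply/nbhs_box; exists (Num.min r s); first by rewrite lt_min r0.
    by move=> x xs i; rewrite addrAC subrr add0r.
  apply: filterS2 nr (psin t t0) => q qr psit.
  have qE : q = p + (q - p) by rewrite addrC subrK.
  have qr' i : `|(q - p) 0 i| <= r by apply: le_trans (qr i) _; rewrite ge_min lexx.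
  have pE : (fun k => psi k q) = fun k => Psi k (cpoint (q - p)).
    by apply/funext => k; rewrite {1}qE PE.
  rewrite pE /G qE FfE -?qE//; congr (F None); apply/funext => j.
  rewrite UP//; first by move=> i; rewrite cabs_real (le_trans (qr i))// ge_min lexx orbT.
  by move=> k; have := psit k; rewrite {1}qE PE.
have Dreal : \forall q \near p, D kz (fun k => psi k q) = 0.
  have psir := near_forall (fun k => cpseries_near (psip k)).
  apply: filterS3 (filterI phn fL) (filterI (near_near fG) psir) (psin _ t2).
  move=> q [[phq TLq] fLq] [fGq psiq] psit.
  have gd k : rderiv (psi k) q (fun i => cpartial i (psi k) q).
    exact: cpseries_rderiv.
  have cD := rderiv_comp_complex (Gd _ psit) gd.
  have dE i : cpartial i f q = \sum_k cpartial i (psi k) q * D k (fun k => psi k q).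
    by rewrite (cpartial_near_eq i fGq) (rderiv_cpartial5 i cD).
  move: fLq; rewrite (eq_bigr _ (fun i _ => congr1 (fun z => _ * z) (dE i))).
  under eq_bigr do rewrite mulr_sumr; rewrite exchange_big /=.
  rewrite (eq_bigr (fun k => (if k == kz then 1 else 0) * D k (fun k => psi k q))); last first.
    move=> k _; under eq_bigr do rewrite mulrA; rewrite -mulr_suml psid// fieldLbar0.
    by rewrite divff// pnatr_eq0.
  rewrite (bigD1 kz)//= mul1r [X in _ + X]big1 ?addr0// => k /negPf ->.
  exact: mul0r.
have /nbhs_box[d d0 dD] := Dreal.
have [s1 s10 Ps] := majorized_shrink r0 t2 (fun k => Fa (Some k)) Psi0.
pose s2 := Num.min s (Num.min d s1).
have s20 : 0 < s2 by rewrite !lt_min s0 d0.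
have [s2s s2d s2s1] : [/\ s2 <= s, s2 <= d & s2 <= s1].
  by rewrite /s2 !ge_min !lexx ?orbT.
have Psm k : majorized (fun=> s2) (Psi k) (t / 2).
  by apply: (Ps s2 _).2; rewrite (ltW s20).
have DP : majorized (fun=> s2) (fun x => D kz (fun k => Psi k x)) (m kz).
  apply: (@majorized_comp _ _ _ (fun=> t / 2) (fun=> s2) (D kz)) => [i|j||j] //; exact: ltW.
have DP0 := identity_theorem (fun=> s20) DP.
(* So far the derivative vanishes at the points of [M], which are the real points of the
   complexification; the identity theorem extends this to a complex polydisc. *)
have {}DP0 z : (forall i, cabs (z i) < s2) -> D kz (fun k => Psi k z) = 0.
  apply: DP0 => x xs; have := dD (\row_i x i) _.
  have xr i : `|(\row_i x i : pt) 0 i| <= s2 by rewrite mxE ltW.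
  have E : (fun k => psi k (p + \row_i x i)) = fun k => Psi k (fun i => (x i)%:C).
    apply/funext => k; rewrite PE.
      by congr (Psi k); apply/funext => i; rewrite /cpoint mxE.
    by move=> i; rewrite (le_trans (xr i))// (le_trans s2s).
  by rewrite E => -> // i; exact: le_trans (xr i) s2d.
have U0 k : U k (fun=> 0) = 0.
  have e : (fun k => Psi k (fun=> 0)) = fun=> 0 by apply/funext => j; exact: Psi0.
  have := UP (fun=> 0) (polydisc0 (fun _ : 'I_(4 + 1) => ltW s0)).
  rewrite e; apply; exact: (polydisc0 (fun _ : 'I_(4 + 1) => ltW t0)).
have s22 : 0 < s2 / 2 by rewrite divr_gt0.
have [t1 t10 Us] := majorized_shrink t0 s22 Um U0.
pose t' := Num.min t1 (t / 2).
have t'0 : 0 < t' by rewrite lt_min t10.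
have [t't t't1] : t' <= t / 2 /\ t' <= t1 by rewrite /t' !ge_min !lexx ?orbT.
have [t'tt Ut'] : t' <= t /\ forall j, majorized (fun=> t') (U j) (s2 / 2).
  by apply: Us; rewrite (ltW t'0).
(* The radius [t'] makes [U] land strictly inside the polydisc [s2], so each such [x] is an image
   under [Psi] of a point already treated. *)
have Dk x : polydisc (fun=> t') x -> D kz x = 0.
  move=> xt; have xt2 : polydisc (fun=> t) x by move=> i; exact: le_trans (xt i) t'tt.
  have -> : x = fun k => Psi k (fun j => U j x) by apply/funext => k; rewrite -(PU x xt2).
  apply: DP0 => i; apply: le_lt_trans (majorized_bound (Ut' i) xt) _.
  by rewrite ltr_pdivrMr// ltr_pMr// ltr1n.
exists t', (fun w => G (pin_last w)), (a None); split=> //.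
  apply: (@majorized_comp _ _ _ (fun=> t') (fun=> t') G) => [i|j||k]; try exact: ltW.
    by apply: majorized_restrict Gm => // _; exact: ltW.
  rewrite /pin_last; case: fintype.split => j; first exact: (maj_var _ j).
  by apply: majorized_cst; rewrite ?cabs0 ltW.
apply: filterS2 fG (psin t' t'0) => q -> psit.
rewrite (const_direction t't K0 GT Dk psit); congr G; apply/funext => k.
rewrite /pin_last; case: (split_ordP k) => j ->.
  by rewrite eq_lrshift psij.
by rewrite (ord1 j) eqxx.
Qed.

End Extension.

(** * Holomorphic maps of C^4 *)

Section ComplexDifferentiable.
Context {R : realType}.
Local Notation C := R[i].

Lemma complex_gt0 (e : C) : 0 < e -> exists2 e' : R, 0 < e' & e = e'%:C.
Proof. by case: e => a b; rewrite ltcE /= => /andP[/eqP -> a0]; exists a. Qed.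

Local Notation C4 := (@C4 R).

Lemma nbhs_cbox (a : 'rV[C]_4) (P : 'rV[C]_4 -> Prop) :
  (\forall b \near (a : C4), P b) <->
  exists2 d : R, 0 < d & forall x : 'rV[C]_4, (forall i, cabs (x 0 i) <= d) -> P (a + x).
Proof.
split=> [/nbhs_ballP[e /= /complex_gt0[e' e0 ->] eP]|[d d0 dP]].
  exists (e' / 2); first by rewrite divr_gt0.
  move=> x xe; apply: eP; rewrite -ball_normE /ball_ /=.
  have -> : a - (a + x : C4) = - x by rewrite opprD addrA subrr sub0r.
  rewrite normrN; apply: (@le_lt_trans _ _ (e' / 2)%:C); last first.
    by rewrite ltcR ltr_pdivrMr// ltr_pMr// ltr1n.
  apply/mx_norm_leP => [|i j]; first by rewrite lecR divr_ge0// ltW.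
  by rewrite ord1 -cabsE lecR.
apply/nbhs_ballP; exists d%:C => /=; first by rewrite ltcR.
move=> b; rewrite -ball_normE /ball_ /= => ab.
have -> : b = a + (b - a) by rewrite addrC subrK.
apply: dP => i; rewrite -lecR cabsE; apply: le_trans (ltW ab).
by rewrite distrC; exact: (@mx_norm_entry _ _ _ (b - a : 'rV[C]_4)).
Qed.

Lemma cderiv_differentiable (F : 'I_4 -> ('I_4 -> C) -> C)
    (a0 a : 'rV[C]_4) (D : 'I_4 -> 'I_4 -> C) :
  (forall l, cderiv (F l) (fun j => (a - a0) 0 j) (D l)) ->
  differentiable ((fun a : 'rV[C]_4 => \row_l F l (fun j => (a - a0) 0 j)) : C4 -> C4) (a : C4).
Proof.
move=> FD; pose H := (fun a : 'rV[C]_4 => \row_l F l (fun j => (a - a0) 0 j)).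
have [|//] := @differentiable_rowP _ 3 3 H a (\matrix_(j, l) D l j).
move=> e /complex_gt0[e' e0 ->].
have em : 0 < e' / 4 by rewrite divr_gt0// ltr0n.
have /choice[d dP] l : exists d : R, 0 < d /\ forall h : 'I_4 -> C, (forall i, cabs (h i) <= d) ->
    cabs (F l (fun i => (a - a0) 0 i + h i) - F l (fun j => (a - a0) 0 j) - \sum_i h i * D l i) <=
      e' / 4 * \sum_i cabs (h i).
  by have [d d0 dP] := FD l _ em; exists d.
apply/(nbhs_cbox 0); exists (\big[Num.min/1]_l d l).
  by elim/big_ind: _ => // [x y ? ?|l _]; [rewrite lt_min; apply/andP|exact: (dP l).1].
move=> x xd; rewrite add0r; apply/mx_norm_leP.
  by rewrite mulr_ge0 ?normr_ge0// lecR ltW.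
move=> i l; rewrite ord1 !mxE -cabsE.
have -> : (fun j => (a + x - a0) 0 j) = fun j => (a - a0) 0 j + x 0 j.
  by apply/funext => j; rewrite !mxE addrAC.
under eq_bigr do rewrite mxE.
apply: (@le_trans _ _ (e' / 4 * \sum_i cabs (x 0 i))%:C).
  by rewrite lecR; apply: (dP l).2 => j; apply: le_trans (xd j) _; exact: bigmin_le_cond.
have eE (y : C) : e'%:C * y = (e' / 4)%:C * \sum_(i < 4) y.
  have -> : e' = e' / 4 + e' / 4 + e' / 4 + e' / 4 by field.
  rewrite (_ : (_ + _) / 4 = e' / 4); last by field.
  by rewrite !rmorphD !big_ord_recl big_ord0 /=; ring.
rewrite eE.
rewrite rmorphM rmorph_sum ler_pM2l ?ltcR//.
by apply: ler_sum => k _; rewrite [leLHS]cabsE; exact: mx_norm_entry.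
Qed.

Definition open_box (c : 'rV[C]_4) (d : R) : set C4 :=
  [set a : 'rV[C]_4 | forall j, cabs ((a - c) 0 j) < d].

Lemma open_box_open (c : 'rV[C]_4) d : open (open_box c d).
Proof.
rewrite openE => a ad; apply/nbhs_cbox.
have dpos j : 0 < d - cabs ((a - c) 0 j) by rewrite subr_gt0.
exists (\big[Num.min/1]_j ((d - cabs ((a - c) 0 j)) / 2)).
  elim/big_ind: _ => // [x y ? ?|j _]; first by rewrite lt_min; apply/andP.
  by rewrite divr_gt0.
move=> x xd j; have -> : (a + x - c) 0 j = (a - c) 0 j + x 0 j.
  by rewrite !mxE addrAC.
rewrite (le_lt_trans (cabsD _ _))// -ltrBrDl (@le_lt_trans _ _ ((d - cabs ((a - c) 0 j)) / 2))//.
  by apply: le_trans (xd j) _; exact: bigmin_le_cond.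
by rewrite ltr_pdivrMr// ltr_pMr ?ltr1n.
Qed.

Lemma cderiv_addl (I : finType) (f : (I -> C) -> C) c x d : cderiv f x d ->
  cderiv (fun z => c + f z) x d.
Proof.
move=> fd e /fd[del d0 hd]; exists del => // h /hd.
by rewrite (_ : c + _ - _ = f (fun i => x i + h i) - f x)//; ring.
Qed.

Lemma preimage_open_at (U : normedModType C) (V : normedModType C) (f : U -> V) (A : set U) (B : set V) :
  open A -> open B -> (forall a, A a -> differentiable f a) -> open (A `&` f @^-1` B).
Proof.
move=> oA oB fd; rewrite openE => a [Aa Ba].
have nA : nbhs a A by exact: open_nbhs_nbhs.
have nB : nbhs (f a) B by exact: open_nbhs_nbhs.
exact: filterI nA (differentiable_continuous (fd a Aa) nB).
Qed.

(** On boxes [A] around [a0] and [B] around [b0], the map [H] and its local inverse [K] are both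
    holomorphic. The image of [A] intersected with the preimage of [B] under [H] is [B] intersected
    with the preimage of [A] under [K], so its openness is the continuity of [K]. *)
Lemma local_biholomorphism (F : 'I_4 -> ('I_4 -> C) -> C) (r delta : R) (m : 'I_4 -> R)
    (D : 'M[C]_4) (a0 b0 : 'rV[C]_4) : 0 < r -> 0 < delta -> D \in unitmx ->
  (forall l, majorized (fun=> r) (F l) (m l)) -> (forall l, F l (fun=> 0) = b0 0 l) ->
  (forall l, cderiv (F l) (fun=> 0) (fun j => D j l)) ->
  exists (U : set C4) (H : C4 -> C4),
    [/\ biholomorphism_on U H, U a0 &
      forall a, U a -> open_box a0 delta a /\ forall l, H a 0 l = F l (fun j => (a - a0) 0 j)].
Proof.
move=> r0 delta0 uD Fm F0 FD0.
have r2 : 0 < r / 2 by rewrite divr_gt0.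
have /choice[DF FD] l : exists DF : 'I_4 -> ('I_4 -> C) -> C, forall x,
    polydisc (fun=> r / 2) x -> cderiv (F l) x (fun i => DF i x).
  have [|DF [? [_ ?]]] := majorized_cderiv (fun _ : 'I_4 => ltW r2) (fun=> r2) (f := F l) (a := m l).
    by rewrite (_ : (fun=> _) = fun=> r)//; apply/funext => _; rewrite -splitr.
  by exists DF.
pose Psi l v := - b0 0 l + F l v.
have Psim l : majorized (fun=> r / 2) (Psi l) (cabs (- b0 0 l) + m l).
  apply: maj_add; first exact: maj_cst.
  apply: majorized_restrict (Fm l) => [_|_]; first exact: ltW.
  by rewrite ler_pdivrMr// ler_pMr// ler1n.
have Psi0 l : Psi l (fun=> 0) = 0 by rewrite /Psi F0 addNr.
have PsiD l : cderiv (Psi l) (fun=> 0) (fun j => D j l) by exact: cderiv_addl.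
have DB i j : \sum_k D i k * invmx D k j = (i == j)%:R.
  by have := congr1 (fun A : 'M[C]_4 => A i j) (mulmxV uD); rewrite !mxE.
have BD i j : \sum_k invmx D i k * D k j = (i == j)%:R.
  by have := congr1 (fun A : 'M[C]_4 => A i j) (mulVmx uD); rewrite !mxE.
have [s [t [U [[s0 sr t0] Um PU UP]]]] := inverse_function r2 Psim Psi0 PsiD DB BD.
have t2 : 0 < t / 2 by rewrite divr_gt0.
have t2t : t / 2 <= t by rewrite ler_pdivrMr// ler_pMr// ler1n.
have /choice[DU UD] k : exists DU : 'I_4 -> ('I_4 -> C) -> C, forall x,
    polydisc (fun=> t / 2) x -> cderiv (U k) x (fun i => DU i x).
  have [|DU [? [_ ?]]] := majorized_cderiv (fun _ : 'I_4 => ltW t2) (fun=> t2) (f := U k) (a := s).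
    by rewrite (_ : (fun=> _) = fun=> t)//; apply/funext => _; rewrite -splitr.
  by exists DU.
pose s3 := Num.min s delta.
have s30 : 0 < s3 by rewrite lt_min s0.
have [s3s s3d] : s3 <= s /\ s3 <= delta by rewrite /s3 !ge_min !lexx orbT.
pose H (a : 'rV[C]_4) : 'rV[C]_4 := \row_l F l (fun j => (a - a0) 0 j).
pose K (b : 'rV[C]_4) : 'rV[C]_4 := \row_k (a0 0 k + U k (fun l => (b - b0) 0 l)).
pose A := open_box a0 s3; pose B := open_box b0 (t / 2).
have Hd a : A a -> differentiable (H : C4 -> C4) a.
  move=> Aa; apply: cderiv_differentiable => l; apply: FD => j.
  by rewrite ltW// (lt_le_trans (Aa j))// (le_trans s3s).
have Kd b : B b -> differentiable (K : C4 -> C4) b.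
  move=> Bb; apply: (@cderiv_differentiable (fun k v => a0 0 k + U k v)) => k.
  by apply: cderiv_addl; apply: UD => j; exact: ltW.
have HB (a : 'rV[C]_4) : A a -> forall l, (H a - b0) 0 l = Psi l (fun j => (a - a0) 0 j).
  by move=> Aa l; rewrite !mxE addrC.
have KA b : forall k, (K b - a0) 0 k = U k (fun l => (b - b0) 0 l).
  by move=> k; rewrite !mxE addrAC subrr add0r.
have KH (a : 'rV[C]_4) : A a -> B (H a) -> K (H a) = a.
  move=> Aa Ba; apply/rowP => k; rewrite mxE.
  have -> : (fun l => (H a - b0) 0 l) = fun l => Psi l (fun j => (a - a0) 0 j).
    by apply/funext => l; exact: HB.
  rewrite UP.
  - by rewrite !mxE /=; ring.
  - by move=> j; rewrite ltW// (lt_le_trans (Aa j)).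
  - by move=> l; rewrite -HB// ltW// (lt_le_trans (Ba l)).
have HK (b : 'rV[C]_4) : B b -> H (K b) = b.
  move=> Bb; apply/rowP => l; rewrite mxE.
  have -> : (fun j => (K b - a0) 0 j) = fun k => U k (fun l => (b - b0) 0 l).
    by apply/funext => k; exact: KA.
  have := PU (fun l => (b - b0) 0 l) (fun j => le_trans (ltW (Bb j)) t2t) l.
  by rewrite /Psi => /(congr1 (+%R (b0 0 l))); rewrite addrA subrr add0r => ->; rewrite !mxE /=; ring.
exists (A `&` H @^-1` B), H; split.
- have imE : H @` (A `&` H @^-1` B) = B `&` K @^-1` A.
    apply/seteqP; split=> [_ [a [Aa Ba] <-]|b [Bb Ab]].
      by split=> //; rewrite /preimage /= KH.
    by exists (K b); [split=> //; rewrite /preimage /= HK|exact: HK].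
  exists K; split.
  + exact: (@preimage_open_at C4 C4 H A B (@open_box_open a0 s3) (@open_box_open b0 (t / 2)) Hd).
  + rewrite imE; exact: (@preimage_open_at C4 C4 K B A (@open_box_open b0 (t / 2)) (@open_box_open a0 s3) Kd).
  + by move=> a [Aa _]; exact: Hd.
  + by rewrite imE => b [Bb _]; exact: Kd.
  + by move=> a [Aa Ba]; exact: KH.
- have Aa0 : A a0 by move=> j; rewrite subrr mxE cabs0.
  split=> // j; rewrite HB// (_ : (fun j => _) = fun=> 0) ?Psi0 ?cabs0//.
  by apply/funext => k; rewrite subrr mxE.
- move=> a [Aa _]; split=> [j|l]; last by rewrite mxE.
  exact: lt_le_trans (Aa j) s3d.
Qed.

End ComplexDifferentiable.

Section Extrinsic.
Context {R : realType}.
Local Notation C := R[i].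
Local Notation C4 := (@C4 R).
Local Notation pt := 'rV[R]_5.

Lemma rderiv_graph (phi : pt -> 'rV[R]_3) p j : vanalytic_at phi p ->
  rderiv (fun q => graph_map phi q 0 j) p (fun i => graph_diff phi p i j).
Proof.
move=> php; apply: rderiv_ext (cpseries_rderiv (graph_map_analytic j php)) _ => i.
by rewrite mxE.
Qed.

Lemma near_graph (phi : pt -> 'rV[R]_3) p (U : set C4) : vanalytic_at phi p ->
  open U -> U (graph_map phi p) -> \forall q \near p, U (graph_map phi q).
Proof.
move=> php oU Up; have : \forall b \near (graph_map phi p : C4), U b by exact: open_nbhs_nbhs.
move=> /nbhs_cbox[d d0 dU].
have := near_forall (fun j => cpseries_cont (graph_map_analytic j php) d0).
apply: filterS => q qd.
have := dU (graph_map phi q - graph_map phi p); rewrite [_ + (_ - _)]addrC subrK; apply => j.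
have sE (u v : 'rV[C]_4) : (u - v) 0 j = u 0 j - v 0 j by rewrite !mxE.
by rewrite sE; exact: qd.
Qed.

(** A biholomorphism is known to be complex differentiable only, with no series at hand, so its
    Jacobian at one point is fed to [rderiv_chain]. *)
Lemma rderiv_holomorphic (phi : pt -> 'rV[R]_3) p (H : 'rV[C]_4 -> 'rV[C]_4) l :
  vanalytic_at phi p -> differentiable (H : C4 -> C4) (graph_map phi p) ->
  exists D : 'M[C]_4,
  rderiv (fun q => H (graph_map phi q) 0 l) p (fun i => \sum_j graph_diff phi p i j * D j l).
Proof.
move=> php Hd; pose J : 'M[C]_4 := jacobian H (graph_map phi p); exists J.
have gd j := rderiv_graph j php.
apply: (rderiv_chain (g := fun j q => graph_map phi q 0 j) gd) => e e0.
have eC : 0 < e%:C :> C by rewrite ltcR.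
have := @differentiable_row _ 3 3 H (graph_map phi p) Hd e%:C eC.
move=> /(nbhs_cbox 0)[d d0 dH].
have := near_forall (fun j => rderiv_lipschitz (gd j) d0); apply: filterS => x xd.
pose h : 'rV[C]_4 := graph_map phi (p + x) - graph_map phi p.
have hE j : h 0 j = graph_map phi (p + x) 0 j - graph_map phi p 0 j by rewrite !mxE.
have {dH} := dH h (fun j => _); rewrite add0r => dH.
have {}dH := dH (fun j => eq_ind_r (fun z => is_true (cabs z <= d)) (xd j) (hE j)).
have hp : graph_map phi p + h = graph_map phi (p + x) by rewrite /h addrC subrK.
rewrite hp in dH.
rewrite -lecR cabsE; apply: le_trans (le_trans (_ : _ <= `|H (graph_map phi (p + x)) - H (graph_map phi p) - h *m J|) dH) _.
  apply: le_trans (@mx_norm_entry _ _ _ _ 0 l).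
  rewrite !mxE; under [X in _ <= `|_ - X|]eq_bigr do rewrite hE.
  exact: lexx.
rewrite rmorphM ler_pM2l//; apply/mx_norm_leP.
  by rewrite lecR sumr_ge0// => j _; exact: cabs_ge0.
move=> i j; rewrite (ord1 i) hE -cabsE lecR (bigD1 j)//= lerDl sumr_ge0// => k _.
exact: cabs_ge0.
Qed.

End Extrinsic.

(** * The extrinsic equivalence problem *)

Section ExtrinsicIntrinsic.
Context {R : realType}.
Local Notation C := R[i].
Local Notation C4 := (@C4 R).
Local Notation pt := 'rV[R]_5.
Variables (D D' : set pt) (phi phi' : pt -> 'rV[R]_3) (V V' : set pt) (h : pt -> pt).
Hypotheses (cls : class_III1 D phi) (cls' : class_III1 D' phi')
  (VD : V `<=` locus_R_neq0 D phi) (VD' : V' `<=` locus_R_neq0 D' phi')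
  (hV : analytic_diffeo V V' h).

Lemma source_analytic p : V p -> vanalytic_at phi p.
Proof. by move=> /VD[Dp _]; case: cls => _ + _ _ _; apply. Qed.

Lemma target_analytic p : V p -> vanalytic_at phi' (h p).
Proof. by move=> /(diffeo_image hV)/VD'[Dp _]; case: cls' => _ + _ _ _; apply. Qed.

Lemma rderiv_graph_comp p l : V p ->
  rderiv (fun q => graph_map phi' (h q) 0 l) p
    (fun i => (cjacobian h p *m graph_diff phi' (h p)) i l).
Proof.
move=> Vp; have hp := diffeo_analytic hV Vp.
have [_ Jh] := vanalytic_differentiable hp.
have hc j : cpseries_at (fun q => (h q 0 j)%:C) p by exact: analytic_cpseries.
apply: rderiv_ext (rderiv_comp_real (rderiv_graph l (target_analytic Vp))
  (fun j => cpseries_rderiv (hc j))) _ => i; rewrite mxE; apply: eq_bigr => j _.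
exact: (congr2 *%R (esym (Jh i j)) erefl).
Qed.

(** The chain rule factors the differential of the target graph along [h] through
    [graph_diff phi p], which gives the forward implication; [T01_transport] upgrades it to an
    equivalence. *)
Lemma restricts_cr_map : restricts_biholomorphism_on phi phi' V h -> cr_map_on phi phi' V h.
Proof.
move=> res p Vp; have [U [H [[K [oU _ Hd _ _]] Up HE]]] := res p Vp.
have php := source_analytic Vp.
have nE : \forall q \near p, H (graph_map phi q) = graph_map phi' (h q).
  by apply: filterS2 (near_graph php oU Up) (diffeo_near hV Vp) => q Uq Vq; exact: HE.
have [gen TL] := source_generic cls VD Vp.
have [gen' TL'] := target_generic cls' VD' hV Vp.
have GD X : T01 phi p X -> T01 phi' (h p) (X *m cjacobian h p).
  move=> TX; rewrite /T01 /= -mulmxA; apply/rowP => l.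
  have [DH HD] := rderiv_holomorphic l php (Hd _ Up).
  have nl : \forall q \near p, (H (graph_map phi q) : 'rV[C]_4) 0 l = graph_map phi' (h q) 0 l.
    by apply: filterS nE => q ->.
  have H1 := rderiv_near_eq nl HD.
  have H2 := rderiv_graph_comp l Vp.
  have E i : (cjacobian h p *m graph_diff phi' (h p)) i l = \sum_j graph_diff phi p i j * DH j l.
    by rewrite -(rderiv_cpartial5 i H1) (rderiv_cpartial5 i H2).
  rewrite mxE [RHS]mxE (eq_bigr (fun i => X 0 i * (graph_diff phi p *m DH) i l)); last first.
    by move=> i _; rewrite E [in RHS]mxE.
  transitivity ((X *m (graph_diff phi p *m DH)) 0 l); last by rewrite mulmxA (TX : _ *m _ = 0) mul0mx mxE.
  by rewrite mxE.
have TLJ := GD _ TL; have LJ := T01_line gen' TL' TLJ.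
apply: (T01_transport cls cls' VD VD' hV Vp _ LJ).
apply/eqP => c0; rewrite c0 scale0r in LJ.
have := congr1 (mulmxr (invmx (cjacobian h p))) LJ.
rewrite /= mulmxK ?(diffeo_unit hV Vp)// mul0mx => /(congr1 (fun v : 'rV_5 => v 0 0)).
by rewrite fieldLbar0 mxE => /eqP; rewrite invr_eq0 pnatr_eq0.
Qed.

(** The coordinates of [C^4] composed with the map into the target graph are annihilated by [Lbar],
    so [cr_extension] applies to each; it remains to see that the four extensions form a local
    biholomorphism. *)
Lemma cr_map_restricts : cr_map_on phi phi' V h -> restricts_biholomorphism_on phi phi' V h.
Proof.
move=> cr p Vp; have php := source_analytic Vp; have phn := diffeo_near hV Vp.
have [gen TL] := source_generic cls VD Vp.
have [gen' TL'] := target_generic cls' VD' hV Vp.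
pose f l (q : pt) : C := graph_map phi' (h q) 0 l.
have fp l : cpseries_at (f l) p.
  apply: (cpseries_comp_real (graph_map_analytic l (target_analytic Vp))) => j.
  by apply: analytic_cpseries; exact: (diffeo_analytic hV Vp).
have fL l : \forall q \near p, \sum_i fieldLbar phi q 0 i * cpartial i (f l) q = 0.
  apply: filterS phn => q Vq; have [_ TLq] := source_generic cls VD Vq.
  have := (cr q Vq _).1 TLq; rewrite /T01 /= -mulmxA => /(congr1 (fun v : 'rV_4 => v 0 l)).
  rewrite mxE [X in _ = X -> _]mxE => e; rewrite -[RHS]e; apply: eq_bigr => i _.
  exact: (congr2 *%R erefl (rderiv_cpartial5 i (rderiv_graph_comp l Vq))).
have pTn : \forall q \near p, vanalytic_at phi q /\ T01 phi q (fieldLbar phi q).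
  by apply: filterS phn => q Vq; split; [exact: source_analytic|have [] := source_generic cls VD Vq].
have /choice[X XP] l : exists X : R * (('I_4 -> C) -> C) * R,
    [/\ 0 < X.1.1, majorized (fun=> X.1.1) X.1.2 X.2 &
      \forall q \near p, f l q = X.1.2 (fun j => graph_map phi q 0 j - graph_map phi p 0 j)].
  by have [r [F [a ?]]] := cr_extension php gen pTn (fp l) (fL l); exists (r, F, a).
pose r := \big[Num.min/1]_l (X l).1.1.
have r0 : 0 < r.
  by rewrite /r; elim/big_ind: _ => // [x y ? ?|l _]; [rewrite lt_min; apply/andP|have [] := XP l].
pose F l := (X l).1.2.
have Fm l : majorized (fun=> r) (F l) (X l).2.
  have [_ + _] := XP l; apply: majorized_restrict => [_|_]; first exact: ltW.
  exact: bigmin_le_cond.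
have fF : \forall q \near p, forall l, f l q = F l (fun j => graph_map phi q 0 j - graph_map phi p 0 j).
  by apply: near_forall => l; have [] := XP l.
have F0 l : F l (fun=> 0) = (graph_map phi' (h p) : 'rV[C]_4) 0 l.
  rewrite -[RHS]/(f l p) (near_at fF l); congr (F l); apply/funext => j.
  by rewrite subrr.
have r2 : 0 < r / 2 by rewrite divr_gt0.
have /choice[DF FD] l : exists DF : 'I_4 -> C, cderiv (F l) (fun=> 0) DF.
  have [|DF [? [_ dF]]] := majorized_cderiv (fun _ : 'I_4 => ltW r2) (fun=> r2) (f := F l) (a := (X l).2).
    by rewrite (_ : (fun=> _) = fun=> r)//; apply/funext => _; rewrite -splitr.
  by exists (fun i => DF i (fun=> 0)); apply: dF; exact: polydisc0 (fun _ : 'I_4 => ltW r2).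
pose M : 'M[C]_4 := \matrix_(j, l) DF l j.
have GM : graph_diff phi p *m M = cjacobian h p *m graph_diff phi' (h p).
  apply/matrixP => i l.
  have gd j : rderiv (fun q => graph_map phi q 0 j - graph_map phi p 0 j) p (fun i => graph_diff phi p i j).
    apply: rderiv_ext (rderivB (rderiv_graph j php) (rderiv_cst _ p)) _ => k.
    by rewrite subr0.
  have FD' : cderiv (F l) (fun j => graph_map phi p 0 j - graph_map phi p 0 j) (DF l).
    by rewrite (_ : (fun j => _) = fun=> 0)//; apply/funext => j; rewrite subrr.
  have cD := rderiv_comp_complex FD' gd.
  have fE : \forall q \near p, F l (fun j => graph_map phi q 0 j - graph_map phi p 0 j) = f l q.
    by apply: filterS fF => q ->.
  have := rderiv_cpartial5 i (rderiv_near_eq fE cD).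
  rewrite (rderiv_cpartial5 i (rderiv_graph_comp l Vp)) => ->.
  by rewrite mxE; apply: eq_bigr => j _; rewrite [M _ _]mxE.
(* By genericity of the target every row is a combination of the rows of [graph_diff phi' (h p)],
   and by [GM] these lie in the row space of [M]. *)
have uM : M \in unitmx.
  rewrite -row_full_unit -sub1mx; apply/row_subP => l.
  have [a [b]] := gen' (row l 1%:M); rewrite scalemxAl -mulmxDl => ->.
  set c := (_ + _ : 'rV[C]_5).
  have -> : c *m graph_diff phi' (h p) = (c *m invmx (cjacobian h p) *m graph_diff phi p) *m M.
    by rewrite -mulmxA GM mulmxA mulmxKV// (diffeo_unit hV Vp).
  exact: submxMl.
have /nbhs_box[d d0 dF] : \forall q \near p, V q /\ forall l, f l q = F l (fun j => graph_map phi q 0 j - graph_map phi p 0 j).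
  exact: filterI.
have [|U [H [bih Up HF]]] := @local_biholomorphism R F r d (fun l => (X l).2) M
  (graph_map phi p) (graph_map phi' (h p)) r0 d0 uM Fm F0.
  by move=> l; rewrite (_ : (fun j => M j l) = DF l)//; apply/funext => j; rewrite mxE.
exists U, H; split=> // q Vq Uq; have [box HE] := HF _ Uq.
have sE (u v : 'rV[C]_4) j : (u - v) 0 j = u 0 j - v 0 j by rewrite !mxE.
(* A point of the graph determines its parameters: [z] gives [x] and [y], the real parts of the
   [w_j] give [u]. A point in the box of size [d] thus has parameters within [d] of [p], where [f]
   and [F] are known to agree. *)
have gq : forall i, `|(q - p) 0 i| <= d.
  have bx j : cabs (graph_map phi q 0 j - graph_map phi p 0 j) <= d.
    by rewrite -sE; exact: ltW (box j).
  move=> i; case: (@split_ordP 2 3 i) => k ->.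
    have := bx (lshift 3 0 : 'I_(1 + 3)); rewrite /graph_map !(@row_mxEl _ 1 1 3) !mxE.
    have [->|->] : k = 0 \/ k = 1.
      by case: k => -[|[|//]] ?; [left|right]; exact: val_inj.
    - rewrite (_ : lshift 3 (0 : 'I_2) = 0 :> 'I_5); last exact: val_inj.
      exact: le_trans (cabs_Re _).
    - rewrite (_ : lshift 3 (1 : 'I_2) = 1 :> 'I_5); last exact: val_inj.
      exact: le_trans (cabs_Im _).
  have := bx (rshift 1 k : 'I_(1 + 3)); rewrite /graph_map !(@row_mxEr _ 1 1 3) !mxE.
  exact: le_trans (cabs_Re _).
have [_ fE] := dF _ gq; rewrite (_ : p + (q - p) = q) in fE; last by rewrite addrC subrK.
apply/rowP => l; rewrite -[RHS]/(f l q) fE HE; congr (F l); apply/funext => j.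
exact: sE.
Qed.

End ExtrinsicIntrinsic.

Theorem theorem1p2 (R : realType) :
  exists Theta : ('rV[R]_5 -> 'rV[R]_3) -> ('rV[R]_5 -> R[i]) -> coframe R,
  [/\ (* near each point where R is nonzero, the choice of A_0 is possible,
         and finite *)
      forall (D : set 'rV[R]_5) (phi : 'rV[R]_5 -> 'rV[R]_3),
        class_III1 D phi -> (exists2 p, D p & fundR phi p != 0) ->
        forall p, locus_R_neq0 D phi p ->
        exists (V : set 'rV[R]_5) (k : nat) (A : 'I_k.+1 -> 'rV[R]_5 -> R[i]),
          [/\ open V, V p, V `<=` locus_R_neq0 D phi,
              forall j, choice_A0 phi V (A j) &
              forall (W : set 'rV[R]_5) (A0 : 'rV[R]_5 -> R[i]),
                open W -> W p -> choice_A0 phi W A0 ->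
                exists j, \forall q \near p, A0 q = A j q],
      (* Theta phi A_0 is determined locally by M and A_0 *)
      forall (phi1 phi2 : 'rV[R]_5 -> 'rV[R]_3) (A1 A2 : 'rV[R]_5 -> R[i])
          (V : set 'rV[R]_5),
        open V -> (forall p, V p -> phi1 p = phi2 p /\ A1 p = A2 p) ->
        forall p, V p -> coframe_eq_at (Theta phi1 A1) (Theta phi2 A2) p,
      (* Theta phi A_0 is a coframe on M *)
      forall (D : set 'rV[R]_5) (phi : 'rV[R]_5 -> 'rV[R]_3)
          (V : set 'rV[R]_5) (A0 : 'rV[R]_5 -> R[i]),
        class_III1 D phi -> (exists2 p, D p & fundR phi p != 0) ->
        open V -> V `<=` locus_R_neq0 D phi -> choice_A0 phi V A0 ->
        parallelism_on V (Theta phi A0)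
    & (* the coframe solves the extrinsic and the intrinsic equivalence
         problems *)
      forall (D D' : set 'rV[R]_5) (phi phi' : 'rV[R]_5 -> 'rV[R]_3)
          (V V' : set 'rV[R]_5) (h : 'rV[R]_5 -> 'rV[R]_5),
        class_III1 D phi -> (exists2 p, D p & fundR phi p != 0) ->
        class_III1 D' phi' -> (exists2 p, D' p & fundR phi' p != 0) ->
        V `<=` locus_R_neq0 D phi -> V' `<=` locus_R_neq0 D' phi' ->
        analytic_diffeo V V' h ->
        let carried :=
          forall p, V p ->
          exists (W : set 'rV[R]_5) (A0 A0' : 'rV[R]_5 -> R[i]),
            [/\ open W /\ W p, W `<=` V, choice_A0 phi W A0,
                choice_A0 phi' (h @` W) A0' &
                forall q, W q ->
                  carries_at h (Theta phi A0) (Theta phi' A0') q] in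
        (restricts_biholomorphism_on phi phi' V h <-> carried) /\
        (cr_map_on phi phi' V h <-> carried)].
Proof.
exists adapted_coframe; split.
- by move=> D phi cls _ p lp; exact: (choice_exists cls lp).
- by move=> phi1 phi2 A1 A2 V oV e p Vp; exact: (adapted_coframe_local oV e Vp).
- by move=> D phi V A0 cls _ oV VD chA; exact: (adapted_parallelism cls oV VD chA).
move=> D D' phi phi' V V' h cls _ cls' _ VD VD' hV carried; split; split.
- move=> res; apply: (cr_map_carried cls cls' VD VD' hV).
  exact: (restricts_cr_map cls cls' VD VD' hV res).
- move=> car; apply: (cr_map_restricts cls cls' VD VD' hV).
  exact: (carried_cr_map cls cls' VD VD' hV car).
- exact: (cr_map_carried cls cls' VD VD' hV).
- exact: (carried_cr_map cls cls' VD VD' hV).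
Qed.
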